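(* Let $X$ be a CB process with branching mechanism $\Phi$ given by $(\alpha,\beta,\pi)$, with $\pi\neq0$, and let $x>0$. For $r\in(0,\infty)$ put $$\Phi^r(\lambda)=\left(\alpha+\int_{(r,\infty)}\theta\,\pi(d\theta)\right)\lambda+\beta\lambda^2+\int_{(0,r]}(e^{-\lambda\theta}-1+\lambda\theta)\,\pi(d\theta).$$ (i) If $\beta>0$ or $\int_{(0,\infty)}\theta\,\pi(d\theta)>-\alpha$, then for any $r\in(0,\infty)$ with $\pi(r,\infty)>0$, $$\mathbf{P}_x\left[\sup_{s\in(0,\infty)}\Delta X_s\le r\right]=\exp\left(-x\,(\Phi^r)^{-1}(\pi(r,\infty))\right).$$ (ii) If $\beta=0$ and $\int_{(0,\infty)}\theta\,\pi(d\theta)\le-\alpha$, then $\mathbf{P}_x[\sup_{s\in(0,\infty)}\Delta X_s\le r]=0$ for any $r\in(0,\infty)$ with $\pi(r,\infty)>0$. (iii) If $\alpha\ge0$, then the identity in (i) is valid for every $r\in(0,\infty)$, even if $\pi(r,\infty)=0$.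
   Context: A branching mechanism is a function $\Phi(\lambda)=\alpha\lambda+\beta\lambda^2+\int_{(0,\infty)}(e^{-\lambda\theta}-1+\lambda\theta)\,\pi(d\theta)$, $\lambda\ge0$, with $\alpha\in\mathbb{R}$, $\beta\ge0$ and $\pi$ a $\sigma$-finite measure on $(0,\infty)$ (the Lévy measure) with $\int_{(0,\infty)}(\theta\wedge\theta^2)\,\pi(d\theta)<\infty$; the case $\Phi\equiv0$ is excluded. A CB process with branching mechanism $\Phi$ is an rcll $[0,\infty)$-valued Markov process $X=(X_t)_{t\ge0}$ such that, writing $\mathbf{P}_x$ for its law when $X_0=x$ and $\mathbf{E}_x$ for the expectation, $\mathbf{E}_x[e^{-\lambda X_t}]=e^{-xv_t(\lambda)}$ for $\lambda\ge0$, where $v_t(\lambda)$ is the unique locally bounded nonnegative solution of $v_t(\lambda)=\lambda-\int_0^t\Phi(v_s(\lambda))\,ds$. $\Delta X_s=X_s-X_{s-}$ for $s>0$. For a branching mechanism $\Psi$ taking a positive value somewhere on $(0,\infty)$ (equivalently, whose parameters satisfy the condition in (i)), $\Psi^{-1}:[0,\infty)\to[q,\infty)$ denotes the inverse of $\Psi$ restricted to $[q,\infty)$, where $q\ge0$ is the largest solution of $\Psi(\lambda)=0$. The condition in (i) holds for $\Phi$ if and only if it holds for $\Phi^r$. *)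

(* Defs.v *)
From HB Require Import structures.
From mathcomp Require Export all_boot all_order all_algebra.
From mathcomp Require Export all_classical all_reals all_analysis.
From mathcomp Require Export measurable_realfun.
Export Order.TTheory GRing.Theory Num.Theory.
Export numFieldNormedType.Exports.

Set Implicit Arguments.
Unset Strict Implicit.
Unset Printing Implicit Defensive.

Local Open Scope ring_scope.
Local Open Scope classical_set_scope.

(* A measure on (0,oo) is encoded as a measure on R that does not charge
   ]-oo, 0] (see [branching_triple]). *)
Notation levy_measure R := {sigma_finite_measure set (measurableTypeR R) -> \bar R}.

Section branching_mechanisms.
Context {R : realType}.
Implicit Types (alpha beta lambda r y : R) (pi : levy_measure R) (Psi : R -> R).

Definition branching_mechanism alpha beta pi lambda : R :=
  alpha * lambda + beta * lambda ^+ 2 +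
  \int[pi]_(theta in `]0, +oo[)
    (expR (- (lambda * theta)) - 1 + lambda * theta).

Record branching_triple alpha beta pi : Prop := BranchingTriple {
  bt_beta_ge0 : 0 <= beta ;
  bt_support : pi `]-oo, 0] = 0%E ;
  bt_integrable :
    (\int[pi]_(theta in `]0%R, +oo[) (Num.min theta (theta ^+ 2))%:E < +oo)%E ;
  bt_neq0 : exists2 lambda : R, 0 <= lambda &
    branching_mechanism alpha beta pi lambda != 0 }.

Definition truncated_mechanism alpha beta pi r lambda : R :=
  (alpha + \int[pi]_(theta in `]r, +oo[) theta) * lambda +
  beta * lambda ^+ 2 +
  \int[pi]_(theta in `]0, r])
    (expR (- (lambda * theta)) - 1 + lambda * theta).

(* The largest solution of [Psi lambda = 0] on [0, +oo[ : for a branching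
   mechanism taking a positive value, the zero set is closed, bounded and
   contains 0, so that the supremum is attained. *)
Definition largest_zero Psi : R :=
  sup [set lambda : R | 0 <= lambda /\ Psi lambda = 0].

Definition branching_inverse Psi : R -> R :=
  'pinv_(fun=> 0) `[largest_zero Psi, +oo[ Psi.

(* [v t lambda] stands for v_t(lambda); only [0 <= t] and [0 <= lambda] are
   constrained. Integrability is what gives the integral equation a meaning;
   it makes [v ^~ lambda] continuous. *)
Definition cumulant_semigroup Psi (v : R -> R -> R) : Prop :=
  forall lambda : R, 0 <= lambda ->
  [/\ forall t : R, 0 <= t -> 0 <= v t lambda,
      forall t : R, 0 <= t -> exists M : R, forall s : R, 0 <= s <= t -> v s lambda <= M,
      forall t : R, 0 <= t ->
        lebesgue_measure.-integrable `[0, t] (fun s => (Psi (v s lambda))%:E)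
    & forall t : R, 0 <= t ->
        v t lambda = lambda - \int[lebesgue_measure]_(s in `[0, t]) Psi (v s lambda)].

End branching_mechanisms.

Section processes.
Context {d : measure_display} {Omega : measurableType d} {R : realType}.
Implicit Types (P : R -> probability Omega R) (X : R -> Omega -> R).

(* Only the values at times [0 <= t] of a process are relevant. *)
Definition natural_filtration X (t : R) : set (set Omega) :=
  <<s [set A | exists (s : R) (B : set R),
         [/\ 0 <= s <= t, measurable B & A = X s @^-1` B]] >>.

(* [P x], for [0 <= x], is the law under which the process starts at [x]. *)
Record markov_process P X : Prop := MarkovProcess {
  mp_measurable : forall t : R, 0 <= t -> measurable_fun setT (X t) ;
  mp_ge0 : forall (t : R) (w : Omega), 0 <= t -> 0 <= X t w ;
  mp_start : forall x : R, 0 <= x -> P x (X 0 @^-1` [set x]) = 1%E ;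
  mp_kernel : forall (t : R) (B : set R), 0 <= t -> measurable B ->
    measurable_fun (`[0, +oo[ : set R) (fun y : R => P y (X t @^-1` B)) ;
  mp_markov : forall (x s t : R) (A : set Omega) (B : set R),
    0 <= x -> 0 <= s -> 0 <= t ->
    natural_filtration X s A -> measurable B ->
    P x (A `&` X (s + t) @^-1` B) =
    (\int[P x]_(w in A) P (X s w) (X t @^-1` B))%E }.

Definition rcll (f : R -> R) : Prop :=
  (forall t : R, 0 <= t -> f u @[u --> t^'+] --> f t) /\
  (forall t : R, 0 < t -> cvg (f u @[u --> t^'-])).

Record CB_process Psi P X : Prop := CBProcess {
  cb_markov : markov_process P X ;
  cb_rcll : forall w : Omega, rcll (X ^~ w) ;
  cb_laplace : exists2 v, cumulant_semigroup Psi v &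
    forall x t lambda : R, 0 <= x -> 0 <= t -> 0 <= lambda ->
    ('E_(P x) [fun w => expR (- (lambda * X t w))] =
     (expR (- (x * v t lambda)))%:E)%E }.

Definition jump X (s : R) (w : Omega) : R :=
  X s w - lim (X u w @[u --> s^'-]).

Definition sup_jump X (w : Omega) : \bar R :=
  ereal_sup [set (jump X s w)%:E | s in `]0, +oo[].

End processes.

(* Main.v *)
(* Write F(l) = pi(r, oo) - Phi^r(l) = int_(r, oo) e^(-l theta) pi(d theta) - Phi(l).
   If Z_t denotes the indicator that X has no jump larger than r up to time t, then
   formally d/dt E[Z_t e^(-l X_t)] = - F(l) E[Z_t X_t e^(-l X_t)]. Hence F(l) <= 0
   gives P_x[no large jump] >= e^(-l x). If F(0) > 0, the choice l = 0 shows that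
   E[Z_t X_t] is integrable in t, hence small for some large t; comparing e^(-l X_t)
   with 1 at such times, F(l) > 0 gives P_x[no large jump] <= e^(-l x). Convexity of
   Phi^r, which vanishes at 0, locates the sign change of F at (Phi^r)^-1(pi(r, oo)).

   The derivative is made rigorous in discrete time. The indicator is replaced by the
   product over a grid of mesh h of 1 - rho(w), where w = exp(- increment) and rho is
   a piecewise linear cutoff that vanishes near w = 1. On paths bounded by K one has
   0 <= w <= e^K, so rho(w) = (1 - w)^2 g(w) with g uniformly approximated by
   polynomials; the conditional expectation of e^(-l X) w^i (1 - w)^2 is given by the
   Laplace transform alone, up to O(h^2), as a second difference of Phi. Letting h
   tend to 0 recovers the jumps because the paths are right-continuous with left
   limits. *)
Require Import Defs.
From mathcomp Require Import ring lra.

Set Implicit Arguments.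
Unset Strict Implicit.
Unset Printing Implicit Defensive.

Local Open Scope ring_scope.
Local Open Scope classical_set_scope.

(** * Elementary estimates and polynomial approximation *)

(** A uniform polynomial error [e] at each of the [D / h] grid steps would not sum to something
    small. Factoring out [(1 - w)^2] weights that error by a quantity of mean O(h), and then it
    does. The same factor produces second differences of Phi, in which drift and compensator cancel,
    and the integrals against [pi] converge because [(1 - e^-t)^2 <= min (t, t^2)]; the term in
    [beta] that remains is multiplied by [g 1 = 0]. The cap [K] makes the moments [w^i] bounded and
    the O(h^2) uniform in the state. It costs nothing in the upper bound, where killing paths only
    helps, and [e^(-l K)] in the lower one. The cutoff acts strictly above [r], since jumps equal to
    [r] are allowed. The cut version of F is therefore at most F, which suits the lower bound as it
    stands, whereas the upper bound loses up to [pi ]r, r_j]] and needs the strict inequality F(l) >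
    0 to absorb the loss; (i) is then reached by letting l increase to the inverse. *)

Section exponential_estimates.
Context {R : realType}.
Implicit Types (x y t l m u S L : R).

Lemma expRN_le_inv x : 0 <= x -> expR (- x) <= (1 + x)^-1.
Proof.
move=> x0; rewrite expRN lef_pV2 ?posrE ?expR_gt0//; last lra.
exact: expR_ge1Dx.
Qed.

(** From [expR (- u) >= 1 - u] one gets [expR u <= 1 / (1 - u)], hence a remainder of at most
    [u^2 / (1 - u)]; the condition on [u] turns the denominator into the factor 2. *)
Lemma expR_sub1Dx_le u : `|u| <= 2^-1 -> `|expR u - 1 - u| <= 2 * u ^+ 2.
Proof.
rewrite ler_norml => /andP[u1 u2].
have h0 : 0 <= expR u - 1 - u by have := expR_ge1Dx u; lra.
rewrite ger0_norm//.
have h1 : expR u * (1 - u) <= 1.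
  rewrite -[leRHS](expRxMexpNx_1 u) ler_pM2l ?expR_gt0//.
  by have := expR_ge1Dx (- u); lra.
nra.
Qed.

(** Since [expR (- x) <= 1 / (1 + x)], the middle term is at most [x^2 / (1 + x)], which is below
    both [x] and [x^2]. *)
Lemma expRN_sub1_le_min x : 0 <= x ->
  0 <= expR (- x) - 1 + x <= Num.min x (x ^+ 2).
Proof.
move=> x0; have h1 := expR_ge1Dx (- x); have h2 := expRN_le_inv x0.
have h3 : (1 + x)^-1 * (1 + x) = 1 by rewrite mulVf//; lra.
set v := (1 + x)^-1 in h2 h3.
apply/andP; split; first lra.
have h4 : 0 <= v by rewrite invr_ge0; lra.
by rewrite le_min; apply/andP; split; nra.
Qed.

(** Dominates increments of the Levy kernel in the exponent by the one function that [pi]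
    integrates. The difference is [(m - l) t - (e^(-l t) - e^(-m t))], and [e^(-l t) - e^(-m t) >=
    e^(-m t) (m - l) t] leaves at most [(1 - e^(-m t)) (m - l) t], which is below [(m - l) t] and
    below [m (m - l) t^2]. *)
Lemma expRN_sub1_lip l m t : 0 <= t -> 0 <= l -> l <= m ->
  0 <= (expR (- (m * t)) - 1 + m * t) - (expR (- (l * t)) - 1 + l * t)
    <= (m - l) * (1 + m) * Num.min t (t ^+ 2).
Proof.
move=> t0 l0 lm.
have m0 : 0 <= m by lra.
have e1 : expR (- (l * t)) = expR (- (m * t)) * expR ((m - l) * t).
  by rewrite -expRD; congr expR; ring.
have e2 : expR (- (m * t)) = expR (- (l * t)) * expR (- ((m - l) * t)).
  by rewrite -expRD; congr expR; ring.
have d0 : 0 <= (m - l) * t by rewrite mulr_ge0//; lra.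
have a1 := expR_ge1Dx ((m - l) * t).
have a2 := expR_ge1Dx (- ((m - l) * t)).
have a3 := expR_ge1Dx (- (m * t)).
have mt0 : 0 <= m * t by rewrite mulr_ge0.
have a4 : expR (- (m * t)) <= 1 by rewrite -expR0 ler_expR oppr_le0.
have a5 : expR (- (l * t)) <= 1 by rewrite -expR0 ler_expR oppr_le0 mulr_ge0.
have p1 := expR_gt0 (- (m * t)).
have p2 := expR_gt0 (- (l * t)).
apply/andP; split.
  nra.
rewrite minr_pMr; last by rewrite mulr_ge0//; lra.
rewrite le_min.
have b1 : expR (- (l * t)) - expR (- (m * t)) >= expR (- (m * t)) * ((m - l) * t).
  rewrite e1; nra.
apply/andP; split.
  suff : (m - l) * t <= (m - l) * (1 + m) * t by nra.
  nra.
suff : (1 - expR (- (m * t))) * ((m - l) * t) <= (m - l) * (1 + m) * t ^+ 2 by nra.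
have : (1 - expR (- (m * t))) * ((m - l) * t) <= (m * t) * ((m - l) * t).
  by rewrite ler_wpM2r//; lra.
have : 0 <= (m - l) * t ^+ 2 by rewrite mulr_ge0 ?sqr_ge0//; lra.
nra.
Qed.

(** Convexity between 0 and [x], from the tangent line at [t * x]: with [E = expR (- (t * x))], both
    endpoint values are [E] times an exponential, and the two exponents [t x] and [- (1 - t) x] have
    weighted mean 0. *)
Lemma expRN_convex x t : 0 <= t <= 1 -> expR (- (t * x)) <= 1 - t + t * expR (- x).
Proof.
move=> /andP[t0 t1].
pose y := - (t * x).
have a1 := expR_ge1Dx (t * x).
have a2 := expR_ge1Dx (- ((1 - t) * x)).
have e1 : 1 = expR (- (t * x)) * expR (t * x) by rewrite mulrC expRxMexpNx_1.
have e2 : expR (- x) = expR (- (t * x)) * expR (- ((1 - t) * x)).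
  by rewrite -expRD; congr expR; ring.
have p1 := expR_gt0 (- (t * x)).
set E := expR (- (t * x)) in e1 e2 p1 *.
have : E * ((1 - t) * expR (t * x) + t * expR (- ((1 - t) * x))) >= E.
  rewrite -[leLHS]mulr1 ler_pM2l//.
  nra.
have -> : E * ((1 - t) * expR (t * x) + t * expR (- ((1 - t) * x))) =
  (1 - t) * (E * expR (t * x)) + t * (E * expR (- ((1 - t) * x))) by ring.
by rewrite -e1 -e2 mulr1.
Qed.

Lemma normr_expRN_sub_le x y : 0 <= x -> 0 <= y -> `|expR (- x) - expR (- y)| <= `|x - y|.
Proof.
wlog xy : x y / x <= y.
  move=> H x0 y0; have [/H->//|/ltW yx] := leP x y.
  by rewrite distrC (distrC x); apply: H.
move=> x0 y0.
rewrite ger0_norm; last by rewrite subr_ge0 ler_expR lerN2.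
rewrite distrC ger0_norm ?subr_ge0//.
have e1 : expR (- y) = expR (- x) * expR (- (y - x)).
  by rewrite -expRD; congr expR; ring.
have p1 : expR (- x) <= 1 by rewrite -expR0 ler_expR oppr_le0.
have p2 := expR_gt0 (- x).
have a := expR_ge1Dx (- (y - x)).
rewrite e1; nra.
Qed.

End exponential_estimates.

(** * Bernstein polynomials and uniform approximation of Lipschitz functions *)

Section bernstein.
Context {R : realType}.
Implicit Types (x y : R) (f : R -> R).

Definition bernstein f (n : nat) : {poly R} :=
  \sum_(k < n.+1) ('C(n, k)%:R * f (k%:R / n%:R)) *: ('X ^+ k * (1 - 'X) ^+ (n - k)).

Lemma bernstein_weight_sum n x :
  \sum_(k < n.+1) 'C(n, k)%:R * (x ^+ k * (1 - x) ^+ (n - k)) = 1.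
Proof.
rewrite -[RHS](expr1n _ n) -[in RHS](subrK x 1) exprDn.
by apply: eq_bigr => i _; rewrite -[RHS]mulr_natl [x ^+ i * _]mulrC.
Qed.

Lemma bernstein_weight_mean n x :
  \sum_(k < n.+1) k%:R * ('C(n, k)%:R * (x ^+ k * (1 - x) ^+ (n - k))) = n%:R * x.
Proof.
case: n => [|n]; first by rewrite big_ord_recl big_ord0 !mul0r addr0.
rewrite big_ord_recl mul0r add0r.
transitivity (n.+1%:R * x * \sum_(k < n.+1) 'C(n, k)%:R * (x ^+ k * (1 - x) ^+ (n - k))); last first.
  by rewrite bernstein_weight_sum mulr1.
rewrite mulr_sumr.
apply: eq_bigr => i _; rewrite lift0 subSS.
rewrite mulrA -natrM -mul_bin_diag natrM exprS; ring.
Qed.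

(** The factorial moment, rather than the second moment, is the form in which the absorption
    identity [k C(n, k) = n C(n - 1, k - 1)] can be applied again, reducing it to the mean for
    [n - 1]. *)
Lemma bernstein_weight_mean2 n x :
  \sum_(k < n.+1) (k%:R * (k%:R - 1)) * ('C(n, k)%:R * (x ^+ k * (1 - x) ^+ (n - k)))
  = n%:R * (n%:R - 1) * x ^+ 2.
Proof.
case: n => [|n]; first by rewrite big_ord_recl big_ord0 !mul0r addr0.
rewrite big_ord_recl mul0r mul0r add0r.
transitivity (n.+1%:R * x *
   \sum_(k < n.+1) k%:R * ('C(n, k)%:R * (x ^+ k * (1 - x) ^+ (n - k)))).
  rewrite mulr_sumr; apply: eq_bigr => i _; rewrite lift0 subSS.
  rewrite (_ : i.+1%:R - 1 = i%:R); last by rewrite -natr1 addrK.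
  have : (i.+1%:R * 'C(n.+1, i.+1)%:R = n.+1%:R * 'C(n, i)%:R :> R).
    by rewrite -!natrM mul_bin_diag.
  move=> e; rewrite exprS.
  transitivity (i%:R * (i.+1%:R * 'C(n.+1, i.+1)%:R) * (x * x ^+ i * (1 - x) ^+ (n - i))).
    by ring.
  by rewrite e; ring.
rewrite bernstein_weight_mean -natr1; ring.
Qed.

Lemma bernstein_weight_variance n x :
  \sum_(k < n.+1) (k%:R - n%:R * x) ^+ 2 * ('C(n, k)%:R * (x ^+ k * (1 - x) ^+ (n - k)))
  = n%:R * x * (1 - x).
Proof.
set b := fun k : 'I_n.+1 => 'C(n, k)%:R * (x ^+ k * (1 - x) ^+ (n - k)).
transitivity (\sum_(k < n.+1) (k%:R * (k%:R - 1) * b k +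
   ((1 - 2 * (n%:R * x)) * (k%:R * b k) + (n%:R * x) ^+ 2 * b k))).
  by apply: eq_bigr => k _; rewrite -/(b k); ring.
rewrite !big_split/= -!mulr_sumr.
rewrite bernstein_weight_sum bernstein_weight_mean bernstein_weight_mean2; ring.
Qed.

Lemma horner_bernstein f n x : (bernstein f n).[x] =
  \sum_(k < n.+1) f (k%:R / n%:R) * ('C(n, k)%:R * (x ^+ k * (1 - x) ^+ (n - k))).
Proof.
rewrite /bernstein horner_sum; apply: eq_bigr => k _.
rewrite hornerZ hornerM !horner_exp hornerD hornerN hornerX hornerC.
by rewrite -mulrA mulrCA.
Qed.

(* With [d = k/n - x], the Lipschitz bound [L |d| <= L (e + d^2 / e)] reduces the
   error to the variance of the binomial distribution. *)
Lemma bernstein_approx f (L e : R) : 0 < L -> 0 < e ->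
  (forall x y, 0 <= x <= 1 -> 0 <= y <= 1 -> `|f x - f y| <= L * `|x - y|) ->
  exists p : {poly R}, forall x, 0 <= x <= 1 -> `|p.[x] - f x| <= e.
Proof.
move=> L0 e0 fL.
(* [h] is the scale of deviation for which [L * h = e / 2]; [n] is then large enough for the
   variance term, at most [L / (h n)], to stay below the other half. *)
pose h := e / (2 * L).
have h0 : 0 < h by rewrite divr_gt0// mulr_gt0.
pose n := (Num.truncn (L / (h * e) * 2)).+1.
have n0 : 0 < n%:R :> R by rewrite ltr0n.
have nn : L / (h * e) * 2 < n%:R by rewrite truncnS_gt.
exists (bernstein f n) => x x01.
have /andP[x0 x1] := x01.
rewrite horner_bernstein -[f x]mulr1.
rewrite (_ : f x * 1 = \sum_(k < n.+1) f x * ('C(n, k)%:R * (x ^+ k * (1 - x) ^+ (n - k)))); last first.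
  by rewrite -mulr_sumr bernstein_weight_sum.
rewrite -sumrB.
apply: (le_trans (ler_norm_sum _ _ _)).
set b := fun k : nat => 'C(n, k)%:R * (x ^+ k * (1 - x) ^+ (n - k)).
have b0 k : 0 <= b k by rewrite !mulr_ge0// exprn_ge0// subr_ge0.
apply: (@le_trans _ _ (\sum_(k < n.+1) (L * h * b k +
   (L / h / n%:R ^+ 2) * ((k%:R - n%:R * x) ^+ 2 * b k)))).
  apply: ler_sum => k _.
  rewrite -/(b k) -mulrBl normrM (ger0_norm (b0 k)).
  rewrite [leRHS](_ : _ = (L * h + (L / h / n%:R ^+ 2) * (k%:R - n%:R * x) ^+ 2) * b k); last by ring.
  apply: ler_wpM2r => //.
  apply: (le_trans (fL _ _ _ _)) => //.
    by rewrite divr_ge0//= ler_pdivrMr// mul1r ler_nat -ltnS.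
  set d := k%:R / n%:R - x.
  have -> : k%:R - n%:R * x = n%:R * d.
    by rewrite /d mulrBr mulrCA divff ?mulr1// lt0r_neq0.
  have -> : L / h / n%:R ^+ 2 * (n%:R * d) ^+ 2 = L * (h^-1 * d ^+ 2).
    by rewrite exprMn; field; rewrite !lt0r_neq0.
  rewrite -mulrDr ler_pM2l//.
  rewrite -(real_normK (num_real d)).
  have := normr_ge0 d; move: `|d| => a a0.
  rewrite -(ler_pM2l h0) mulrDr mulVKf ?lt0r_neq0//.
  nra.
rewrite big_split/= -!mulr_sumr bernstein_weight_sum bernstein_weight_variance mulr1.
have -> : L * h = e / 2 by rewrite /h; field; rewrite lt0r_neq0.
rewrite [leRHS]splitr lerD2l.
have -> : L / h / n%:R ^+ 2 * (n%:R * x * (1 - x)) = (L / h / n%:R) * (x * (1 - x)).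
  by field; rewrite !lt0r_neq0.
have c0 : 0 <= L / h / n%:R by rewrite ltW// divr_gt0// divr_gt0.
apply: (@le_trans _ _ (L / h / n%:R)); first by nra.
rewrite ler_pdivrMr//.
have -> : L / h = e / 2 * (L / (h * e) * 2) by field; rewrite !lt0r_neq0.
by rewrite ler_pM2l ?divr_gt0// ltW.
Qed.

Lemma weierstrass_lipschitz f (S L e : R) : 0 < S -> 0 < L -> 0 < e ->
  (forall x y, 0 <= x <= S -> 0 <= y <= S -> `|f x - f y| <= L * `|x - y|) ->
  exists p : {poly R}, forall x, 0 <= x <= S -> `|p.[x] - f x| <= e.
Proof.
move=> S0 L0 e0 fL.
have [|p pP] := @bernstein_approx (fun x => f (S * x)) (L * S) e (mulr_gt0 L0 S0) e0.
  move=> x y x01 y01.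
  have -> : L * S * `|x - y| = L * `|S * x - S * y|.
    by rewrite -mulrBr normrM (gtr0_norm S0) mulrA.
  by apply: fL; nra.
exists (p \Po (S^-1 *: 'X)) => x x0S.
rewrite horner_comp !hornerE.
have := pP (S^-1 * x); rewrite mulrA divff ?mul1r ?lt0r_neq0//; apply.
have /andP[x0 x1] := x0S.
by rewrite mulr_ge0 ?invr_ge0 ?(ltW S0)//= mulrC ler_pdivrMr// mul1r.
Qed.

End bernstein.

(** * Integrals against the Levy measure *)

Section levy_integrals.
Context {R : realType} (pi : levy_measure R).
Implicit Types (l m r t alpha beta : R) (S : set (measurableTypeR R)) (f g : R -> R).

Let posR : set (measurableTypeR R) := `]0%R, +oo[.

Let mI (i : interval R) : @measurable _ (measurableTypeR R) [set` i].
Proof. exact: measurable_itv. Qed.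

Lemma measurable_fun_levy_kernel S l :
  measurable_fun S (fun t : R => expR (- (l * t)) - 1 + l * t).
Proof.
apply: measurable_funD; last by apply: measurable_funM => //; exact: measurable_cst.
apply: measurable_funB; last exact: measurable_cst.
by do 2 apply: measurableT_comp => //; apply: measurable_funM.
Qed.

Lemma measurable_fun_expRN_mul S l : measurable_fun S (fun t : R => expR (- (l * t))).
Proof.
by do 2 apply: measurableT_comp => //; apply: measurable_funM.
Qed.

Context (pi_int : (\int[pi]_(t in `]0%R, +oo[) (Num.min t (t ^+ 2))%:E < +oo)%E).

Lemma min_sqr_integrable : pi.-integrable posR (EFin \o (fun t : R => Num.min t (t ^+ 2))).
Proof.
apply/integrableP; split.
  by apply/measurable_EFinP; exact: measurable_minr.
apply: le_lt_trans pi_int; rewrite le_eqVlt; apply/orP; left; apply/eqP.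
apply: eq_integral => t; rewrite inE /posR/= in_itv/= andbT => t0.
by rewrite /abse/= ger0_norm// le_min ltW//= sqr_ge0.
Qed.

(** All integrability against [pi] goes through domination by a multiple of [min (t, t^2)], the only
    function assumed integrable. *)
Lemma levy_integrable S f C : measurable S -> S `<=` posR ->
  measurable_fun S f -> (forall t, S t -> `|f t| <= C * Num.min t (t ^+ 2)) ->
  pi.-integrable S (EFin \o f).
Proof.
move=> mS SP mf fC.
have iS : pi.-integrable S (EFin \o (fun t : R => Num.min t (t ^+ 2))).
  by apply: integrableS min_sqr_integrable => //; exact: measurable_itv.
have := integrableZl mS C iS.
apply: le_integrable => //.
  exact/measurable_EFinP.
move=> t St /=; rewrite lee_fin (le_trans (fC _ St))// ler_norm//.
Qed.

Lemma levy_kernel_integrable S l : measurable S -> S `<=` posR -> 0 <= l ->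
  pi.-integrable S (EFin \o (fun t : R => expR (- (l * t)) - 1 + l * t)).
Proof.
move=> mS SP l0; apply: (@levy_integrable _ _ (l * (1 + l))) => //.
  exact: measurable_fun_levy_kernel.
move=> t /SP; rewrite /posR/= in_itv/= andbT => t0.
have /andP[] := expRN_sub1_lip (ltW t0) (lexx 0) l0.
rewrite !mul0r oppr0 expR0 subrr !addr0 !subr0 => h1 h2.
by rewrite ger0_norm.
Qed.

Lemma levy_integral_lip S l m : measurable S -> S `<=` posR -> 0 <= l -> l <= m ->
  0 <= \int[pi]_(t in S) (expR (- (m * t)) - 1 + m * t)
     - \int[pi]_(t in S) (expR (- (l * t)) - 1 + l * t)
  <= (m - l) * (1 + m) * \int[pi]_(t in posR) Num.min t (t ^+ 2).
Proof.
move=> mS SP l0 lm.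
have m0 : 0 <= m by lra.
have iS : pi.-integrable S (EFin \o (fun t : R => Num.min t (t ^+ 2))).
  by apply: integrableS min_sqr_integrable => //; exact: measurable_itv.
have il := levy_kernel_integrable mS SP l0.
have im := levy_kernel_integrable mS SP m0.
rewrite -RintegralB//.
have c0 : 0 <= (m - l) * (1 + m) by rewrite mulr_ge0//; lra.
have St t : S t -> 0 <= t by move=> /SP; rewrite /posR/= in_itv/= andbT => /ltW.
apply/andP; split.
  by apply: Rintegral_ge0 => t /St t0; have /andP[] := expRN_sub1_lip t0 l0 lm.
apply: (@le_trans _ _ (\int[pi]_(t in S) ((m - l) * (1 + m) * Num.min t (t ^+ 2)))).
  apply: le_Rintegral => //.
  - exact: (integrableB mS im il).
  - exact: (integrableZl mS _ iS).
  - by move=> t /St t0; have /andP[] := expRN_sub1_lip t0 l0 lm.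
rewrite RintegralZl//; apply: ler_wpM2l => //.
rewrite [leRHS]/Rintegral fine_le//.
- exact: integrable_fin_num.
- exact: (integrable_fin_num (mI _) min_sqr_integrable).
- apply: ge0_subset_integral => //.
  + exact: measurable_itv.
  + by case/integrableP : min_sqr_integrable.
  + move=> t; rewrite /posR/= in_itv/= andbT => /ltW t0.
    by rewrite lee_fin le_min t0 sqr_ge0.
Qed.

(** Away from 0, constants and [t] itself are dominated by [min (t, t^2)]: one has [t / r >= 1], so
    that [1 <= t / r], [1 <= (t / r)^2] and [t <= t^2 / r]. Each constant is a sum, to serve both
    branches of the minimum. *)
Lemma min_sqr_tail r t : 0 < r -> r < t ->
  1 <= (r^-1 + r^-1 ^+ 2) * Num.min t (t ^+ 2) /\ t <= (1 + r^-1) * Num.min t (t ^+ 2).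
Proof.
move=> r0 rt; set v := r^-1.
have v0 : 0 < v by rewrite invr_gt0.
have vt : 1 <= v * t by rewrite mulrC -ler_pdivrMr ?invr_gt0// mul1r invrK ltW.
have t0 : 0 < t by lra.
rewrite /Num.min; case: ifPn => _; split.
- nra.
- nra.
- have : 1 <= (v * t) ^+ 2 by rewrite exprn_ege1.
  rewrite exprMn; nra.
- have : t * 1 <= t * (v * t) by rewrite ler_pM2l.
  nra.
Qed.

Lemma tail_sub r : 0 < r -> `]r, +oo[%classic `<=` posR.
Proof.
by move=> r0 t; rewrite /posR/= !in_itv/= !andbT; exact: lt_trans.
Qed.

Lemma tail_bounded_integrable r f : 0 < r ->
  measurable_fun (`]r, +oo[ : set (measurableTypeR R)) f ->
  (forall t, r < t -> `|f t| <= 1) ->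
  pi.-integrable `]r, +oo[ (EFin \o f).
Proof.
move=> r0 mf f1.
apply: (@levy_integrable _ _ (r^-1 + r^-1 ^+ 2)) => //.
  exact: tail_sub.
move=> t; rewrite /= in_itv/= andbT => rt.
by have [+ _] := min_sqr_tail r0 rt; apply: le_trans; exact: f1.
Qed.

Lemma tail_id_integrable r : 0 < r ->
  pi.-integrable `]r, +oo[ (EFin \o (fun t : R => t)).
Proof.
move=> r0.
apply: (@levy_integrable _ _ (1 + r^-1)) => //.
  exact: tail_sub.
move=> t; rewrite /= in_itv/= andbT => rt.
rewrite gtr0_norm; first by have [] := min_sqr_tail r0 rt.
exact: lt_trans rt.
Qed.

Lemma tail_lty r : 0 < r -> (pi `]r, +oo[%classic < +oo)%E.
Proof.
move=> r0.
have : pi.-integrable `]r, +oo[ (EFin \o (fun t : R => 1)).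
  by apply: tail_bounded_integrable => // t _; rewrite normr1.
move=> i1; have := integrable_fin_num (mI _) i1.
have := integral_cst pi (mI (Interval (BRight r) (BInfty _ false))) 1%E; rewrite /cst/= => ->.
by rewrite mul1e ge0_fin_numE.
Qed.

Lemma tail_fin_num r : 0 < r -> (pi `]r, +oo[%classic \is a fin_num)%E.
Proof. by move=> r0; rewrite ge0_fin_numE// tail_lty. Qed.

Local Notation Phi alpha beta := (branching_mechanism alpha beta pi).

(** [S] is left free so that one proof serves Phi, with [S = ]0, oo[], and Phi^r, with [S = ]0, r]].
    The final 1 in the constant only makes it positive. *)
Lemma quadratic_levy_lip S (a b M : R) : measurable S -> S `<=` posR -> 0 <= b -> 0 <= M ->
  exists2 L, 0 < L & forall l m, 0 <= l <= M -> 0 <= m <= M ->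
    `|(a * l + b * l ^+ 2 + \int[pi]_(t in S) (expR (- (l * t)) - 1 + l * t)) -
      (a * m + b * m ^+ 2 + \int[pi]_(t in S) (expR (- (m * t)) - 1 + m * t))| <= L * `|l - m|.
Proof.
move=> mS SP b0 M0.
pose I := \int[pi]_(t in posR) Num.min t (t ^+ 2).
have I0 : 0 <= I.
  apply: Rintegral_ge0 => t; rewrite /posR/= in_itv/= andbT => /ltW t0.
  by rewrite le_min t0 sqr_ge0.
exists (`|a| + b * (2 * M) + (1 + M) * I + 1).
  have := normr_ge0 a.
  have : 0 <= b * (2 * M) by rewrite mulr_ge0//; lra.
  have : 0 <= (1 + M) * I by rewrite mulr_ge0//; lra.
  by lra.
move=> l m.
wlog lm : l m / l <= m.
  move=> H l0 m0; have [lm|/ltW lm] := leP l m; first exact: H.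
  by rewrite distrC (distrC l); exact: H.
move=> /andP[l0 lM] /andP[m0 mM].
rewrite distrC (distrC l) (ger0_norm (_ : 0 <= m - l)); last lra.
have /andP[] := levy_integral_lip mS SP l0 lm.
rewrite -/I.
set A := \int[pi]_(t in _) _; set B := \int[pi]_(t in _) _ => h1 h2.
rewrite [X in `|X|](_ : _ = a * (m - l) + (b * (m + l) * (m - l) + (A - B))); last first.
  by rewrite /A /B; ring.
apply: (le_trans (ler_normD _ _)).
rewrite normrM (ger0_norm (_ : 0 <= m - l)); last lra.
rewrite (ger0_norm (_ : 0 <= b * (m + l) * (m - l) + (A - B))); last first.
  by rewrite addr_ge0// mulr_ge0//; [rewrite mulr_ge0//; lra|lra].
have := normr_ge0 a.
have : b * (m + l) * (m - l) <= b * (2 * M) * (m - l).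
  by rewrite ler_wpM2r//; [lra|rewrite ler_wpM2l//; lra].
have : (m - l) * (1 + m) * I <= (1 + M) * I * (m - l).
  rewrite [leRHS]mulrC [(1 + M) * I]mulrC [leLHS]mulrC mulrCA ler_wpM2l//; first lra.
  by rewrite ler_wpM2l//; lra.
nra.
Qed.

Lemma branching_mechanism_lip alpha beta (M : R) : 0 <= beta -> 0 <= M -> exists2 L, 0 < L &
  forall l m, 0 <= l <= M -> 0 <= m <= M ->
    `|Phi alpha beta l - Phi alpha beta m| <= L * `|l - m|.
Proof. exact: (quadratic_levy_lip alpha (mI _) (@subset_refl _ _)). Qed.

(** A second difference annihilates affine functions of [l], hence the drift and the compensator
    [- 1 + l t]; what remains of the kernel is [e^(-l t) (1 - e^-t)^2]. This is how knowledge of Phi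
    alone gives access to integrals against [pi]. *)
Lemma branching_mechanism_second_difference alpha beta l : 0 <= l ->
  Phi alpha beta l - 2 * Phi alpha beta (l + 1) + Phi alpha beta (l + 2) =
  2 * beta + \int[pi]_(t in `]0, +oo[) (expR (- (l * t)) * (1 - expR (- t)) ^+ 2).
Proof.
move=> l0.
have mP : measurable posR by exact: measurable_itv.
have i0 := levy_kernel_integrable mP (@subset_refl _ _) l0.
have l1 : 0 <= l + 1 by lra.
have l2 : 0 <= l + 2 by lra.
have i1 := levy_kernel_integrable mP (@subset_refl _ _) l1.
have i2 := levy_kernel_integrable mP (@subset_refl _ _) l2.
rewrite [in RHS](_ : (\int[pi]_(t in _) _) = \int[pi]_(t in posR)
  (((expR (- (l * t)) - 1 + l * t) + (- 2) * (expR (- ((l + 1) * t)) - 1 + (l + 1) * t))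
  + (expR (- ((l + 2) * t)) - 1 + (l + 2) * t))); last first.
  apply: eq_Rintegral => t _.
  have -> : expR (- ((l + 1) * t)) = expR (- (l * t)) * expR (- t).
    by rewrite -expRD; congr expR; ring.
  have -> : expR (- ((l + 2) * t)) = expR (- (l * t)) * (expR (- t) * expR (- t)).
    by rewrite -!expRD; congr expR; ring.
  ring.
have i1' := integrableZl mP (- 2)%R i1.
rewrite RintegralD//; last exact: (integrableD mP i0 i1').
rewrite RintegralD//.
rewrite RintegralZl// /branching_mechanism.
by rewrite /posR; ring.
Qed.


(** On []r, oo[] the three terms of the Levy kernel are integrable separately: the exponential
    stays, the constant gives the mass of the tail, and the linear term is the extra drift of
    Phi^r. *)
Lemma truncated_mechanismE alpha beta r l : 0 < r -> 0 <= l ->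
  fine (pi `]r, +oo[%classic) - truncated_mechanism alpha beta pi r l =
  \int[pi]_(t in `]r, +oo[) expR (- (l * t)) - Phi alpha beta l.
Proof.
move=> r0 l0.
have iexp : pi.-integrable `]r, +oo[ (EFin \o (fun t : R => expR (- (l * t)))).
  apply: tail_bounded_integrable => //; first exact: measurable_fun_expRN_mul.
  move=> t rt; rewrite ger0_norm ?expR_ge0// -expR0 ler_expR oppr_le0 mulr_ge0//.
  by rewrite ltW// (lt_trans r0).
have i1 : pi.-integrable `]r, +oo[ (EFin \o (fun t : R => - 1)).
  by apply: tail_bounded_integrable => // t _; rewrite normrN1.
have iid := tail_id_integrable r0.
have posE : posR = `]0, r]%classic `|` `]r, +oo[%classic.
  by rewrite /posR (@itv_bndbnd_setU _ _ _ (BRight r))//= ?bnd_simp ltW.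
have rsub : `]0, r]%classic `<=` posR by rewrite posE; exact: subsetUl.
rewrite /truncated_mechanism /branching_mechanism -/posR posE Rintegral_setU//; first last.
- apply/disj_setPS => t [] /=; rewrite !in_itv/= andbT => /andP[_ tr] rt.
  by have := lt_le_trans rt tr; rewrite ltxx.
- by rewrite -posE; exact: (levy_kernel_integrable (mI _) (@subset_refl _ _) l0).
have -> : \int[pi]_(t in `]r, +oo[) (expR (- (l * t)) - 1 + l * t) =
  \int[pi]_(t in `]r, +oo[) expR (- (l * t)) - fine (pi `]r, +oo[%classic) +
  l * \int[pi]_(t in `]r, +oo[) t.
  rewrite RintegralD//; first last.
  - exact: (integrableZl _ l iid).
  - exact: (integrableD _ iexp i1).
  rewrite RintegralD// RintegralZl//; congr (_ + _ + _).
  by rewrite (Rintegral_cst pi (mI _) (-1)) mulN1r.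
by rewrite /=; ring.
Qed.

Lemma truncated_mechanism0 alpha beta r : truncated_mechanism alpha beta pi r 0 = 0.
Proof.
rewrite /truncated_mechanism mulr0 expr0n mulr0 !add0r.
rewrite (_ : (\int[pi]_(t in _) _) = \int[pi]_(t in `]0, r]) (cst 0) t).
  by rewrite Rintegral_cst ?mul0r.
by apply: eq_Rintegral => t _; rewrite mul0r oppr0 expR0 subrr add0r.
Qed.

(** Convexity along segments starting at 0, where the mechanism vanishes. This is the only form of
    convexity that the argument uses. *)
Lemma truncated_mechanism_star alpha beta r l t : 0 <= beta -> 0 <= l -> 0 <= t <= 1 ->
  truncated_mechanism alpha beta pi r (t * l) <= t * truncated_mechanism alpha beta pi r l.
Proof.
move=> b0 l0 t01; have /andP[t0 t1] := t01.
have rsub : `]0, r]%classic `<=` posR.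
  by move=> u; rewrite /posR/= !in_itv/= andbT => /andP[].
have tl0 : 0 <= t * l by rewrite mulr_ge0.
have il := levy_kernel_integrable (mI _) rsub l0.
have itl := levy_kernel_integrable (mI _) rsub tl0.
rewrite /truncated_mechanism !mulrDr mulrCA lerD//.
  rewrite lerD2l exprMn mulrCA ler_wpM2r//; first by rewrite mulr_ge0// sqr_ge0.
  by rewrite expr2 ler_piMr.
rewrite -RintegralZl//; apply: le_Rintegral => //.
  exact: (integrableZl _ t il).
move=> u _; have := expRN_convex (l * u) t01.
by rewrite !mulrA; lra.
Qed.

Lemma truncated_mechanism_lip alpha beta r (M : R) : 0 <= beta -> 0 <= M ->
  exists2 L, 0 < L & forall l m, 0 <= l <= M -> 0 <= m <= M ->
    `|truncated_mechanism alpha beta pi r l - truncated_mechanism alpha beta pi r m|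
      <= L * `|l - m|.
Proof.
apply: (@quadratic_levy_lip `]0%R, r]) => //.
by move=> u; rewrite /posR/= !in_itv/= andbT => /andP[].
Qed.

End levy_integrals.

(** * Conditional Laplace transforms *)

Section bounded_measurable.
Context {d : measure_display} {T : measurableType d} {R : realType}.
Implicit Types (f g h : T -> R) (c C : R).

(** A class closed under ring operations and integrable for every probability, so that linearity and
    monotonicity of expectations need no separate integrability argument. *)
Definition bounded_measurable f :=
  measurable_fun setT f /\ exists C : R, forall w, `|f w| <= C.

Lemma bounded_measurable_cst c : bounded_measurable (fun=> c).
Proof. by split; [exact: measurable_cst|exists `|c|]. Qed.

Lemma bounded_measurableD f g : bounded_measurable f -> bounded_measurable g ->
  bounded_measurable (fun w => f w + g w).
Proof.
move=> [mf [C fC]] [mg [D gD]]; split; first exact: measurable_funD.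
by exists (C + D) => w; rewrite (le_trans (ler_normD _ _))// lerD.
Qed.

Lemma bounded_measurableM f g : bounded_measurable f -> bounded_measurable g ->
  bounded_measurable (fun w => f w * g w).
Proof.
move=> [mf [C fC]] [mg [D gD]]; split; first exact: measurable_funM.
by exists (C * D) => w; rewrite normrM ler_pM.
Qed.

Lemma bounded_measurableZ c f : bounded_measurable f -> bounded_measurable (fun w => c * f w).
Proof. by move=> bf; apply: bounded_measurableM => //; exact: bounded_measurable_cst. Qed.

Lemma bounded_measurableB f g : bounded_measurable f -> bounded_measurable g ->
  bounded_measurable (fun w => f w - g w).
Proof.
move=> bf bg; apply: bounded_measurableD => //.
rewrite (_ : (fun w => - g w) = (fun w => (- 1) * g w)).
  exact: bounded_measurableZ.
by apply/funext => w; rewrite mulN1r.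
Qed.

Lemma bounded_measurable_sum n (F : nat -> T -> R) :
  (forall i, (i < n)%N -> bounded_measurable (F i)) ->
  bounded_measurable (fun w => \sum_(i < n) F i w).
Proof.
elim: n => [_|n IH bF].
  under [X in bounded_measurable X]funext do rewrite big_ord0.
  exact: bounded_measurable_cst.
under [X in bounded_measurable X]funext do rewrite big_ord_recr/=.
by apply: bounded_measurableD; [apply: IH => i /ltnW; exact: bF|exact: bF].
Qed.

Lemma bounded_measurable_indic (A : set T) : measurable A -> bounded_measurable (\1_A : T -> R).
Proof.
move=> mA; split; first exact: measurable_indic.
by exists 1 => w; rewrite indicE; case: (w \in A); rewrite ?normr1 ?normr0.
Qed.

Context (P : probability T R).

Let PT : P setT = 1%E.
Proof. exact: probability_setT. Qed.

Lemma bounded_measurable_integrable f : bounded_measurable f -> P.-integrable setT (EFin \o f).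
Proof.
move=> [mf [C fC]]; apply: measurable_bounded_integrable => //.
  by apply: (@le_lt_trans _ _ 1%E); [rewrite le_eqVlt; apply/orP; left; apply/eqP; exact: PT|exact: ltry].
exists C; split; first exact: num_real.
by move=> M CM w _ /=; exact: le_trans (fC w) (ltW CM).
Qed.

Lemma expectation_cst c : \int[P]_(w in setT) c = c.
Proof. rewrite Rintegral_cst// (_ : fine _ = 1) ?mulr1//; exact: (congr1 fine PT). Qed.

Lemma expectationD f g : bounded_measurable f -> bounded_measurable g ->
  \int[P]_w (f w + g w) = \int[P]_w f w + \int[P]_w g w.
Proof. by move=> bf bg; rewrite RintegralD//; exact: bounded_measurable_integrable. Qed.

Lemma expectationB f g : bounded_measurable f -> bounded_measurable g ->
  \int[P]_w (f w - g w) = \int[P]_w f w - \int[P]_w g w.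
Proof. by move=> bf bg; rewrite RintegralB//; exact: bounded_measurable_integrable. Qed.

Lemma expectationZ c f : bounded_measurable f ->
  \int[P]_w (c * f w) = c * \int[P]_w f w.
Proof. by move=> bf; rewrite RintegralZl//; exact: bounded_measurable_integrable. Qed.

Lemma expectation_le f g : bounded_measurable f -> bounded_measurable g ->
  (forall w, f w <= g w) -> \int[P]_w f w <= \int[P]_w g w.
Proof. by move=> bf bg fg; apply: le_Rintegral => //; exact: bounded_measurable_integrable. Qed.

Lemma expectation_sum n (F : nat -> T -> R) :
  (forall i, (i < n)%N -> bounded_measurable (F i)) ->
  \int[P]_w (\sum_(i < n) F i w) = \sum_(i < n) \int[P]_w F i w.
Proof.
elim: n => [_|n IH bF].
  under eq_Rintegral do rewrite big_ord0.
  by rewrite expectation_cst big_ord0.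
under eq_Rintegral do rewrite big_ord_recr/=.
rewrite expectationD; last 2 first.
- by apply: bounded_measurable_sum => i /ltnW; exact: bF.
- exact: bF.
by rewrite IH ?big_ord_recr// => i /ltnW; exact: bF.
Qed.

Lemma expectation_dist f g h c : bounded_measurable f -> bounded_measurable g ->
  bounded_measurable h -> (forall w, `|f w - g w| <= c * h w) ->
  `|\int[P]_w f w - \int[P]_w g w| <= c * \int[P]_w h w.
Proof.
move=> bf bg bh fg; rewrite -expectationB// -expectationZ// ler_norml.
have bfg := bounded_measurableB bf bg.
have bch := bounded_measurableZ c bh.
apply/andP; split; last first.
  by apply: expectation_le => // w; have := fg w; rewrite ler_norml => /andP[].
rewrite -mulN1r -expectationZ//; apply: expectation_le => //.
  exact: bounded_measurableZ.
by move=> w; have := fg w; rewrite ler_norml mulN1r => /andP[].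
Qed.

Lemma expectation_dist_cst f g c : bounded_measurable f -> bounded_measurable g ->
  (forall w, `|f w - g w| <= c) -> `|\int[P]_w f w - \int[P]_w g w| <= c.
Proof.
move=> bf bg fg; rewrite -[leRHS]mulr1 -[in leRHS](expectation_cst 1).
apply: expectation_dist => //; first exact: bounded_measurable_cst.
by move=> w; rewrite mulr1.
Qed.

Lemma expectation_indic (A : set T) : measurable A ->
  \int[P]_w (\1_A w) = fine (P A).
Proof. by move=> mA; rewrite /Rintegral integral_indic// setIT. Qed.

End bounded_measurable.

Section layers.
Context {R : realType}.
Implicit Types (u : R) (n : nat).

(** The sum counts the integers from 1 to [n] that are at most [n u], so it equals the integer part
    of [n u] divided by [n]. Such layers carry identities known for events over to functions with
    values in [0, 1]. *)
Lemma layer_approx n u : 0 <= u <= 1 -> (0 < n)%N ->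
  `|u - \sum_(j < n) n%:R^-1 * ((j.+1%:R <= n%:R * u :> R) : nat)%:R| <= n%:R^-1.
Proof.
move=> /andP[u0 u1] n0.
have n0' : 0 < n%:R :> R by rewrite ltr0n.
have nu0 : 0 <= n%:R * u by rewrite mulr_ge0// ltW.
set m := Num.truncn (n%:R * u).
have mn : (m <= n)%N.
  by rewrite -(ler_nat R) (@le_trans _ _ (n%:R * u))// ?truncn_le// ler_piMr// ltW.
have -> : \sum_(j < n) n%:R^-1 * ((j.+1%:R <= n%:R * u :> R) : nat)%:R = n%:R^-1 * m%:R :> R.
  rewrite -mulr_sumr; congr (_ * _).
  rewrite -natr_sum; congr (_%:R).
  transitivity (\sum_(j < n) (j < m)%N : nat)%N.
    by apply: eq_bigr => j _; rewrite /m -truncn_ge_nat.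
  rewrite -(big_mkord xpredT (fun j => (j < m)%N : nat)) (@big_cat_nat _ _ _ m)//=.
  rewrite (eq_big_nat _ _ (F2 := fun=> 1%N)); last by move=> i /andP[_ ->].
  rewrite [X in (_ + X)%N](eq_big_nat _ _ (F2 := fun=> 0%N)); last first.
    by move=> i /andP[mi _]; rewrite ltnNge mi.
  by rewrite !sum_nat_const_nat subn0 muln1 muln0 addn0.
have /andP[a1 a2] := truncn_itv nu0; rewrite -/m in a1 a2.
rewrite -(ler_pM2l n0') -{1}(gtr0_norm n0') -normrM mulrBr mulVKf ?lt0r_neq0// divff ?lt0r_neq0//.
rewrite ger0_norm ?subr_ge0//; move: a2; rewrite -natr1; lra.
Qed.

End layers.

(** * Random variables adapted to the natural filtration *)

Section adapted.
Context {d : measure_display} {T : measurableType d} {R : realType}.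
Implicit Types (X : R -> T -> R) (Y Z : T -> R).

Definition adapted X (s : R) Y :=
  forall B : set R, measurable B -> natural_filtration X s (Y @^-1` B).

Let gens X (s : R) := [set A | exists (u : R) (B : set R),
  [/\ 0 <= u <= s, measurable B & A = X u @^-1` B]].

(** Passing to the generated sigma-algebra as a measurable type gives access to the general closure
    properties of measurable functions. *)
Lemma adaptedP X s Y : adapted X s Y <->
  measurable_fun (setT : set (g_sigma_algebraType (gens X s)))
    (Y : g_sigma_algebraType (gens X s) -> R).
Proof.
split=> [aY _ B mB|mY B mB]; first by rewrite setTI; exact: aY.
by have := mY measurableT B mB; rewrite setTI.
Qed.

Lemma adapted_cst X s c : adapted X s (fun=> c).
Proof. by apply/adaptedP; exact: measurable_cst. Qed.

Lemma adaptedM X s Y Z : adapted X s Y -> adapted X s Z -> adapted X s (fun w => Y w * Z w).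
Proof. by move=> /adaptedP mY /adaptedP mZ; apply/adaptedP; exact: measurable_funM. Qed.

Lemma adaptedB X s Y Z : adapted X s Y -> adapted X s Z -> adapted X s (fun w => Y w - Z w).
Proof. by move=> /adaptedP mY /adaptedP mZ; apply/adaptedP; exact: measurable_funB. Qed.

Lemma adapted_comp X s Y (h : R -> R) : measurable_fun setT h -> adapted X s Y ->
  adapted X s (fun w => h (Y w)).
Proof.
move=> mh aY B mB.
have := aY (h @^-1` B); rewrite comp_preimage; apply.
by rewrite -[X in measurable X]setTI; exact: mh.
Qed.

Lemma adapted_process X s u : 0 <= u <= s -> adapted X s (X u).
Proof. by move=> us B mB; apply: sub_sigma_algebra; exists u, B. Qed.

Lemma adapted_mono X s u Y : s <= u -> adapted X s Y -> adapted X u Y.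
Proof.
move=> su aY B mB; apply: sub_sigma_algebra2 (aY B mB) => A [v [C [/andP[v0 vs] mC ->]]].
by exists v, C; split => //; rewrite v0 (le_trans vs).
Qed.

Lemma natural_filtration_measurable X s A :
  (forall t, 0 <= t -> measurable_fun setT (X t)) ->
  natural_filtration X s A -> measurable A.
Proof.
move=> mX; apply: smallest_sub; first exact: sigma_algebra_measurable.
move=> B [u [C [/andP[u0 _] mC ->]]].
by rewrite -[X in measurable X]setTI; exact: mX.
Qed.

Lemma adapted_measurable X s Y : (forall t, 0 <= t -> measurable_fun setT (X t)) ->
  adapted X s Y -> measurable_fun setT Y.
Proof.
move=> mX aY _ B mB; rewrite setTI.
exact: natural_filtration_measurable (aY B mB).
Qed.

End adapted.

(** * The Markov property in terms of Laplace transforms *)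

Section conditional_laplace.
Context {d : measure_display} {T : measurableType d} {R : realType}.
Context (P : R -> probability T R) (X : R -> T -> R) (v : R -> R -> R).
Context (MP : markov_process P X).
Context (v_ge0 : forall t l : R, 0 <= t -> 0 <= l -> 0 <= v t l).
Context (laplaceX : forall x t l : R, 0 <= x -> 0 <= t -> 0 <= l ->
    ('E_(P x) [fun w => expR (- (l * X t w))] = (expR (- (x * v t l)))%:E)%E).
Implicit Types (x s t l : R) (Y : T -> R).

Let mX (t : R) : 0 <= t -> measurable_fun setT (X t).
Proof. exact: mp_measurable MP t. Qed.

Let X_ge0 (t : R) (w : T) : 0 <= t -> 0 <= X t w.
Proof. exact: mp_ge0 MP t w. Qed.

Lemma laplace_Rintegral x t l : 0 <= x -> 0 <= t -> 0 <= l ->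
  \int[P x]_w expR (- (l * X t w)) = expR (- (x * v t l)).
Proof.
by move=> x0 t0 l0; have := laplaceX x0 t0 l0; rewrite unlock /Rintegral => ->.
Qed.

Lemma expRN_unit l (y : R) : 0 <= l -> 0 <= y -> 0 <= expR (- (l * y)) <= 1.
Proof. by move=> l0 y0; rewrite expR_ge0/= -expR0 ler_expR oppr_le0 mulr_ge0. Qed.

Lemma measurable_fun_expRN l Y : measurable_fun setT Y ->
  measurable_fun setT (fun w => expR (- (l * Y w))).
Proof. by move=> mY; do 2 apply: measurableT_comp => //; exact: measurable_funM. Qed.

Lemma bounded_measurable_expRN l Y : 0 <= l -> measurable_fun setT Y -> (forall w, 0 <= Y w) ->
  bounded_measurable (fun w => expR (- (l * Y w))).
Proof.
move=> l0 mY Y0; split; first exact: measurable_fun_expRN.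
by exists 1 => w; have /andP[a b] := expRN_unit l0 (Y0 w); rewrite ger0_norm.
Qed.

Lemma markov_indic x s t A (B : set R) : 0 <= x -> 0 <= s -> 0 <= t ->
  natural_filtration X s A -> measurable B ->
  bounded_measurable (fun w => fine (P (X s w) (X t @^-1` B))) /\
  \int[P x]_w (\1_A w * \1_B (X (s + t) w)) =
  \int[P x]_w (\1_A w * fine (P (X s w) (X t @^-1` B))).
Proof.
move=> x0 s0 t0 FA mB.
have mA : measurable A by exact: natural_filtration_measurable FA.
have mXB u : 0 <= u -> measurable (X u @^-1` B).
  by move=> u0; rewrite -[Y in measurable Y]setTI; exact: mX.
have finP y : P y (X t @^-1` B) \is a fin_num.
  by apply: fin_num_measure; exact: mXB.
split.
  split.
    apply: measurableT_comp => //.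
    (* The transition kernel is measurable in its starting point only on [[0, oo[], so the
       composition has to use that [X s] takes its values there. *)
    apply: (@measurable_comp _ _ _ _ _ _ (`[0, +oo[ : set R) (fun y => P y (X t @^-1` B))).
    - exact: measurable_itv.
    - by move=> _ [w _ <-] /=; rewrite in_itv/= X_ge0.
    - exact: (mp_kernel MP).
    - exact: mX.
  exists 1 => w; rewrite ger0_norm ?fine_ge0// -lee_fin fineK//.
  by apply: probability_le1; exact: mXB.
transitivity (fine (P x (A `&` X (s + t) @^-1` B))).
  rewrite -expectation_indic; last by apply: measurableI => //; apply: mXB; rewrite addr_ge0.
  by apply: eq_Rintegral => w _; rewrite indicI.
rewrite (mp_markov MP)//.
transitivity (\int[P x]_(w in A) fine (P (X s w) (X t @^-1` B))).
  by congr fine; apply: eq_integral => w _; rewrite fineK.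
rewrite Rintegral_mkcond; apply: eq_Rintegral => w _.
by rewrite patchE indicE; case: ifPn => wA; rewrite ?mul1r ?mul0r.
Qed.

(** Stated with a common approximant [c], because both sides of the conditional Laplace identities
    are compared with one and the same layer sum. *)
Lemma real_eq_approx (a b : R) :
  (forall n : nat, (0 < n)%N -> exists2 c : R, `|a - c| <= n%:R^-1 & `|b - c| <= n%:R^-1) ->
  a = b.
Proof.
move=> H; apply/eqP; rewrite -subr_eq0 -normr_le0; apply/ler_addgt0Pl => e e0.
rewrite addr0.
pose n := (Num.truncn (2 / e)).+1.
have ne : 2 / e < n%:R by exact: truncnS_gt.
have n0 : 0 < n%:R :> R by rewrite ltr0n.
have [c ac bc] := H n isT.
have -> : a - b = (a - c) - (b - c) by ring.
apply: (le_trans (ler_normB _ _)).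
have : n%:R^-1 <= e / 2.
  by rewrite -[leRHS]invrK lef_pV2 ?posrE ?invr_gt0 ?divr_gt0// invf_div ltW.
lra.
Qed.

(** The Markov property speaks of events, so [z |-> expR (- (l * z))] is cut into the layers [B j].
    Layer by layer the Markov property moves the integrand from time [s + t] to the kernel started
    at [X s], and the layer sum of kernels is close to the Laplace transform from that state. *)
Lemma conditional_laplace_indic x s t l A : 0 <= x -> 0 <= s -> 0 <= t -> 0 <= l ->
  natural_filtration X s A ->
  \int[P x]_w (\1_A w * expR (- (l * X (s + t) w))) =
  \int[P x]_w (\1_A w * expR (- (v t l * X s w))).
Proof.
move=> x0 s0 t0 l0 FA.
have st0 : 0 <= s + t by rewrite addr_ge0.
have mA : measurable A by exact: natural_filtration_measurable FA.
have b1 : bounded_measurable (\1_A : T -> R) by exact: bounded_measurable_indic.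
have a01 w : 0 <= (\1_A w : R) <= 1 by rewrite indicE; case: (w \in A); rewrite ?ler01 ?lexx.
apply: real_eq_approx => n n0.
pose B (j : nat) : set R := [set z | j.+1%:R <= n%:R * expR (- (l * z))].
have mB j : measurable (B j).
  rewrite -[B j]setTI; apply: measurable_fun_le => //.
  by apply: measurable_funM => //; exact: measurable_fun_expRN_mul.
have indB j (z : R) : \1_(B j) z = ((j.+1%:R <= n%:R * expR (- (l * z)) :> R) : nat)%:R :> R.
  by rewrite indicE; congr (_ (nat_of_bool _)); rewrite /B mem_setE.
have bXB u j : 0 <= u -> bounded_measurable (fun w => \1_(B j) (X u w) : R).
  move=> u0; rewrite (_ : (fun w => _) = \1_(X u @^-1` B j)); last first.
    by apply/funext => w; rewrite !indicE; congr (_ (nat_of_bool _)); rewrite !mem_setE.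
  by apply: bounded_measurable_indic; rewrite -[Y in measurable Y]setTI; exact: mX.
exists (\sum_(j < n) n%:R^-1 * \int[P x]_w (\1_A w * \1_(B j) (X (s + t) w))).
  have bAB j : bounded_measurable (fun w => \1_A w * \1_(B j) (X (s + t) w) : R).
    by apply: bounded_measurableM => //; exact: bXB.
  have bb j : bounded_measurable (fun w => n%:R^-1 * (\1_A w * \1_(B j) (X (s + t) w)) : R).
    exact: bounded_measurableZ.
  under eq_bigr => j _ do rewrite -expectationZ//.
  rewrite -(@expectation_sum _ _ _ _ n (fun j w => n%:R^-1 * (\1_A w * \1_(B j) (X (s + t) w))))//.
  apply: expectation_dist_cst.
  - apply: bounded_measurableM => //; apply: bounded_measurable_expRN => //; first exact: mX.
    by move=> w; exact: X_ge0.
  - by apply: (@bounded_measurable_sum _ _ _ n (fun j w => n%:R^-1 * (\1_A w * \1_(B j) (X (s + t) w)))) => j _.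
  move=> w.
  under eq_bigr do rewrite mulrCA indB.
  rewrite -mulr_sumr -mulrBr normrM.
  have /andP[a0 a1] := a01 w; rewrite (ger0_norm a0).
  rewrite -[leRHS]mul1r ler_pM//.
  by apply: layer_approx => //; apply: expRN_unit => //; exact: X_ge0.
have pB j := markov_indic x0 s0 t0 FA (mB j).
under eq_bigr => j _ do rewrite (pB j).2.
have bb j : bounded_measurable (fun w => \1_A w * fine (P (X s w) (X t @^-1` B j))).
  by apply: bounded_measurableM => //; exact: (pB j).1.
under eq_bigr => j _ do rewrite -expectationZ//.
rewrite -(@expectation_sum _ _ _ _ n (fun j w => n%:R^-1 * (\1_A w * fine (P (X s w) (X t @^-1` B j)))))//; last first.
  by move=> j _; exact: bounded_measurableZ.
apply: expectation_dist_cst.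
- apply: bounded_measurableM => //; apply: bounded_measurable_expRN => //.
  + exact: v_ge0.
  + exact: mX.
  + by move=> w; exact: X_ge0.
- apply: (@bounded_measurable_sum _ _ _ n (fun j w => n%:R^-1 * (\1_A w * fine (P (X s w) (X t @^-1` B j))))) => j _.
  exact: bounded_measurableZ.
move=> w.
under eq_bigr do rewrite mulrCA.
rewrite -mulr_sumr -mulrBr normrM.
have /andP[a0 a1] := a01 w; rewrite (ger0_norm a0).
rewrite -[leRHS]mul1r ler_pM//.
have Xs0 := X_ge0 w s0.
(* The exponential in [X s w] is read as the expectation of [expR (- (l * X t))] under the law
   started at [X s w], to which the same layers apply. *)
rewrite [v t l * _]mulrC -laplace_Rintegral//.
rewrite (_ : \sum_(j < n) _ = \int[P (X s w)]_u (\sum_(j < n) n%:R^-1 * \1_(B j) (X t u))).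
  apply: expectation_dist_cst.
  - by apply: bounded_measurable_expRN => //; [exact: mX|move=> u; exact: X_ge0].
  - apply: (@bounded_measurable_sum _ _ _ n (fun j u => n%:R^-1 * \1_(B j) (X t u))) => j _.
    by apply: bounded_measurableZ; exact: bXB.
  move=> u; under eq_bigr do rewrite indB.
  by apply: layer_approx => //; apply: expRN_unit => //; exact: X_ge0.
rewrite (@expectation_sum _ _ _ _ n (fun j w => n%:R^-1 * (\1_(B j) (X t w)))); last first.
  by move=> j _; apply: bounded_measurableZ; exact: bXB.
apply: eq_bigr => j _; rewrite expectationZ; last exact: bXB.
congr (_ * _); rewrite -expectation_indic; last first.
  by rewrite -[Y in measurable Y]setTI; exact: mX.
by apply: eq_Rintegral => u _; rewrite !indicE; congr (_ (nat_of_bool _)); rewrite !mem_setE.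
Qed.

(** The layers are now those of the weight [Y], each being an event of the filtration at time [s].
    Division by [max (1, C)] first brings [Y] into [0, 1]. *)
Lemma conditional_laplace x s t l Y C : 0 <= x -> 0 <= s -> 0 <= t -> 0 <= l ->
  adapted X s Y -> (forall w, 0 <= Y w <= C) ->
  \int[P x]_w (Y w * expR (- (l * X (s + t) w))) =
  \int[P x]_w (Y w * expR (- (v t l * X s w))).
Proof.
move=> x0 s0 t0 l0 aY.
wlog : Y C aY / C = 1.
  move=> H YC.
  pose D := Num.max 1 C.
  have D0 : 0 < D by rewrite lt_max ltr01.
  have Y01 w : 0 <= D^-1 * Y w <= 1.
    have /andP[Y0 YCw] := YC w; rewrite mulr_ge0 ?invr_ge0 ?(ltW D0)//=.
    by rewrite mulrC ler_pdivrMr// mul1r (le_trans YCw)// le_max lexx orbT.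
  have bY : bounded_measurable Y.
    split; first exact: adapted_measurable aY.
    by exists C => w; have /andP[Y0 YCw] := YC w; rewrite ger0_norm.
  have aDY : adapted X s (fun w => D^-1 * Y w).
    by apply: adaptedM => //; exact: adapted_cst.
  have := H (fun w => D^-1 * Y w) 1 aDY erefl Y01.
  under eq_Rintegral do rewrite -mulrA.
  under [in X in _ = X -> _]eq_Rintegral do rewrite -mulrA.
  rewrite !expectationZ; first last.
  - apply: bounded_measurableM => //; apply: bounded_measurable_expRN => //.
    + by apply: mX; rewrite addr_ge0.
    + by move=> w; rewrite X_ge0// addr_ge0.
  - apply: bounded_measurableM => //; apply: bounded_measurable_expRN => //.
    + exact: v_ge0.
    + exact: mX.
    + by move=> w; exact: X_ge0.
  by move/mulfI; apply; rewrite invr_eq0 lt0r_neq0.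
move=> -> Y01.
have mY : measurable_fun setT Y by exact: adapted_measurable aY.
have bY : bounded_measurable Y.
  by split=> //; exists 1 => w; have /andP[Y0 YCw] := Y01 w; rewrite ger0_norm.
have bU : bounded_measurable (fun w => expR (- (l * X (s + t) w))).
  apply: bounded_measurable_expRN => //; first by apply: mX; rewrite addr_ge0.
  by move=> w; rewrite X_ge0// addr_ge0.
have bV : bounded_measurable (fun w => expR (- (v t l * X s w))).
  apply: bounded_measurable_expRN => //; first exact: v_ge0.
    exact: mX.
  by move=> w; rewrite X_ge0.
apply: real_eq_approx => n n0.
pose A (j : nat) : set T := [set w | j.+1%:R <= n%:R * Y w].
have FA j : natural_filtration X s (A j).
  have := aY [set z | j.+1%:R <= n%:R * z]; apply.
  rewrite -[Z in measurable Z]setTI; exact: measurable_fun_le.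
have mA j : measurable (A j) by exact: natural_filtration_measurable (FA j).
have bA j : bounded_measurable (\1_(A j) : T -> R) by exact: bounded_measurable_indic.
have indA j w : \1_(A j) w = ((j.+1%:R <= n%:R * Y w :> R) : nat)%:R :> R.
  by rewrite indicE; congr (_ (nat_of_bool _)); rewrite /A mem_setE.
have approx U : bounded_measurable U -> (forall w, 0 <= U w <= 1) ->
  `|\int[P x]_w (Y w * U w) - \sum_(j < n) n%:R^-1 * \int[P x]_w (\1_(A j) w * U w)| <= n%:R^-1.
  move=> bmU U01.
  have bAU j : bounded_measurable (fun w => \1_(A j) w * U w) by exact: bounded_measurableM.
  under eq_bigr => j _ do rewrite -expectationZ//.
  rewrite -(@expectation_sum _ _ _ _ n (fun j w => n%:R^-1 * (\1_(A j) w * U w)))//; last first.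
    by move=> j _; exact: bounded_measurableZ.
  apply: expectation_dist_cst; first exact: bounded_measurableM.
    apply: (@bounded_measurable_sum _ _ _ n (fun j w => n%:R^-1 * (\1_(A j) w * U w))) => j _.
    exact: bounded_measurableZ.
  move=> w; under eq_bigr do rewrite mulrA indA.
  rewrite -mulr_suml -mulrBl normrM.
  have /andP[a0 a1] := U01 w; rewrite (ger0_norm a0).
  rewrite -[leRHS]mulr1 ler_pM//.
  exact: layer_approx.
exists (\sum_(j < n) n%:R^-1 * \int[P x]_w (\1_(A j) w * expR (- (l * X (s + t) w)))).
  by apply: approx => // w; apply: expRN_unit => //; rewrite X_ge0// addr_ge0.
under eq_bigr => j _ do rewrite conditional_laplace_indic//.
by apply: approx => // w; apply: expRN_unit; [exact: v_ge0|exact: X_ge0].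
Qed.

End conditional_laplace.

(** * Cutoff functions and small-time behaviour of the cumulant semigroup *)

Section cutoff.
Context {R : realType}.
Implicit Types (a b w : R).

(** For [b < a] it falls linearly from 1 at [b] to 0 at [a]. As [w] stands for [exp (- increment)],
    small values of [w] are large upward increments: these are the ones that the cutoff detects. *)
Definition cutoff a b w : R := Num.max 0 (Num.min 1 ((a - w) / (a - b))).

(* The truncation [Num.min w a] keeps the denominator away from 0 and is
   harmless since [cutoff a b] vanishes beyond [a]. *)
Definition cutoff_quotient a b w : R := cutoff a b w / (1 - Num.min w a) ^+ 2.

Lemma cutoff_ge0 a b w : 0 <= cutoff a b w.
Proof. by rewrite le_max lexx. Qed.

Lemma cutoff_le1 a b w : cutoff a b w <= 1.
Proof. by rewrite ge_max ler01 ge_min lexx. Qed.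

Lemma cutoff_eq0 a b w : b < a -> a <= w -> cutoff a b w = 0.
Proof.
move=> ba aw; apply/max_idPl; rewrite ge_min; apply/orP; right.
by rewrite pmulr_lle0 ?invr_gt0 ?subr_gt0// subr_le0.
Qed.

Lemma cutoff_eq1 a b w : b < a -> w <= b -> cutoff a b w = 1.
Proof.
move=> ba wb; rewrite /cutoff (min_idPl _) ?(max_idPr ler01)//.
by rewrite ler_pdivlMr ?subr_gt0// mul1r lerD2l lerN2.
Qed.

Lemma cutoff_lip a b w w' : b < a ->
  `|cutoff a b w - cutoff a b w'| <= (a - b)^-1 * `|w - w'|.
Proof.
move=> ba; have ab0 : 0 < a - b by rewrite subr_gt0.
have clip (u u' : R) : `|Num.max 0 (Num.min 1 u) - Num.max 0 (Num.min 1 u')| <= `|u - u'|.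
  rewrite /Num.max /Num.min ler_norml.
  case: (ltP 1 u) => ?; case: (ltP 1 u') => ?; case: ltP => ?; case: ltP => ?;
  have := ler_norm (u - u'); have := ler_norm (u' - u); rewrite (distrC u'); lra.
apply: le_trans (clip _ _) _.
rewrite -mulrBl normrM mulrC (gtr0_norm (_ : 0 < (a - b)^-1)) ?invr_gt0//.
by rewrite ler_pM2l ?invr_gt0// distrC; rewrite (_ : a - w' - (a - w) = w - w')//; ring.
Qed.

Lemma cutoffE a b w : b < a -> a < 1 -> (1 - w) ^+ 2 * cutoff_quotient a b w = cutoff a b w.
Proof.
move=> ba a1; rewrite /cutoff_quotient.
have [wa|aw] := leP w a.
  rewrite mulrCA divff ?mulr1// expf_neq0// subr_eq0 eq_sym.
  by rewrite lt_eqF// (le_lt_trans wa).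
by rewrite cutoff_eq0 ?mul0r ?mulr0// ltW.
Qed.

Lemma cutoff_quotient1 a b : b < a -> a < 1 -> cutoff_quotient a b 1 = 0.
Proof. by move=> ba a1; rewrite /cutoff_quotient cutoff_eq0 ?mul0r// ltW. Qed.

(** Product rule for [cutoff * q^2], where [q = 1 / (1 - min (w, a))] is bounded by
    [c = 1 / (1 - a)] and has Lipschitz constant [c^2]: the cutoff contributes [c^2 / (a - b)] and
    [q^2] contributes [2 c * c^2]. *)
Lemma cutoff_quotient_lip a b : b < a -> 0 < a -> a < 1 -> exists2 L, 0 < L &
  forall w w', 0 <= w -> 0 <= w' ->
    `|cutoff_quotient a b w - cutoff_quotient a b w'| <= L * `|w - w'|.
Proof.
move=> ba a0 a1.
have ab0 : 0 < a - b by rewrite subr_gt0.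
have c0 : 0 < 1 - a by rewrite subr_gt0.
pose c := (1 - a)^-1.
have c_gt0 : 0 < c by rewrite invr_gt0.
exists ((a - b)^-1 * c ^+ 2 + 2 * c ^+ 3).
  by rewrite addr_gt0// mulr_gt0 ?invr_gt0 ?exprn_gt0.
move=> w w' w0 w'0.
pose q (w : R) := (1 - Num.min w a)^-1.
have q_ge (u : R) : 0 <= q u <= c.
  have : 1 - a <= 1 - Num.min u a by rewrite lerD2l lerN2 ge_min lexx orbT.
  move=> h; rewrite invr_ge0 (le_trans (ltW c0) h)/= lef_pV2 ?posrE//.
  exact: lt_le_trans h.
have q_lip : `|q w - q w'| <= c ^+ 2 * `|w - w'|.
  have u0 (u : R) : 1 - Num.min u a != 0.
    have h : 1 - a <= 1 - Num.min u a by rewrite lerD2l lerN2 ge_min lexx orbT.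
    by rewrite lt0r_neq0// (lt_le_trans c0 h).
  have -> : q w - q w' = (q w * q w') * (Num.min w a - Num.min w' a).
    by rewrite /q; field; rewrite !u0.
  rewrite normrM normrM.
  have /andP[qa qb] := q_ge w; have /andP[qc qd] := q_ge w'.
  rewrite expr2 (ger0_norm qa) (ger0_norm qc); apply: ler_pM => //.
  - by rewrite mulr_ge0.
  - exact: ler_pM.
  - rewrite /Num.min ler_norml.
    case: (ltP w a) => ?; case: (ltP w' a) => ?;
    have := ler_norm (w - w'); have := ler_norm (w' - w); rewrite (distrC w'); lra.
have r_lip := cutoff_lip w w' ba.
have -> : cutoff_quotient a b w - cutoff_quotient a b w' =
  (cutoff a b w - cutoff a b w') * q w ^+ 2 +
  cutoff a b w' * ((q w + q w') * (q w - q w')).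
  by rewrite /cutoff_quotient -!exprVn -/(q w) -/(q w'); ring.
apply: (le_trans (ler_normD _ _)); rewrite [leRHS]mulrDl lerD//.
  rewrite normrM [leRHS]mulrAC ler_pM// normrX ler_pXn2r// ?nnegrE// ?(ltW c_gt0)//.
  by have /andP[qa qb] := q_ge w; rewrite ger0_norm.
rewrite normrM ger0_norm ?cutoff_ge0//.
rewrite -[leRHS]mul1r ler_pM ?cutoff_ge0 ?cutoff_le1// normrM.
apply: (@le_trans _ _ ((2 * c) * (c ^+ 2 * `|w - w'|))); last first.
  by rewrite le_eqVlt; apply/orP; left; apply/eqP; ring.
rewrite ler_pM//.
have /andP[qa qb] := q_ge w; have /andP[qc qd] := q_ge w'.
rewrite ger0_norm; lra.
Qed.

Lemma cutoff_quotient_approx a b (S e : R) : b < a -> 0 < a -> a < 1 -> 0 < S -> 0 < e ->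
  exists p : {poly R}, forall w, 0 <= w <= S -> `|p.[w] - cutoff_quotient a b w| <= e.
Proof.
move=> ba a0 a1 S0 e0.
have [L L0 LP] := cutoff_quotient_lip ba a0 a1.
apply: (weierstrass_lipschitz S0 L0 e0) => x y /andP[x0 _] /andP[y0 _].
exact: LP.
Qed.

Lemma measurable_fun_cutoff a b : measurable_fun setT (cutoff a b).
Proof.
apply: measurable_maxr => //; apply: measurable_minr => //.
by apply: measurable_funM => //; exact: measurable_funB.
Qed.

End cutoff.

(** * Expansion of the cumulant semigroup at small times *)

Section small_time.
Context {R : realType} (pi : levy_measure R) (alpha beta : R).
Context (triple : branching_triple alpha beta pi).
Context (v : R -> R -> R).
Let Phi := branching_mechanism alpha beta pi.
Context (cum : cumulant_semigroup Phi v).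
Implicit Types (l h : R).

Lemma Rintegral_le_length (f : R -> R) (h c : R) : 0 <= h ->
  lebesgue_measure.-integrable `[0, h] (EFin \o f) ->
  (forall s, 0 <= s <= h -> `|f s| <= c) ->
  `|\int[lebesgue_measure]_(s in `[0, h]) f s| <= c * h.
Proof.
move=> h0 intf fc.
have mh : lebesgue_measure (`[0, h]%classic : set R) = h%:E.
  rewrite lebesgue_measure_itv/= lte_fin; case: ltP => [_|h0']; first by rewrite oppr0 addr0.
  by congr EFin; apply/le_anti; rewrite h0.
have ic : lebesgue_measure.-integrable (`[0, h] : set R) (EFin \o (fun=> c)).
  apply: measurable_bounded_integrable => //.
  - by rewrite [X in (X < _)%E](_ : _ = h%:E) ?ltry.
  - exact: bounded_cst.
apply: (le_trans (le_normr_Rintegral _ intf)) => //.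
have <- : \int[lebesgue_measure]_(s in `[0, h]) c = c * h.
  by rewrite Rintegral_cst//; congr (_ * _); rewrite [X in fine X](_ : _ = h%:E).
apply: le_Rintegral => //.
by have /(@integrable_norm) := intf.
Qed.

(** Two passes through the integral equation. Boundedness of [Phi (v s l)] by [C0] first gives
    [|v s l - l| <= C0 s]; since Phi is Lipschitz on the range of [v], replacing [Phi (v s l)] by
    [Phi l] under the integral then costs at most [L C0 h] per unit length. *)
Lemma cumulant_expansion l : 0 <= l -> exists2 C, 0 <= C &
  forall h, 0 <= h <= 1 -> `|l - v h l - h * Phi l| <= C * h ^+ 2.
Proof.
move=> l0; have [v0 vb vi ve] := cum l0.
have [M0 M0P] := vb 1 ler01.
pose M := Num.max M0 l.
have vM s : 0 <= s <= 1 -> 0 <= v s l <= M.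
  move=> s01; rewrite v0/=; last by case/andP: s01.
  by rewrite le_max M0P.
have lM : 0 <= l <= M by rewrite l0 le_max lexx orbT.
have M_ge0 : 0 <= M by rewrite (le_trans l0)//; case/andP: lM.
have [L L0 LP] := branching_mechanism_lip (bt_integrable triple) alpha (bt_beta_ge0 triple) M_ge0.
pose C0 := `|Phi l| + L * M.
have C00 : 0 <= C0 by rewrite addr_ge0// mulr_ge0// ltW.
have PhiC0 s : 0 <= s <= 1 -> `|Phi (v s l)| <= C0.
  move=> s01; rewrite -[Phi (v s l)](subrK (Phi l)) addrC.
  apply: (le_trans (ler_normD _ _)); rewrite lerD2l.
  apply: (le_trans (LP _ _ (vM _ s01) lM)); rewrite ler_pM2l//.
  by have := vM _ s01; rewrite ler_norml; move: lM; lra.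
have vl s : 0 <= s <= 1 -> `|v s l - l| <= C0 * s.
  move=> s01; have /andP[s0 s1] := s01.
  rewrite ve// addrC addKr normrN; apply: Rintegral_le_length => //; first exact: vi.
  by move=> u /andP[u0 us]; apply: PhiC0; rewrite u0 (le_trans us).
exists (L * C0); first by rewrite mulr_ge0// ltW.
move=> h h01; have /andP[h0 h1] := h01.
have mh : lebesgue_measure (`[0, h]%classic : set R) = h%:E.
  rewrite lebesgue_measure_itv/= lte_fin; case: ltP => [_|h0']; first by rewrite oppr0 addr0.
  by congr EFin; apply/le_anti; rewrite h0.
have ic : lebesgue_measure.-integrable (`[0, h] : set R) (EFin \o (fun=> Phi l)).
  apply: measurable_bounded_integrable => //.
  - by rewrite [X in (X < _)%E](_ : _ = h%:E) ?ltry.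
  - exact: bounded_cst.
have -> : l - v h l - h * Phi l =
    \int[lebesgue_measure]_(s in `[0, h]) (Phi (v s l) - Phi l).
  rewrite RintegralB//; last exact: vi.
  rewrite Rintegral_cst// [X in _ = _ - _ * X](_ : _ = h); last by rewrite [X in fine X](_ : _ = h%:E).
  by rewrite {1}ve//; ring.
rewrite expr2 mulrA; apply: Rintegral_le_length => //.
  have mI : @measurable _ (measurableTypeR R) `[0, h] by exact: measurable_itv.
  exact: (integrableB mI (vi h h0) ic).
move=> s /andP[s0 sh].
have s01 : 0 <= s <= 1 by rewrite s0 (le_trans sh).
apply: (le_trans (LP _ _ (vM _ s01) lM)); rewrite -mulrA ler_pM2l//.
by apply: (le_trans (vl _ s01)); rewrite ler_wpM2l.
Qed.

(** Here [y] stands for the state at the start of a step. [D] bounds [|l - v h l| / h], and [h0]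
    makes the exponent at most 1/2 in absolute value, so that the quadratic remainder of the
    exponential applies. *)
Lemma expR_cumulant_expansion l (K : R) : 0 <= l -> 0 <= K -> exists C h0 : R,
  [/\ 0 <= C, 0 < h0 & forall h y, 0 <= h <= h0 -> 0 <= y <= K ->
    `|expR (y * (l - v h l)) - (1 + h * y * Phi l)| <= C * h ^+ 2].
Proof.
move=> l0 K0.
have [C C0 CP] := cumulant_expansion l0.
pose D := `|Phi l| + C.
have D0 : 0 <= D by rewrite addr_ge0.
have KD0 : 0 < 2 * (K * D + 1) by rewrite mulr_gt0// ltr_wpDl// mulr_ge0.
exists (2 * (K * D) ^+ 2 + K * C), (Num.min 1 (2 * (K * D + 1))^-1); split.
- by rewrite addr_ge0 ?mulr_ge0 ?sqr_ge0.
- by rewrite lt_min ltr01 invr_gt0.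
move=> h y /andP[h0]; rewrite le_min => /andP[h1 h2] /andP[y0 yK].
have h01 : 0 <= h <= 1 by rewrite h0.
set a := l - v h l.
have aD : `|a| <= D * h.
  have -> : a = (a - h * Phi l) + h * Phi l by ring.
  apply: (le_trans (ler_normD _ _)).
  rewrite normrM (ger0_norm h0) /D mulrDl addrC mulrC lerD2l.
  apply: (le_trans (CP _ h01)); rewrite expr2 mulrA ler_piMr// mulr_ge0//.
have ya : `|y * a| <= K * D * h.
  by rewrite normrM (ger0_norm y0) -mulrA ler_pM.
have ya2 : `|y * a| <= 2^-1.
  apply: (le_trans ya).
  have : h * (2 * (K * D + 1)) <= 1 by rewrite -ler_pdivlMr// mul1r.
  have : 0 <= K * D by rewrite mulr_ge0.
  nra.
have -> : expR (y * a) - (1 + h * y * Phi l) =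
  (expR (y * a) - 1 - y * a) + y * (a - h * Phi l) by ring.
apply: (le_trans (ler_normD _ _)); rewrite mulrDl lerD//.
  apply: (le_trans (expR_sub1Dx_le ya2)).
  rewrite -(real_normK (num_real (y * a))) -mulrA -exprMn ler_pM2l//.
  by rewrite ler_pXn2r// ?nnegrE// (le_trans _ ya).
by rewrite normrM (ger0_norm y0) -mulrA ler_pM// CP.
Qed.

End small_time.

(** * One-step expansion *)

Section bounded_on.
Context {d : measure_display} {T : measurableType d} {R : realType} (A : set T).
Implicit Types (f g : T -> R).

(** The state and the powers of the ratio are bounded only where the state is capped; a factor
    vanishing outside [A] makes the product bounded everywhere. *)
Definition bounded_measurable_on f :=
  measurable_fun setT f /\ exists C : R, forall w, A w -> `|f w| <= C.

Lemma bounded_measurable_on_cst c : bounded_measurable_on (fun=> c).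
Proof. by split; [exact: measurable_cst|exists `|c|]. Qed.

Lemma bounded_measurable_onD f g : bounded_measurable_on f -> bounded_measurable_on g ->
  bounded_measurable_on (fun w => f w + g w).
Proof.
move=> [mf [C fC]] [mg [D gD]]; split; first exact: measurable_funD.
by exists (C + D) => w Aw; rewrite (le_trans (ler_normD _ _))// lerD ?fC ?gD.
Qed.

Lemma bounded_measurable_onM f g : bounded_measurable_on f -> bounded_measurable_on g ->
  bounded_measurable_on (fun w => f w * g w).
Proof.
move=> [mf [C fC]] [mg [D gD]]; split; first exact: measurable_funM.
by exists (C * D) => w Aw; rewrite normrM ler_pM ?fC ?gD.
Qed.

Lemma bounded_measurable_on_horner (p : {poly R}) f : bounded_measurable_on f ->
  bounded_measurable_on (fun w => p.[f w]).
Proof.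
move=> bf; elim/poly_ind: p => [|p c IH].
  under [X in bounded_measurable_on X]funext do rewrite horner0.
  exact: bounded_measurable_on_cst.
under [X in bounded_measurable_on X]funext do rewrite hornerMXaddC.
apply: bounded_measurable_onD; last exact: bounded_measurable_on_cst.
exact: bounded_measurable_onM.
Qed.

Lemma bounded_measurable_mul_on Y f : bounded_measurable Y -> (forall w, ~ A w -> Y w = 0) ->
  bounded_measurable_on f -> bounded_measurable (fun w => Y w * f w).
Proof.
move=> [mY [C YC]] Y0 [mf [D fD]]; split; first exact: measurable_funM.
exists (C * `|D|) => w; have C0 : 0 <= C by exact: le_trans (YC w).
have [Aw|nAw] := pselect (A w).
  by rewrite normrM ler_pM// (le_trans (fD _ Aw))// ler_norm.
by rewrite Y0// mul0r normr0 mulr_ge0.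
Qed.

End bounded_on.

Section one_step.
Context {d : measure_display} {T : measurableType d} {R : realType}.
Context (alpha beta : R) (pi : levy_measure R) (triple : branching_triple alpha beta pi).
Context (P : R -> probability T R) (X : R -> T -> R) (v : R -> R -> R).
Context (MP : markov_process P X).
Let Phi := branching_mechanism alpha beta pi.
Context (cum : cumulant_semigroup Phi v).
Context (laplaceX : forall x t l : R, 0 <= x -> 0 <= t -> 0 <= l ->
    ('E_(P x) [fun w => expR (- (l * X t w))] = (expR (- (x * v t l)))%:E)%E).
Implicit Types (x s h l K : R) (Y : T -> R) (p q : {poly R}).

Let mX (t : R) : 0 <= t -> measurable_fun setT (X t).
Proof. exact: mp_measurable MP t. Qed.

Let X_ge0 (t : R) (w : T) : 0 <= t -> 0 <= X t w.
Proof. exact: mp_ge0 MP t w. Qed.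

Let v_ge0 (t l : R) : 0 <= t -> 0 <= l -> 0 <= v t l.
Proof. by move=> t0 l0; have [+ _ _ _] := cum l0; apply. Qed.

(** What is needed of the past at time [s] for the one-step expansion: it is known at that time, and
    it vanishes above the cap, which keeps products with [expR (i * X s)] bounded. *)
Definition localized s K Y :=
  [/\ adapted X s Y, forall w, 0 <= Y w <= 1 & forall w, K < X s w -> Y w = 0].

Definition ratio s h w : R := expR (- (X (s + h) w - X s w)).

Section fixed_times.
Context (x s h l K : R) (Y : T -> R).
Context (x0 : 0 <= x) (s0 : 0 <= s) (h0 : 0 <= h) (l0 : 0 <= l) (locY : localized s K Y).

Let A := [set w | X s w <= K].

Let sh0 : 0 <= s + h. Proof. by rewrite addr_ge0. Qed.

Lemma localized_bounded_measurable : bounded_measurable Y.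
Proof.
have [aY Y01 _] := locY; split; first exact: adapted_measurable aY.
by exists 1 => w; have /andP[a b] := Y01 w; rewrite ger0_norm.
Qed.

Lemma bounded_measurable_localized f : bounded_measurable_on A f ->
  bounded_measurable (fun w => Y w * f w).
Proof.
apply: bounded_measurable_mul_on; first exact: localized_bounded_measurable.
by have [_ _ Y0] := locY => w nA; apply: Y0; rewrite ltNge; apply/negP.
Qed.

Lemma bounded_on_expRN t : 0 <= t -> bounded_measurable_on A (fun w => expR (- (l * X t w))).
Proof.
move=> t0; split; first exact/measurable_fun_expRN/mX.
exists 1 => w _; rewrite ger0_norm ?expR_ge0//.
by have /andP[] := expRN_unit l0 (X_ge0 w t0).
Qed.

Lemma bounded_on_process : bounded_measurable_on A (X s).
Proof.
split; first exact: mX.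
by exists K => w /=; rewrite ger0_norm// X_ge0.
Qed.

Lemma ratio_gt0 w : 0 < ratio s h w. Proof. exact: expR_gt0. Qed.

(** The process is nonnegative, so from a state at most [K] it cannot fall by more than [K]. The
    polynomial approximation is thus needed on a compact interval only. *)
Lemma ratio_le w : A w -> ratio s h w <= expR K.
Proof.
by rewrite /A/= => XK; rewrite ler_expR opprB; have := X_ge0 w sh0; lra.
Qed.

Lemma bounded_on_ratio : bounded_measurable_on A (ratio s h).
Proof.
split.
  by do 2 apply: measurableT_comp => //; apply: measurable_funB; exact: mX.
exists (expR K) => w Aw; rewrite ger0_norm; first exact: ratio_le.
exact/ltW/ratio_gt0.
Qed.

Lemma bounded_measurable_step f : bounded_measurable_on A f ->
  bounded_measurable (fun w => Y w * (expR (- (l * X (s + h) w)) * f w)).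
Proof.
by move=> bf; apply/bounded_measurable_localized/bounded_measurable_onM => //; exact: bounded_on_expRN.
Qed.

Lemma bounded_measurable_start f : bounded_measurable_on A f ->
  bounded_measurable (fun w => Y w * (expR (- (l * X s w)) * f w)).
Proof.
by move=> bf; apply/bounded_measurable_localized/bounded_measurable_onM => //; exact: bounded_on_expRN.
Qed.

(** A factor [ratio^i] shifts the Laplace exponent from [l] to [l + i] and leaves [expR (i * X s)],
    which is known at time [s] and at most [expR (i * K)] where [Y] does not vanish; the conditional
    Laplace transform is applied with this factor joined to [Y]. *)
Lemma laplace_monomial (i : nat) :
  \int[P x]_w (Y w * (expR (- (l * X (s + h) w)) * ratio s h w ^+ i)) =
  \int[P x]_w (Y w * (expR (- (l * X s w)) * expR (X s w * (l + i%:R - v h (l + i%:R))))).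
Proof.
have [aY Y01 Y0] := locY.
have li0 : 0 <= l + i%:R by rewrite addr_ge0.
transitivity (\int[P x]_w ((Y w * expR (i%:R * X s w)) * expR (- ((l + i%:R) * X (s + h) w)))).
  apply: eq_Rintegral => w _; rewrite -mulrA -[ratio s h w ^+ i]expRM_natl -!expRD.
  by congr (_ * expR _); ring.
rewrite (conditional_laplace MP v_ge0 laplaceX (C := expR (i%:R * K)))//.
- apply: eq_Rintegral => w _; rewrite -mulrA -!expRD.
  by congr (_ * expR _); ring.
- apply: adaptedM => //.
  apply: (@adapted_comp _ _ _ X s (X s) (fun y => expR (i%:R * y))).
    by apply: measurableT_comp => //; apply: measurable_funM.
  by apply: adapted_process; rewrite s0 lexx.
move=> w; have /andP[Ya Yb] := Y01 w.
rewrite mulr_ge0 ?expR_ge0//=.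
have [XK|/Y0 ->] := leP (X s w) K; last by rewrite mul0r expR_ge0.
by rewrite -[leRHS]mul1r ler_pM ?expR_ge0// ler_expR ler_wpM2l.
Qed.

End fixed_times.

(** The coefficients [c] and [k] are parameters so that expansions can be combined linearly in [p].
    The constants [C] and [h0] come before [x], [s] and [Y]: this uniformity allows summing the
    errors over the grid. *)
Definition expansion l K p (c k : R) := exists C h0 : R, [/\ 0 <= C, 0 < h0 &
  forall x s h Y, 0 <= x -> 0 <= s -> 0 <= h <= h0 -> localized s K Y ->
  `|\int[P x]_w (Y w * (expR (- (l * X (s + h) w)) * p.[ratio s h w]))
    - (c * \int[P x]_w (Y w * expR (- (l * X s w)))
       + h * k * \int[P x]_w (Y w * (expR (- (l * X s w)) * X s w)))| <= C * h ^+ 2].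

Lemma expansion0 l K : expansion l K 0 0 0.
Proof.
exists 0, 1; split => // x s h Y x0 s0 _ _.
under eq_Rintegral do rewrite horner0 !mulr0.
by rewrite expectation_cst mulr0 !mul0r addr0 subrr normr0.
Qed.

Lemma expansionD l K p q c k c' k' : 0 <= l -> expansion l K p c k -> expansion l K q c' k' ->
  expansion l K (p + q) (c + c') (k + k').
Proof.
move=> l0 [C [h0 [C0 h00 H]]] [C' [h0' [C0' h00' H']]].
exists (C + C'), (Num.min h0 h0'); split; [exact: addr_ge0|by rewrite lt_min h00|].
move=> x s h Y x0 s0 /andP[hh]; rewrite le_min => /andP[h1 h2] lY.
have bp p' : bounded_measurable (fun w => Y w * (expR (- (l * X (s + h) w)) * p'.[ratio s h w])).
  apply: (bounded_measurable_step s0 hh l0 lY); apply: bounded_measurable_on_horner.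
  exact: bounded_on_ratio.
under eq_Rintegral do rewrite hornerD !mulrDr.
rewrite expectationD//.
have := H x s h Y x0 s0; rewrite hh h1 => /(_ isT lY) Hp.
have := H' x s h Y x0 s0; rewrite hh h2 => /(_ isT lY) Hq.
rewrite mulrDl; move: Hp Hq; rewrite !ler_norml.
set a := \int[P x]_w _; set b := \int[P x]_w _; set e := \int[P x]_w _; set f := \int[P x]_w _.
move=> /andP[p1 p2] /andP[q1 q2]; apply/andP; split; lra.
Qed.

Lemma expansionZ l K p c k (r : R) : 0 <= l -> expansion l K p c k ->
  expansion l K (r *: p) (r * c) (r * k).
Proof.
move=> l0 [C [h0 [C0 h00 H]]].
exists (`|r| * C), h0; split => //; first exact: mulr_ge0.
move=> x s h Y x0 s0 h1 lY; have /andP[hh _] := h1.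
have bp p' : bounded_measurable (fun w => Y w * (expR (- (l * X (s + h) w)) * p'.[ratio s h w])).
  apply: (bounded_measurable_step s0 hh l0 lY); apply: bounded_measurable_on_horner.
  exact: bounded_on_ratio.
under eq_Rintegral do rewrite hornerZ 2!(mulrCA _ r).
rewrite expectationZ// -!mulrA (mulrCA h r) -mulrDr -mulrBr normrM ler_wpM2l//.
by have := H _ _ _ _ x0 s0 h1 lY; rewrite -[h * k * _]mulrA.
Qed.

Lemma expansion_monomial l K (i : nat) : 0 <= l -> 0 <= K ->
  expansion l K ('X^i) 1 (Phi (l + i%:R)).
Proof.
move=> l0 K0.
have li0 : 0 <= l + i%:R by rewrite addr_ge0.
have [C [h0 [C0 h00 H]]] := expR_cumulant_expansion triple cum li0 K0.
exists C, h0; split => // x s h Y x0 s0 h1 lY.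
have [aY Y01 Y0] := lY; have /andP[hh _] := h1.
under eq_Rintegral do rewrite hornerXn.
rewrite (laplace_monomial x0 s0 hh l0 lY) mul1r.
have bX := @bounded_on_process s K s0.
have be := @bounded_measurable_start s l K Y s0 l0 lY.
have b1 : bounded_measurable (fun w => Y w * expR (- (l * X s w))).
  under [Z in bounded_measurable Z]funext => w do rewrite -[expR _]mulr1.
  by apply: be; exact: bounded_measurable_on_cst.
have b2 : bounded_measurable (fun w => Y w * (expR (- (l * X s w)) * X s w)) by exact: be.
rewrite -expectationZ// -expectationD//; last exact: bounded_measurableZ.
apply: expectation_dist_cst.
- apply: be; split.
    by apply: measurableT_comp => //; apply: measurable_funM => //; exact: mX.
  exists (expR (K * `|l + i%:R - v h (l + i%:R)|)) => w /= XK.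
  rewrite ger0_norm ?expR_ge0// ler_expR.
  apply: (le_trans (ler_norm _)); rewrite normrM ler_wpM2r//.
  by rewrite ger0_norm// X_ge0.
- by apply: bounded_measurableD => //; exact: bounded_measurableZ.
move=> w.
have [XK|/Y0 ->] := leP (X s w) K; last first.
  by rewrite !mul0r mulr0 addr0 subrr normr0 mulr_ge0// sqr_ge0.
rewrite (_ : _ - _ = (Y w * expR (- (l * X s w))) *
  (expR (X s w * (l + i%:R - v h (l + i%:R))) - (1 + h * X s w * Phi (l + i%:R)))); last by ring.
have /andP[Ya Yb] := Y01 w.
have /andP[ea eb] := expRN_unit l0 (X_ge0 w s0).
rewrite normrM -[leRHS]mul1r ler_pM//.
  by rewrite ger0_norm ?mulr_ge0// mulr_ile1.
by apply: H => //; rewrite XK X_ge0.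
Qed.

(* The coefficient of [h] in the expansion of [(1 - 'X) ^+ 2 * p]. *)
Definition levy_functional l p : R := 2 * beta * p.[1] +
  \int[pi]_(t in `]0, +oo[) (expR (- (l * t)) * (1 - expR (- t)) ^+ 2 * p.[expR (- t)]).

Let piI : (\int[pi]_(t in `]0%R, +oo[) (Num.min t (t ^+ 2))%:E < +oo)%E := bt_integrable triple.

(** The factor [(1 - e^-t)^2] is at most 1, [t] and [t^2] at the relevant places, hence at most
    [min (t, t^2)], so that boundedness of [f] on [0, 1] is enough. *)
Lemma levy_square_integrable (f : R -> R) l (C : R) : 0 <= l ->
  measurable_fun (`]0, +oo[ : set (measurableTypeR R))
    (fun t : R => expR (- (l * t)) * (1 - expR (- t)) ^+ 2 * f (expR (- t))) ->
  (forall w, 0 <= w <= 1 -> `|f w| <= C) ->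
  pi.-integrable `]0, +oo[ 
    (EFin \o (fun t : R => expR (- (l * t)) * (1 - expR (- t)) ^+ 2 * f (expR (- t)))).
Proof.
move=> l0 mf fC.
apply: (@levy_integrable _ _ piI _ _ C) => //.
move=> t; rewrite /= in_itv/= andbT => t0.
have e1 : 0 <= expR (- t) <= 1 by rewrite expR_ge0 -expR0 ler_expR oppr_le0 ltW.
have e2 : 0 <= expR (- (l * t)) <= 1 by apply: expRN_unit => //; exact: ltW.
have e3 := expR_ge1Dx (- t).
have C0 : 0 <= C by exact: le_trans (fC _ e1).
rewrite normrM mulrC ler_pM ?fC//.
case/andP: e1 => e11 e12; case/andP: e2 => e21 e22.
have s0 : 0 <= (1 - expR (- t)) ^+ 2 by exact: sqr_ge0.
apply: (@le_trans _ _ ((1 - expR (- t)) ^+ 2)).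
  by rewrite ger0_norm; [exact: ler_piMl|exact: mulr_ge0].
by rewrite le_min; apply/andP; split; nra.
Qed.

Lemma measurable_fun_horner (p : {poly R}) : measurable_fun setT (fun w : R => p.[w]).
Proof. by apply: continuous_measurable_fun; exact: continuous_horner. Qed.

Lemma horner_bounded p : exists C, forall w, 0 <= w <= 1 -> `|p.[w]| <= C.
Proof.
exists (\sum_(i < size p) `|p`_i|) => w /andP[w0 w1].
rewrite horner_coef; apply: (le_trans (ler_norm_sum _ _ _)).
apply: ler_sum => i _; rewrite normrM -[leRHS]mulr1 ler_wpM2l//.
by rewrite ger0_norm ?exprn_ge0// exprn_ile1.
Qed.

Let levy_poly_integrable l p : 0 <= l -> pi.-integrable `]0, +oo[
  (EFin \o (fun t : R => expR (- (l * t)) * (1 - expR (- t)) ^+ 2 * p.[expR (- t)])).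
Proof.
move=> l0; have [C CP] := horner_bounded p.
apply: (@levy_square_integrable (fun w => p.[w]) l C) => //.
apply: measurable_funM.
  apply: measurable_funM; first exact: measurable_fun_expRN_mul.
  apply: measurable_funX; apply: measurable_funB => //.
  by do 2 apply: measurableT_comp => //.
apply: measurableT_comp; first exact: measurable_fun_horner.
by do 2 apply: measurableT_comp => //.
Qed.

Lemma levy_functionalD l p q : 0 <= l ->
  levy_functional l (p + q) = levy_functional l p + levy_functional l q.
Proof.
move=> l0; rewrite /levy_functional.
under [in LHS]eq_Rintegral do rewrite hornerD mulrDr.
rewrite RintegralD//; [|exact: levy_poly_integrable..].
by rewrite hornerD; ring.
Qed.

Lemma levy_functionalZ l p r : 0 <= l ->
  levy_functional l (r *: p) = r * levy_functional l p.
Proof.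
move=> l0; rewrite /levy_functional.
under [in LHS]eq_Rintegral do rewrite hornerZ mulrCA.
rewrite RintegralZl//; last exact: levy_poly_integrable.
by rewrite hornerZ; ring.
Qed.

Lemma levy_functional0 l : levy_functional l 0 = 0.
Proof.
rewrite /levy_functional; under eq_Rintegral do rewrite horner0 mulr0.
by rewrite Rintegral_cst// mul0r horner0 mulr0 addr0.
Qed.

Lemma levy_functional_monomial l (i : nat) : 0 <= l -> levy_functional l 'X^i =
  Phi (l + i%:R) - 2 * Phi (l + i%:R + 1) + Phi (l + i%:R + 2).
Proof.
move=> l0; rewrite /Phi branching_mechanism_second_difference ?addr_ge0//.
rewrite /levy_functional hornerXn expr1n mulr1; congr (_ + _).
apply: eq_Rintegral => t _; rewrite hornerXn -expRM_natl mulrAC -expRD.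
by congr (expR _ * _); ring.
Qed.

(** By linearity it is enough to take [p = 'X^i], where [(1 - 'X)^2 'X^i] has coefficients 1, -2, 1:
    they cancel at order 0, and at order 1 they form the second difference of Phi at [l + i]. *)
Lemma expansion_levy l K p : 0 <= l -> 0 <= K ->
  expansion l K ((1 - 'X) ^+ 2 * p) 0 (levy_functional l p).
Proof.
move=> l0 K0; rewrite -(coefK p) poly_def.
apply: (big_ind (fun q => expansion l K ((1 - 'X) ^+ 2 * q) 0 (levy_functional l q))).
- by rewrite mulr0 levy_functional0; exact: expansion0.
- move=> q q' eq eq'; rewrite mulrDr levy_functionalD// -[0]addr0; exact: expansionD.
move=> i _; rewrite -scalerAr levy_functionalZ//.
have eZ : forall q k, expansion l K q 0 k -> expansion l K (p`_i *: q) 0 (p`_i * k).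
  by move=> q k /(expansionZ p`_i l0); rewrite mulr0.
apply: eZ.
rewrite levy_functional_monomial//.
have -> : (1 - 'X) ^+ 2 * 'X^i = 'X^i + ((- 2) *: 'X^(i.+1) + 'X^(i.+2)) :> {poly R}.
  by rewrite -mul_polyC !exprS polyCN; ring.
rewrite (_ : (0 : R) = 1 + ((- 2) * 1 + 1)); last by ring.
rewrite -addrA -mulNr; apply: expansionD => //; first exact: expansion_monomial.
apply: expansionD => //.
  apply: expansionZ => //.
  by rewrite -addrA natr1; exact: expansion_monomial.
rewrite -addrA -natrD addn2; exact: expansion_monomial.
Qed.

(** The quotient of the cutoff by [(1 - w)^2] vanishes at 1, so its Lipschitz constant bounds it on
    [0, 1]. *)
Lemma cutoff_integrable a b l : 0 <= l -> b < a -> 0 < a -> a < 1 -> pi.-integrable `]0, +oo[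
  (EFin \o (fun t : R => expR (- (l * t)) * cutoff a b (expR (- t)))).
Proof.
move=> l0 ba a0 a1; have [L L0 LP] := cutoff_quotient_lip ba a0 a1.
have fE (t : R) : expR (- (l * t)) * cutoff a b (expR (- t)) =
  expR (- (l * t)) * (1 - expR (- t)) ^+ 2 * cutoff_quotient a b (expR (- t)).
  by rewrite -mulrA cutoffE.
rewrite (_ : (fun t : R => _) = (fun t : R => expR (- (l * t)) * (1 - expR (- t)) ^+ 2 *
  cutoff_quotient a b (expR (- t)))); last by apply/funext => t; rewrite fE.
apply: (@levy_square_integrable _ l L) => //.
  under [Z in measurable_fun _ Z]funext do rewrite -fE.
  apply: measurable_funM; first exact: measurable_fun_expRN_mul.
  apply: measurableT_comp; first exact: measurable_fun_cutoff.
  by do 2 apply: measurableT_comp => //.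
move=> w /andP[w0 w1].
have := LP w 1 w0 ler01; rewrite cutoff_quotient1// subr0 => /le_trans; apply.
by rewrite ler_piMr ?(ltW L0)// ler_norml; lra.
Qed.

(** The function F of the overview with the indicator of large jumps smoothed into the cutoff. *)
Definition cut_mechanism a b l : R :=
  \int[pi]_(t in `]0, +oo[) (expR (- (l * t)) * cutoff a b (expR (- t))) - Phi l.

(** The quotient is replaced by a polynomial within [dl]. On the path side the error is [dl] times
    the mean [A3] of [(1 - w)^2], itself of order [h] by the expansion for [p = 1]; on the Levy side
    it is at most [dl * I2]. Both are therefore small multiples of [h]. *)
Lemma one_step_expansion a b l K (e : R) : 0 <= l -> 0 <= K -> b < a -> 0 < a -> a < 1 -> 0 < e ->
  exists2 h0 : R, 0 < h0 & forall x s h Y, 0 <= x -> 0 <= s -> 0 <= h <= h0 -> localized s K Y ->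
  `|\int[P x]_w (Y w * (expR (- (l * X (s + h) w)) * (1 - cutoff a b (ratio s h w))))
    - (\int[P x]_w (Y w * expR (- (l * X s w)))
       - h * cut_mechanism a b l * \int[P x]_w (Y w * (expR (- (l * X s w)) * X s w)))| <= e * h.
Proof.
move=> l0 K0 ba a0 a1 e0.
pose I2 := levy_functional l 1.
have I2_ge0 : 0 <= I2.
  rewrite /I2 /levy_functional hornerC mulr1 addr_ge0//.
    by rewrite mulr_ge0// (bt_beta_ge0 triple).
  apply: Rintegral_ge0 => t _; rewrite hornerC mulr1 mulr_ge0 ?expR_ge0//.
  exact: sqr_ge0.
pose dl := e / (4 * (I2 * K + 1)).
have IK0 : 0 <= I2 * K by rewrite mulr_ge0.
have dl0 : 0 < dl by rewrite divr_gt0// mulr_gt0// ltr_wpDl.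
have dlE : dl * (4 * (I2 * K + 1)) = e.
  by rewrite /dl divfK// lt0r_neq0// mulr_gt0// ltr_wpDl.
(* The interval must contain the ratios, up to [expR K], as well as the values [expR (- t)] and the
   point 1 occurring in the Levy functional. *)
have S0 : 0 < Num.max 1 (expR K) by rewrite lt_max ltr01.
have [p pP] := cutoff_quotient_approx ba a0 a1 S0 dl0.
have [C1 [h1 [C10 h10 H1]]] := expansion_levy 1 l0 K0.
have [C2 [h2 [C20 h20 H2]]] := expansion_monomial 0 l0 K0.
have [C3 [h3 [C30 h30 H3]]] := expansion_levy p l0 K0.
pose D := dl * C1 + C2 + C3.
have D0 : 0 <= D by rewrite !addr_ge0// mulr_ge0// ltW.
(* [D * h^2] collects the quadratic remainders of the three expansions; for [h <= h4] it is at most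
   the other half, [e / 2 * h]. *)
pose h4 := e / (2 * (D + 1)).
have h40 : 0 < h4 by rewrite divr_gt0// mulr_gt0// ltr_wpDl.
have h4E : h4 * (2 * (D + 1)) = e.
  by rewrite /h4 divfK// lt0r_neq0// mulr_gt0// ltr_wpDl.
exists (Num.min (Num.min h1 h2) (Num.min h3 h4)); first by rewrite !lt_min h10 h20 h30.
move=> x s h Y x0 s0 /andP[hh]; rewrite !le_min => /andP[/andP[hh1 hh2] /andP[hh3 hh4]] lY.
have [aY Y01 Y0] := lY.
pose m := \int[P x]_w (Y w * expR (- (l * X s w))).
pose M := \int[P x]_w (Y w * (expR (- (l * X s w)) * X s w)).
have {}H1 := H1 x s h Y x0 s0 _ lY; rewrite hh hh1 in H1; have {}H1 := H1 isT.
have {}H2 := H2 x s h Y x0 s0 _ lY; rewrite hh hh2 in H2; have {}H2 := H2 isT.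
have {}H3 := H3 x s h Y x0 s0 _ lY; rewrite hh hh3 in H3; have {}H3 := H3 isT.
rewrite -/m -/M in H1 H2 H3 *.
have bX := @bounded_on_process s K s0.
have bS := @bounded_measurable_step s h l K Y s0 hh l0 lY.
have bR := @bounded_on_ratio s h K s0 hh.
have bP q := bS _ (bounded_measurable_on_horner q bR).
have bC : bounded_measurable_on [set w | X s w <= K] (fun w => cutoff a b (ratio s h w)).
  split.
    by apply: measurableT_comp; [exact: measurable_fun_cutoff|exact: bR.1].
  by exists 1 => w _; rewrite ger0_norm ?cutoff_ge0 ?cutoff_le1.
have b1 : bounded_measurable (fun w => Y w * expR (- (l * X (s + h) w))).
  under [Z in bounded_measurable Z]funext => w do rewrite -[expR _]mulr1.
  by apply: bS; exact: bounded_measurable_on_cst.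
have bM : bounded_measurable (fun w => Y w * (expR (- (l * X s w)) * X s w)).
  exact: (bounded_measurable_start s0 l0 lY).
have M_ge0 : 0 <= M.
  by apply: Rintegral_ge0 => w _; case/andP: (Y01 w) => ? _; rewrite !mulr_ge0 ?expR_ge0// X_ge0.
have M_le : M <= K.
  rewrite -[leRHS](expectation_cst (P x)); apply: expectation_le => //.
    exact: bounded_measurable_cst.
  move=> w; have [XK|/Y0 ->] := leP (X s w) K; last by rewrite mul0r.
  have /andP[Ya Yb] := Y01 w; have /andP[ea eb] := expRN_unit l0 (X_ge0 w s0).
  rewrite mulrA -[leRHS]mul1r ler_pM ?mulr_ge0 ?X_ge0//.
  by rewrite mulr_ile1.
pose q2 : {poly R} := (1 - 'X) ^+ 2.
pose J := \int[pi]_(t in `]0, +oo[) (expR (- (l * t)) * cutoff a b (expR (- t))).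
have S1 : 0 <= (1 : R) <= Num.max 1 (expR K) by rewrite ler01 le_max lexx.
have kJ : `|levy_functional l p - J| <= dl * I2.
  have JE : J = \int[pi]_(t in `]0, +oo[)
      (expR (- (l * t)) * (1 - expR (- t)) ^+ 2 * cutoff_quotient a b (expR (- t))).
    by apply: eq_Rintegral => t _; rewrite -mulrA cutoffE.
  have ig : pi.-integrable `]0, +oo[ (EFin \o (fun t : R =>
      expR (- (l * t)) * (1 - expR (- t)) ^+ 2 * cutoff_quotient a b (expR (- t)))).
    have := cutoff_integrable l0 ba a0 a1; congr (_.-integrable _ _).
    by apply/funext => t /=; rewrite -mulrA cutoffE.
  have ip := levy_poly_integrable p l0.
  have i1 := levy_poly_integrable 1 l0.
  rewrite JE /levy_functional -addrA -RintegralB//.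
  apply: (le_trans (ler_normD _ _)).
  rewrite /I2 /levy_functional hornerC mulr1 [leRHS]mulrDr lerD//.
    (* The quotient vanishes at 1, so [|p.[1]| <= dl]: the diffusion term contributes to the error
       only. *)
    rewrite normrM ger0_norm ?mulr_ge0 ?(bt_beta_ge0 triple)// mulrC.
    rewrite ler_wpM2r ?mulr_ge0 ?(bt_beta_ge0 triple)//.
    by have := pP 1 S1; rewrite cutoff_quotient1// subr0.
  have mI : @measurable _ (measurableTypeR R) `]0%R, +oo[ by exact: measurable_itv.
  have iB := integrableB mI ip ig.
  apply: (le_trans (le_normr_Rintegral mI iB)).
  rewrite -RintegralZl//; apply: le_Rintegral => //.
  - exact: integrable_norm.
  - exact: (integrableZl mI dl i1).
  move=> t; rewrite /= in_itv/= andbT => t0.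
  have q0 : 0 <= expR (- (l * t)) * (1 - expR (- t)) ^+ 2.
    by apply: mulr_ge0; [exact: expR_ge0|exact: sqr_ge0].
  rewrite hornerC mulr1 -mulrBr normrM (ger0_norm q0) mulrC ler_wpM2r//.
  apply: pP; rewrite expR_ge0/= le_max; apply/orP; left.
  by rewrite -expR0 ler_expR oppr_le0 ltW.
set A0 := \int[P x]_w _.
pose A1 := \int[P x]_w (Y w * expR (- (l * X (s + h) w))).
pose A2 := \int[P x]_w (Y w * (expR (- (l * X (s + h) w)) * (q2 * p).[ratio s h w])).
pose A3 := \int[P x]_w (Y w * (expR (- (l * X (s + h) w)) * (q2 * 1).[ratio s h w])).
have E0 : `|A0 - (A1 - A2)| <= dl * A3.
  rewrite /A1 /A2 -expectationB//.
  apply: expectation_dist => //.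
  - apply: bS; have := bounded_measurable_onM (bounded_measurable_on_cst _ (- 1)) bC.
    move=> /(bounded_measurable_onD (bounded_measurable_on_cst _ 1)).
    by under [Z in bounded_measurable_on _ Z -> _]funext do rewrite mulN1r.
  - exact: bounded_measurableB.
  move=> w; have [XK|/Y0 ->] := leP (X s w) K; last first.
    by rewrite !mul0r !subrr mulr0 normr0.
  have /andP[Ya Yb] := Y01 w; have e'0 := expR_ge0 (- (l * X (s + h) w)).
  set r := ratio s h w; set E := expR _.
  have hq q : (q2 * q).[r] = (1 - r) ^+ 2 * q.[r].
    by rewrite hornerM horner_exp hornerD hornerN hornerX hornerC.
  rewrite !hq hornerC mulr1 -(cutoffE _ ba a1).
  have rS : 0 <= r <= Num.max 1 (expR K).
    by rewrite ltW ?ratio_gt0//= le_max (ratio_le s0 hh)// orbT.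
  have -> : Y w * (E * (1 - (1 - r) ^+ 2 * cutoff_quotient a b r)) -
    (Y w * E - Y w * (E * ((1 - r) ^+ 2 * p.[r]))) =
    (Y w * (E * ((1 - r) ^+ 2))) * (p.[r] - cutoff_quotient a b r) by ring.
  have q0 : 0 <= Y w * (E * (1 - r) ^+ 2).
    by apply: mulr_ge0 => //; apply: mulr_ge0 => //; exact: sqr_ge0.
  by rewrite normrM (ger0_norm q0) mulrC; apply: ler_wpM2r => //; exact: pP.
have A1E : `|A1 - (m + h * Phi l * M)| <= C2 * h ^+ 2.
  move: H2; rewrite addr0 mul1r.
  by under eq_Rintegral do rewrite hornerXn expr0 mulr1.
have {}H1 : `|A3 - h * I2 * M| <= C1 * h ^+ 2 by move: H1; rewrite mul0r add0r.
have {}H3 : `|A2 - h * levy_functional l p * M| <= C3 * h ^+ 2.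
  by move: H3; rewrite mul0r add0r.
have A3_le : A3 <= h * I2 * K + C1 * h ^+ 2.
  have : h * I2 * M <= h * I2 * K by rewrite ler_wpM2l// mulr_ge0.
  move: H1; rewrite ler_norml; lra.
have kJM : `|h * (levy_functional l p - J) * M| <= h * (dl * I2) * K.
  rewrite !normrM (ger0_norm hh) (ger0_norm M_ge0) ler_pM ?mulr_ge0//.
  by rewrite ler_wpM2l.
have -> : A0 - (m - h * cut_mechanism a b l * M) = (A0 - (A1 - A2)) +
  ((A1 - (m + h * Phi l * M)) - (A2 - h * levy_functional l p * M)) -
  h * (levy_functional l p - J) * M by rewrite /cut_mechanism -/J; ring.
have dlA3 : dl * A3 <= dl * (h * I2 * K + C1 * h ^+ 2) by rewrite ler_wpM2l// ltW.
have Dh : D * h ^+ 2 <= e / 2 * h.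
  rewrite expr2 mulrA ler_wpM2r//.
  have : D * h <= D * h4 by rewrite ler_wpM2l.
  have : 0 <= h4 by exact: ltW.
  move: h4E; lra.
have dlIK : 2 * (dl * (I2 * K)) * h <= e / 2 * h.
  rewrite ler_wpM2r//; move: dlE; have := ltW dl0; lra.
apply: (le_trans (ler_normB _ _)); apply: (le_trans (lerD (ler_normD _ _) (lexx _))).
have := ler_normB (A1 - (m + h * Phi l * M)) (A2 - h * levy_functional l p * M).
move: Dh; rewrite /D; lra.
Qed.

End one_step.

(** * Iteration along a grid *)

Section survival.
Context {d : measure_display} {T : measurableType d} {R : realType}.
Context (X : R -> T -> R) (mX : forall t : R, 0 <= t -> measurable_fun setT (X t)).
Context (a b : R) (C : set R) (mC : measurable C).
Implicit Types (h K : R) (k : nat) (w : T).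

Definition no_jump_factor h k w : R := 1 - cutoff a b (ratio X (k%:R * h) h w).

(* A smoothed indicator of the event that the increments of [X] over the first
   [k] steps of the grid are small and that [X] stays in [C] at grid times. *)
Fixpoint survival h k w : R :=
  if k is k'.+1 then survival h k' w * no_jump_factor h k' w * \1_C (X (k'%:R * h + h) w)
  else \1_C (X 0 w).

Lemma gridS h k : k.+1%:R * h = k%:R * h + h :> R.
Proof. by rewrite -natr1 mulrDl mul1r. Qed.

Lemma no_jump_factor01 h k w : 0 <= no_jump_factor h k w <= 1.
Proof.
by rewrite /no_jump_factor subr_ge0 cutoff_le1 gerBl cutoff_ge0.
Qed.

Let indic01 (y : R) : 0 <= (\1_C y : R) <= 1.
Proof. by rewrite indicE; case: (y \in C); rewrite ?ler01 ?lexx. Qed.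

Lemma survival01 h k w : 0 <= survival h k w <= 1.
Proof.
elim: k => [|k /andP[IH1 IH2]] /=; first exact: indic01.
have /andP[f1 f2] := no_jump_factor01 h k w.
have /andP[i1 i2] := indic01 (X (k%:R * h + h) w).
by rewrite !mulr_ge0//= !mulr_ile1 ?mulr_ge0.
Qed.

Lemma survivalS_le h k w : survival h k.+1 w <= survival h k w.
Proof.
have /andP[s1 s2] := survival01 h k w.
have /andP[f1 f2] := no_jump_factor01 h k w.
have /andP[i1 i2] := indic01 (X (k%:R * h + h) w).
by rewrite /= -mulrA ler_piMr// mulr_ile1.
Qed.

Lemma survival_le h k k' w : (k <= k')%N -> survival h k' w <= survival h k w.
Proof.
move=> /subnK <-; elim: (k' - k)%N => [|n IH]; first by rewrite add0n.
by rewrite addSn (le_trans (survivalS_le _ _ _)).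
Qed.

Lemma survival_adapted h k : 0 <= h -> adapted X (k%:R * h) (survival h k).
Proof.
move=> h0.
have mind : measurable_fun setT (\1_C : R -> R) by exact: measurable_indic.
have kh0 (j : nat) : 0 <= j%:R * h by rewrite mulr_ge0.
elim: k => [|k IH] /=.
  apply: (@adapted_comp _ _ _ X _ (X 0) (\1_C)) => //.
  by apply: adapted_process; rewrite lexx kh0.
rewrite gridS.
apply: adaptedM; last first.
  apply: (@adapted_comp _ _ _ X _ (X (k%:R * h + h)) (\1_C)) => //.
  by apply: adapted_process; rewrite lexx addr_ge0 ?kh0.
apply: adaptedM.
  by apply: adapted_mono IH; rewrite lerDl.
apply: (@adapted_comp _ _ _ X _ (fun w => X (k%:R * h + h) w - X (k%:R * h) w)
  (fun y => 1 - cutoff a b (expR (- y)))).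
  apply: measurable_funB => //; apply: measurableT_comp; first exact: measurable_fun_cutoff.
  by do 2 apply: measurableT_comp => //.
apply: adaptedB; apply: adapted_process.
  by rewrite lexx addr_ge0 ?kh0.
by rewrite lerDl h0 kh0.
Qed.

Lemma survival_bounded_measurable h k : 0 <= h -> bounded_measurable (survival h k).
Proof.
move=> h0; split; first by apply: (adapted_measurable mX); exact: survival_adapted.
by exists 1 => w; have /andP[s1 s2] := survival01 h k w; rewrite ger0_norm.
Qed.

End survival.

Lemma survival_setT_ge {d : measure_display} {T : measurableType d} {R : realType}
    (X : R -> T -> R) (a b : R) (C : set R) h k w :
  survival X a b C h k w <= survival X a b setT h k w.
Proof.
have i01 (y : R) : 0 <= (\1_C y : R) <= 1.
  by rewrite indicE; case: (y \in C); rewrite ?ler01 ?lexx.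
elim: k => [|k IH] /=; first by rewrite indicT; case/andP: (i01 (X 0 w)).
have /andP[f1 f2] := no_jump_factor01 X a b h k w.
have /andP[s1 s2] := survival01 X a b C h k w.
have /andP[i1 i2] := i01 (X (k%:R * h + h) w).
by rewrite indicT mulr1 -[leRHS]mulr1 ler_pM ?mulr_ge0// ler_wpM2r.
Qed.

Section grid_estimates.
Context {d : measure_display} {T : measurableType d} {R : realType}.
Context (alpha beta : R) (pi : levy_measure R) (triple : branching_triple alpha beta pi).
Context (P : R -> probability T R) (X : R -> T -> R) (v : R -> R -> R).
Context (MP : markov_process P X).
Let Phi := branching_mechanism alpha beta pi.
Context (cum : cumulant_semigroup Phi v).
Context (laplaceX : forall x t l : R, 0 <= x -> 0 <= t -> 0 <= l ->
    ('E_(P x) [fun w => expR (- (l * X t w))] = (expR (- (x * v t l)))%:E)%E).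
Context (a b : R) (ba : b < a) (a0 : 0 < a) (a1 : a < 1).
Implicit Types (x s h l K e : R) (k N : nat).

Let mX (t : R) : 0 <= t -> measurable_fun setT (X t).
Proof. exact: mp_measurable MP t. Qed.

Let X_ge0 (t : R) (w : T) : 0 <= t -> 0 <= X t w.
Proof. exact: mp_ge0 MP t w. Qed.

Let F l := cut_mechanism alpha beta pi a b l.

Let capped K : set R := `]-oo, K].

Let S K h k w := survival X a b (capped K) h k w.

Let mcapped K : measurable (capped K). Proof. exact: measurable_itv. Qed.

Let cappedE K (y : R) : capped K y = (y <= K) :> Prop.
Proof. by rewrite /capped/= in_itv. Qed.

Lemma survival_localized K h k : 0 <= h -> localized X (k%:R * h) K (S K h k).
Proof.
move=> h0; split; first exact: survival_adapted.
  by move=> w; exact: survival01.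
move=> w; case: k => [|k] /=.
  rewrite mul0r => KX; rewrite /S/= indicE memNset// cappedE; apply/negP.
  by rewrite -ltNge.
rewrite gridS => KX; rewrite /S/= indicE memNset ?mulr0// cappedE; apply/negP.
by rewrite -ltNge.
Qed.

Let grid_ge0 h k : 0 <= h -> 0 <= k%:R * h.
Proof. by move=> h0; rewrite mulr_ge0. Qed.

Let bexp (l t : R) : 0 <= l -> 0 <= t -> bounded_measurable (fun w => expR (- (l * X t w))).
Proof.
by move=> l0 t0; apply: bounded_measurable_expRN => //; [exact: mX|move=> w; exact: X_ge0].
Qed.

Let bS K h k : 0 <= h -> bounded_measurable (S K h k).
Proof. by move=> h0; exact: survival_bounded_measurable. Qed.

Let bSX K h k l : 0 <= h -> 0 <= l ->
  bounded_measurable (fun w => S K h k w * (expR (- (l * X (k%:R * h) w)) * X (k%:R * h) w)).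
Proof.
move=> h0 l0; apply: (bounded_measurable_start MP (grid_ge0 k h0) l0 (survival_localized K k h0)).
exact: (bounded_on_process MP K (grid_ge0 k h0)).
Qed.

Let bSE K h k l : 0 <= h -> 0 <= l -> bounded_measurable (fun w => S K h k w *
  (expR (- (l * X (k%:R * h + h) w)) * no_jump_factor X a b h k w)).
Proof.
move=> h0 l0; apply: bounded_measurableM; first exact: bS.
apply: bounded_measurableM; first by apply: bexp => //; rewrite addr_ge0 ?grid_ge0.
split.
  apply: measurable_funB => //; apply: measurableT_comp; first exact: measurable_fun_cutoff.
  by do 2 apply: measurableT_comp => //; apply: measurable_funB; apply: mX; rewrite ?addr_ge0 ?grid_ge0.
by exists 1 => w; have /andP[f1 f2] := no_jump_factor01 X a b h k w; rewrite ger0_norm.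
Qed.

(** At time 0 the integral equation runs over a single point, so [v 0 l = l]. *)
Lemma laplace_start x l : 0 <= x -> 0 <= l -> \int[P x]_w expR (- (l * X 0 w)) = expR (- (l * x)).
Proof.
move=> x0 l0; rewrite (laplace_Rintegral laplaceX)//.
have [_ _ _ ->] := cum l0 => //.
rewrite set_itv1 Rintegral_set1 subr0 mulrC//.
Qed.

Let grid_expansion K l e : 0 <= K -> 0 <= l -> 0 < e -> exists2 h0 : R, 0 < h0 &
  forall x h k, 0 <= x -> 0 <= h <= h0 ->
  `|\int[P x]_w (S K h k w * (expR (- (l * X (k%:R * h + h) w)) * no_jump_factor X a b h k w))
    - (\int[P x]_w (S K h k w * expR (- (l * X (k%:R * h) w)))
       - h * F l * \int[P x]_w (S K h k w * (expR (- (l * X (k%:R * h) w)) * X (k%:R * h) w)))|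
  <= e * h.
Proof.
move=> K0 l0 e0.
have [h0 h00 H] := one_step_expansion triple MP cum laplaceX l0 K0 ba a0 a1 e0.
exists h0 => // x h k x0 h1; have /andP[hh _] := h1.
exact: (H x (k%:R * h) h _ x0 (grid_ge0 k hh) h1 (survival_localized K k hh)).
Qed.

(* With [Z] the survival functional at step [k] and [X] the process there, the
   expansion at exponent 0 bounds the average over the grid of the means of
   [Z * X], while the one at [l] bounds those of [Z * expR (- (l * X))]; they are
   combined through [1 <= expR (- (l * X)) + l * X]. *)
Lemma survival_upper_bound K l (D : nat) (e : R) : 0 <= K -> 0 < l -> (0 < D)%N -> 0 < e ->
  0 < F 0 -> 0 <= F l -> exists2 h0 : R, 0 < h0 & forall x h N, 0 <= x -> 0 <= h <= h0 ->
  N%:R * h = D%:R ->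
  \int[P x]_w survival X a b `]-oo, K] h N w <= expR (- (l * x)) + l / (F 0 * D%:R) + e.
Proof.
move=> K0 l0 D0 e0 F0 Fl.
have D0' : 0 < D%:R :> R by rewrite ltr0n.
(* After division by [D], the accumulated errors are [e' * D] from the means [A] and [e' * l / F 0]
   from the sum of the [B], that is [e' * c]. *)
pose c := D%:R + l / (F 0 * D%:R) * D%:R.
have c0 : 0 < c by rewrite addr_gt0// !mulr_gt0// invr_gt0 mulr_gt0.
have [e' e'0 e'E] : exists2 e', 0 < e' & e' * c = e.
  by exists (e / c); rewrite ?divr_gt0// divfK// lt0r_neq0.
have [h1 h10 H1] := grid_expansion K0 (ltW l0) e'0.
have [h2 h20 H2] := grid_expansion K0 (lexx 0) e'0.
exists (Num.min h1 h2); first by rewrite lt_min h10.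
move=> x h N x0 /andP[h0]; rewrite le_min => /andP[hh1 hh2] Nh.
pose A k := \int[P x]_w (S K h k w * expR (- (l * X (k%:R * h) w))).
pose B k := \int[P x]_w (S K h k w * X (k%:R * h) w).
pose Z k := \int[P x]_w S K h k w.
have bA k : bounded_measurable (fun w => S K h k w * expR (- (l * X (k%:R * h) w))).
  by apply: bounded_measurableM; [exact: bS|apply: bexp; [exact: ltW|exact: grid_ge0]].
have bB k : bounded_measurable (fun w => S K h k w * X (k%:R * h) w).
  have := bSX K k h0 (lexx 0).
  by under [Y in bounded_measurable Y -> _]funext do rewrite mul0r oppr0 expR0 mul1r.
have stepA k : A k.+1 <= A k + e' * h.
  have hx := H1 x h k x0; rewrite h0 hh1 in hx; have {}hx := hx isT.
  have : A k.+1 <= \int[P x]_w (S K h k w * (expR (- (l * X (k%:R * h + h) w)) * no_jump_factor X a b h k w)).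
    apply: expectation_le => //; first by apply: bSE => //; exact: ltW.
    move=> w; rewrite gridS /S/= -/(S K h k w).
    have /andP[s1 s2] := survival01 X a b (capped K) h k w.
    have /andP[f1 f2] := no_jump_factor01 X a b h k w.
    rewrite -!mulrA ler_wpM2l// [leRHS]mulrC ler_wpM2l//.
    rewrite ler_piMl ?expR_ge0// indicE; by case: (_ \in _).
  have B0 : 0 <= \int[P x]_w (S K h k w * (expR (- (l * X (k%:R * h) w)) * X (k%:R * h) w)).
    apply: Rintegral_ge0 => w _; have /andP[s1 s2] := survival01 X a b (capped K) h k w.
    by rewrite !mulr_ge0 ?expR_ge0// X_ge0// grid_ge0.
  have : 0 <= h * F l * \int[P x]_w (S K h k w * (expR (- (l * X (k%:R * h) w)) * X (k%:R * h) w)).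
    by rewrite !mulr_ge0.
  move: hx; rewrite -/(A k) ler_norml; lra.
have stepZ k : h * F 0 * B k <= Z k - Z k.+1 + e' * h.
  have hx := H2 x h k x0; rewrite h0 hh2 in hx; have {}hx := hx isT.
  have : Z k.+1 <= \int[P x]_w (S K h k w * (expR (- (0 * X (k%:R * h + h) w)) * no_jump_factor X a b h k w)).
    apply: expectation_le => //; [exact: bS|exact: bSE|].
    move=> w; rewrite mul0r oppr0 expR0 mul1r /S/= -/(S K h k w).
    have /andP[s1 s2] := survival01 X a b (capped K) h k w.
    have /andP[f1 f2] := no_jump_factor01 X a b h k w.
    rewrite ler_piMr ?mulr_ge0// indicE; by case: (_ \in _).
  move: hx.
  under [Y in `| _ - (Y - _)|]eq_Rintegral do rewrite mul0r oppr0 expR0 mulr1.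
  under [Y in `| _ - (_ - _ * Y)|]eq_Rintegral do rewrite mul0r oppr0 expR0 mul1r.
  by rewrite -/(Z k) -/(B k) ler_norml; lra.
have A0 : A 0%N <= expR (- (l * x)).
  rewrite -(laplace_start x0 (ltW l0)); apply: expectation_le => //.
    by apply: bexp => //; exact: ltW.
  move=> w; rewrite mul0r /S/= ler_piMl ?expR_ge0// indicE; by case: (_ \in _).
have Ak k : A k <= expR (- (l * x)) + e' * (k%:R * h).
  elim: k => [|k IH]; first by rewrite mul0r mulr0 addr0.
  by rewrite gridS mulrDr addrA (le_trans (stepA k))// lerD2r.
(* Telescoping: the decrements of [Z] add up to at most [1 - Z n]. *)
have sumB n : h * F 0 * \sum_(k < n) B k <= 1 - Z n + e' * (n%:R * h).
  elim: n => [|n IH].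
    rewrite big_ord0 mulr0 mul0r mulr0 addr0 subr_ge0.
    rewrite -(expectation_cst (P x) 1); apply: expectation_le => //.
    - exact: bS.
    - exact: bounded_measurable_cst.
    - by move=> w; have /andP[] := survival01 X a b (capped K) h 0 w.
  by rewrite big_ord_recr/= mulrDr gridS; have := stepZ n; lra.
have ZAB k : (k <= N)%N -> Z N <= A k + l * B k.
  move=> kN; rewrite -expectationZ// -expectationD//; last exact: bounded_measurableZ.
  apply: expectation_le; first exact: bS.
    by apply: bounded_measurableD => //; exact: bounded_measurableZ.
  move=> w; apply: (le_trans (survival_le _ _ _ _ _ _ kN)).
  have /andP[s1 s2] := survival01 X a b (capped K) h k w.
  rewrite -/(S K h k w) mulrCA -mulrDr ler_peMr//.
  by have := expR_ge1Dx (- (l * X (k%:R * h) w)); lra.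
(* [ZAB] is averaged over all grid times, so that no particular time with a small mean has to be
   selected. *)
have : D%:R * Z N <= D%:R * (expR (- (l * x)) + e' * D%:R) + l / F 0 * (1 + e' * D%:R).
  have h_gt0 : 0 < h.
    by rewrite lt_neqAle h0 andbT; apply/eqP => h00; move: Nh; rewrite -h00 mulr0 => /eqP; rewrite lt_eqF.
  have sumZ : N%:R * h * Z N <= \sum_(k < N) h * (A k + l * B k).
    rewrite -mulrA mulr_natl -[X in _ *+ X]card_ord -sumr_const.
    by apply: ler_sum => k _; rewrite ler_wpM2l// ZAB// ltnW.
  move: sumZ; rewrite Nh => /le_trans; apply.
  under eq_bigr do rewrite mulrDr.
  rewrite big_split/= lerD//.
    rewrite -Nh -!mulrA mulr_natl -[X in _ *+ X]card_ord -sumr_const.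
    apply: ler_sum => k _; rewrite ler_wpM2l//; apply: (le_trans (Ak k)).
    rewrite lerD2l ler_wpM2l ?(ltW e'0)// ler_wpM2r// ler_nat; exact: ltnW.
  have := sumB N; rewrite Nh => sB.
  have ZN0 : 0 <= Z N.
    by apply: Rintegral_ge0 => w _; have /andP[] := survival01 X a b (capped K) h N w.
  have sB' : h * F 0 * \sum_(k < N) B k <= 1 + e' * D%:R by lra.
  have -> : \sum_(k < N) h * (l * B k) = l / F 0 * (h * F 0 * \sum_(k < N) B k).
    by rewrite -!mulr_sumr; field; rewrite lt0r_neq0.
  by rewrite ler_wpM2l// divr_ge0// ltW.
move=> DZ; rewrite -(ler_pM2l D0'); apply: (le_trans DZ).
have -> : D%:R * (expR (- (l * x)) + l / (F 0 * D%:R) + e) =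
  D%:R * (expR (- (l * x)) + e) + l / F 0.
  by field; rewrite !lt0r_neq0.
rewrite -{}e'E /c.
have -> : l / (F 0 * D%:R) * D%:R = l / F 0 by field; rewrite !lt0r_neq0.
have : 0 <= e' * (l / F 0) * (D%:R - 1).
  apply: mulr_ge0; last by rewrite subr_ge0 ler1n.
  apply: mulr_ge0; first exact: ltW.
  by apply: divr_ge0; exact: ltW.
lra.
Qed.

(* [expR (- (l * y)) - expR (- (l * K))] is negative for [y > K], so that killing
   the paths leaving ]-oo, K] only increases its mean. *)
Lemma survival_lower_bound K l (D : nat) (e : R) : 0 <= K -> 0 <= l -> 0 < e -> F l <= 0 ->
  exists2 h0 : R, 0 < h0 & forall x h N, 0 <= x -> 0 <= h <= h0 -> N%:R * h = D%:R ->
  expR (- (l * x)) - expR (- (l * K)) - e <= \int[P x]_w survival X a b setT h N w.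
Proof.
move=> K0 l0 e0 Fl.
have D1 : 0 < D%:R + 1 :> R by rewrite ltr_wpDl.
(* The errors add up to [e' * D]; the added 1 covers [D = 0]. *)
have [e' e'0 e'E] : exists2 e', 0 < e' & e' * (D%:R + 1) = e.
  by exists (e / (D%:R + 1)); rewrite ?divr_gt0// divfK// lt0r_neq0.
have [h1 h10 H1] := grid_expansion K0 l0 e'0.
exists h1 => // x h N x0 h01 Nh; have /andP[h0 hh1] := h01.
pose A k := \int[P x]_w (S K h k w * expR (- (l * X (k%:R * h) w))).
pose Z k := \int[P x]_w S K h k w.
have bA k : bounded_measurable (fun w => S K h k w * expR (- (l * X (k%:R * h) w))).
  by apply: bounded_measurableM; [exact: bS|apply: bexp => //; exact: grid_ge0].
pose q := expR (- (l * K)).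
have q0 : 0 <= q by exact: expR_ge0.
pose c k := A k - q * Z k.
have cE k : c k = \int[P x]_w (S K h k w * expR (- (l * X (k%:R * h) w)) - q * S K h k w).
  rewrite expectationB//; last by apply: bounded_measurableZ; exact: bS.
  by rewrite expectationZ//; exact: bS.
have stepc k : c k - e' * h <= c k.+1.
  have hx := H1 x h k x0 h01.
  have B0 : 0 <= \int[P x]_w (S K h k w * (expR (- (l * X (k%:R * h) w)) * X (k%:R * h) w)).
    apply: Rintegral_ge0 => w _; have /andP[s1 s2] := survival01 X a b (capped K) h k w.
    by rewrite !mulr_ge0 ?expR_ge0// X_ge0// grid_ge0.
  have : h * F l * \int[P x]_w (S K h k w * (expR (- (l * X (k%:R * h) w)) * X (k%:R * h) w)) <= 0.
    by rewrite mulr_le0_ge0// mulr_ge0_le0.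
  have : \int[P x]_w (S K h k w * (expR (- (l * X (k%:R * h + h) w)) * no_jump_factor X a b h k w))
     - q * Z k <= c k.+1.
    rewrite cE -expectationZ; last exact: bS.
    rewrite -expectationB; [|exact: bSE|by apply: bounded_measurableZ; exact: bS].
    apply: expectation_le.
    - by apply: bounded_measurableB; [exact: bSE|apply: bounded_measurableZ; exact: bS].
    - by apply: bounded_measurableB => //; apply: bounded_measurableZ; exact: bS.
    move=> w; rewrite gridS /S/= -/(S K h k w).
    have /andP[s1 s2] := survival01 X a b (capped K) h k w.
    rewrite -/(S K h k w) in s1 s2.
    have /andP[f1 f2] := no_jump_factor01 X a b h k w.
    set f := no_jump_factor _ _ _ _ _ _ in f1 f2 *; set E := expR _.
    (* Below the cap the right side exceeds the left by [q * S * (1 - f)]; above it the right side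
       is 0, and the left is nonpositive because [E <= q]. *)
    rewrite indicE; case: (boolP (_ \in _)) => [_|]; rewrite ?mulr1 ?mulr0 ?mul0r ?subr0.
      have : 0 <= q * S K h k w * (1 - f) by rewrite !mulr_ge0// subr_ge0.
      lra.
    rewrite notin_setE cappedE => /negP; rewrite -ltNge => KX.
    have Eq : E <= q by rewrite ler_expR lerN2 ler_wpM2l// ltW.
    have E0 : 0 <= E by exact: expR_ge0.
    rewrite subr_le0 mulrC ler_wpM2r//.
    by rewrite -[leRHS]mulr1 ler_pM.
  move: hx; rewrite -/(A k) ler_norml /c; lra.
have c0 : expR (- (l * x)) - q <= c 0%N.
  rewrite cE -(laplace_start x0 l0) -[q](expectation_cst (P x)) -expectationB; last 2 first.
  - exact: bexp.
  - exact: bounded_measurable_cst.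
  rewrite expectation_cst; apply: expectation_le.
  - by apply: bounded_measurableB; [exact: bexp|exact: bounded_measurable_cst].
  - by apply: bounded_measurableB => //; apply: bounded_measurableZ; exact: bS.
  move=> w; rewrite mul0r /S/= indicE; case: (boolP (_ \in _)) => [_|].
    by rewrite mul1r mulr1.
  rewrite notin_setE cappedE => /negP; rewrite -ltNge => KX.
  by rewrite mul0r mulr0 subrr subr_le0 ler_expR lerN2 ler_wpM2l// ltW.
have ck k : expR (- (l * x)) - q - e' * (k%:R * h) <= c k.
  elim: k => [|k IH]; first by rewrite mul0r mulr0 subr0.
  by rewrite gridS; have := stepc k; lra.
have cN : c N <= \int[P x]_w survival X a b setT h N w.
  rewrite cE; apply: expectation_le.
  - by apply: bounded_measurableB => //; apply: bounded_measurableZ; exact: bS.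
  - exact: survival_bounded_measurable.
  move=> w; apply: le_trans (survival_setT_ge X a b (capped K) h N w).
  have /andP[s1 s2] := survival01 X a b (capped K) h N w.
  have /andP[e1 e2] := expRN_unit l0 (X_ge0 w (grid_ge0 N h0)).
  rewrite -/(S K h N w) in s1 s2 *.
  have : 0 <= q * S K h N w by rewrite mulr_ge0.
  have : S K h N w * expR (- (l * X (N%:R * h) w)) <= S K h N w by rewrite ler_piMr.
  lra.
have := ck N; rewrite Nh -/q; move: e'E (ltW e'0); lra.
Qed.

End grid_estimates.

(** * Jumps and grid increments of right-continuous paths with left limits *)

Section rcll_paths.
Context {R : realType}.
Implicit Types (f : R -> R) (u s t e : R).

Lemma rcll_right f u e : rcll f -> 0 <= u -> 0 < e ->
  exists2 eta, 0 < eta & forall t, u <= t -> t < u + eta -> `|f t - f u| <= e.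
Proof.
move=> [rf _] u0 e0.
have /cvgrPdist_le/(_ e e0) := rf u u0.
move=> /nbhs_ballP[eta /= eta0 H]; exists eta => // t.
rewrite le_eqVlt => /predU1P[<- _|ut tu]; first by rewrite subrr normr0 ltW.
rewrite distrC; apply: H => //.
by rewrite /ball/= ltr_norml; apply/andP; split; lra.
Qed.

Lemma rcll_left f u e : rcll f -> 0 < u -> 0 < e ->
  exists2 eta, 0 < eta &
    forall t, t < u -> u - eta < t -> `|f t - lim (f s @[s --> u^'-])| <= e.
Proof.
move=> [_ lf] u0 e0.
have /cvgrPdist_le/(_ e e0) := lf u u0.
move=> /nbhs_ballP[eta /= eta0 H]; exists eta => // t tu ut.
rewrite distrC; apply: H => //.
by rewrite /ball/= ltr_norml; apply/andP; split; lra.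
Qed.

(** Near each [u] the path is controlled by [f u] on the right and by the left limit on the left,
    with nothing to control to the left of 0. Compactness in near-covering form, along bounds
    tending to infinity, makes the bound uniform. *)
Lemma rcll_bounded f (D : R) : rcll f -> exists M, forall t, 0 <= t <= D -> f t <= M.
Proof.
move=> rf.
have /compact_near_coveringP := @segment_compact R 0 D.
move=> /(_ R (pinfty_nbhs R) (fun M t => 0 <= t -> f t <= M)).
case=> [|M0 [_ H]]; last first.
  exists (M0 + 1) => t t0D; apply: (H (M0 + 1)); first by rewrite ltrDl.
  - by rewrite /= in_itv.
  - by case/andP: t0D.
move=> u; rewrite /= in_itv/= => /andP[u0 _].
have [eta1 eta10 H1] := rcll_right rf u0 ltr01.
pose M1 := f u + 1.
have right_le t : u <= t -> t < u + eta1 -> f t <= M1.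
  by move=> ut tu; have := H1 t ut tu; rewrite ler_norml /M1; lra.
have [eta [M2 [eta0 left_le]]] : exists eta M2, 0 < eta /\
    forall t, 0 <= t -> t < u -> u - eta < t -> f t <= M2.
  move: u0; rewrite le_eqVlt => /predU1P[u0|u0].
    by exists 1, 0; split => // t t0; rewrite -u0; lra.
  have [eta eta0 H2] := rcll_left rf u0 ltr01.
  exists eta, (lim (f s @[s --> u^'-]) + 1); split => // t t0 tu ut.
  by have := H2 t tu ut; rewrite ler_norml; lra.
exists (ball u (Num.min eta1 eta), [set M | Num.max M1 M2 < M]) => /=.
  split; first by apply: nbhsx_ballx; rewrite lt_min eta10.
  by exists (Num.max M1 M2); split => //; exact: num_real.
move=> [t M] [/= + +] t0; rewrite /ball/= lt_min gt_max.
move=> /andP[h1 h2] /andP[MM1 MM2].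
move: h1 h2; rewrite !ltr_norml => /andP[h1 h2] /andP[h3 h4].
have [tu|ut'] := ltP t u.
  by apply: (le_trans (left_le t t0 tu _)); lra.
by apply: (le_trans (right_le t ut' _)); lra.
Qed.

(** Compactness again, along radii tending to 0. Around each [u] half of [eta] is given to [s] and
    half to the distance from [s] to [t]. *)
Lemma lebesgue_number (D : R) (Q : R -> R -> Prop) :
  (forall u, 0 <= u <= D -> exists2 eta, 0 < eta &
     forall s t, `|s - u| < eta -> `|t - u| < eta -> Q s t) ->
  exists2 delta, 0 < delta & forall s t, 0 <= s <= D -> `|t - s| < delta -> Q s t.
Proof.
move=> H.
have /compact_near_coveringP := @segment_compact R 0 D.
move=> /(_ R (0^'+) (fun del s => 0 < del -> forall t, `|t - s| < del -> Q s t)).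
case=> [|del /= del0 Hd]; last first.
  exists (del / 2); first by rewrite divr_gt0.
  move=> s t sD; apply: (Hd (del / 2)) => //.
  - by rewrite /ball/= sub0r normrN gtr0_norm ?divr_gt0// ltr_pdivrMr// ltr_pMr// ltr1n.
  - by rewrite divr_gt0.
  - by rewrite divr_gt0.
move=> u; rewrite /= in_itv/= => uD; have [eta eta0 He] := H u uD.
exists (ball u (eta / 2), [set d | 0 < d -> d < eta / 2]) => /=.
  split; first by apply: nbhsx_ballx; rewrite divr_gt0.
  exists (eta / 2); first by rewrite /= divr_gt0.
  by move=> d; rewrite /ball/= sub0r normrN => /(le_lt_trans (ler_norm _)).
move=> [s d] [/= us dd] d0 t ts; have {}dd := dd d0.
move: us; rewrite /ball/= distrC => us.
apply: He; first by apply: (lt_trans us); rewrite ltr_pdivrMr// ltr_pMr// ltr1n.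
have -> : t - u = (t - s) + (s - u) by ring.
apply: (le_lt_trans (ler_normD _ _)); lra.
Qed.

(** Near [u] every value is within [e] of [f u] or of the left limit, according to the side. Two
    points on the same side differ by at most [2 e <= r1]; if [u] separates them the increment is at
    most the jump plus [2 e], hence at most [r1]. The Lebesgue number makes this uniform in [u]. *)
Lemma rcll_small_increments f (D r r1 : R) : rcll f -> r < r1 -> 0 < r1 ->
  (forall u, 0 < u -> f u - lim (f s @[s --> u^'-]) <= r) ->
  exists2 delta, 0 < delta & forall s t, 0 <= s <= D -> s <= t -> t - s < delta ->
    f t - f s <= r1.
Proof.
move=> rf rr1 r10 jf.
have [delta delta0 H] : exists2 delta, 0 < delta & forall s t, 0 <= s <= D ->
    `|t - s| < delta -> 0 <= s -> s <= t -> f t - f s <= r1.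
  apply: lebesgue_number => u /andP[u0 _].
  have [e e0 [e1 e2]] : exists2 e, 0 < e & 2 * e <= r1 - r /\ 2 * e <= r1.
    exists (Num.min ((r1 - r) / 2) (r1 / 2)).
      by rewrite lt_min !divr_gt0// subr_gt0.
    have : Num.min ((r1 - r) / 2) (r1 / 2) <= (r1 - r) / 2 by rewrite ge_min lexx.
    have : Num.min ((r1 - r) / 2) (r1 / 2) <= r1 / 2 by rewrite ge_min lexx orbT.
    by split; lra.
  have [eta1 eta10 H1] := rcll_right rf u0 e0.
  move: u0; rewrite le_eqVlt => /predU1P[u0|u0].
    exists eta1 => // s t; rewrite -u0 !subr0 !ltr_norml => /andP[_ s1] /andP[_ t1] s0 st.
    have := H1 s; have := H1 t; rewrite -u0 add0r => /(_ (le_trans s0 st) t1) + /(_ s0 s1).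
    by rewrite !ler_norml; lra.
  have [eta2 eta20 H2] := rcll_left rf u0 e0.
  have ju := jf u u0; set L := lim _ in H2 ju.
  exists (Num.min eta1 eta2); first by rewrite lt_min eta10.
  move=> s t; rewrite !lt_min !ltr_norml => /andP[/andP[s1 s2] /andP[s3 s4]].
  move=> /andP[/andP[t1 t2] /andP[t3 t4]] s0 st.
  have near_u v : v < u + eta1 -> u - eta2 < v ->
      if v < u then `|f v - L| <= e else `|f v - f u| <= e.
    by move=> v1 v2; case: ltP => vu; [exact: H2|exact: H1].
  have := near_u s ltac:(lra) ltac:(lra); have := near_u t ltac:(lra) ltac:(lra).
  by case: ltP => tu; case: ltP => su; rewrite !ler_norml; lra.
exists delta => // s t sD st ts; apply: H => //; last by case/andP: sD.
by rewrite ger0_norm// subr_ge0.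
Qed.

(** The excess of the jump over [r2] is shared equally between the approach to the left limit and
    that to [f u]. *)
Lemma rcll_large_increments f (u r2 : R) : rcll f -> 0 < u ->
  r2 < f u - lim (f s @[s --> u^'-]) ->
  exists2 delta, 0 < delta & forall s t, s < u -> u <= t -> t - s < delta ->
    r2 <= f t - f s.
Proof.
move=> rf u0 ju.
pose e := (f u - lim (f s @[s --> u^'-]) - r2) / 2.
have e0 : 0 < e by rewrite divr_gt0// subr_gt0.
have [eta1 eta10 H1] := rcll_right rf (ltW u0) e0.
have [eta2 eta20 H2] := rcll_left rf u0 e0.
exists (Num.min eta1 eta2); first by rewrite lt_min eta10.
move=> s t su ut; rewrite lt_min => /andP[h1 h2].
have := H1 t ut; have := H2 s su; rewrite !ler_norml => /(_ ltac:(lra)) + /(_ ltac:(lra)).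
by rewrite /e; lra.
Qed.

End rcll_paths.

Section survival_paths.
Context {d : measure_display} {T : measurableType d} {R : realType}.
Context (X : R -> T -> R) (w : T) (Xrcll : rcll (X ^~ w)).
Implicit Types (r h u : R) (k N n D : nat) (C : set R).

Let h_ n : R := n.+1%:R^-1.

Let h_lt (e : R) : 0 < e -> exists n0, forall n, (n0 <= n)%N -> h_ n < e.
Proof.
move=> e0; exists (Num.truncn e^-1) => n en.
rewrite /h_ -[ltRHS]invrK ltf_pV2 ?posrE ?invr_gt0//.
by apply: (lt_le_trans (truncnS_gt _)); rewrite ler_nat ltnS.
Qed.

Let grid_lt D n k : (k < D * n.+1)%N -> k.+1%:R * h_ n <= D%:R.
Proof.
move=> kN; rewrite ler_pdivrMr// -natrM ler_nat//.
Qed.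

Lemma sup_jump_le r u : (sup_jump X w <= r%:E)%E -> 0 < u -> jump X u w <= r.
Proof.
move=> sr u0; rewrite -lee_fin; apply: le_trans sr.
by apply: ereal_sup_ubound; exists u => //=; rewrite in_itv/= u0.
Qed.

(** Once the mesh is below the modulus of small increments, each grid increment is at most [r1],
    where the cutoff vanishes. The bound [M] precedes [C] so that one rank [n0] serves all caps
    above [M]. *)
Lemma survival_eventually1 r (r1 r2 : R) D : (sup_jump X w <= r%:E)%E ->
  r < r1 -> 0 < r1 -> r1 < r2 ->
  exists M n0, forall C n, (n0 <= n)%N -> (forall y, y <= M -> C y) ->
    survival X (expR (- r1)) (expR (- r2)) C (h_ n) (D * n.+1) w = 1.
Proof.
move=> sr rr1 r10 r12.
have [M HM] := rcll_bounded D%:R Xrcll.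
have [delta delta0 Hd] := rcll_small_increments D%:R Xrcll rr1 r10 (fun u => sup_jump_le sr).
have [n0 Hn0] := h_lt delta0.
exists M, n0 => C n nn0 CM.
have hn0 : 0 < h_ n by rewrite invr_gt0.
suff H k : (k <= D * n.+1)%N -> survival X (expR (- r1)) (expR (- r2)) C (h_ n) k w = 1 by exact: H.
elim: k => [_|k IH kN] /=.
  by rewrite indicE mem_set//; apply/CM/HM; rewrite lexx ler0n.
rewrite IH ?(ltnW kN)// mul1r.
have kh0 : 0 <= k%:R * h_ n by rewrite mulr_ge0// ltW.
have khD : k%:R * h_ n + h_ n <= D%:R by rewrite -gridS grid_lt.
rewrite /no_jump_factor cutoff_eq0; first last.
- rewrite /ratio ler_expR lerN2; apply: Hd.
  + by rewrite kh0/=; lra.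
  + by rewrite lerDl ltW.
  + by rewrite addrAC subrr add0r Hn0.
- by rewrite ltr_expR ltrN2.
rewrite subr0 mul1r indicE mem_set//; apply/CM/HM.
by rewrite khD addr_ge0// ltW.
Qed.

(** The first grid point at or after [u] ends a step that straddles [u]; its increment is at least
    [r >= r2], where the cutoff is 1, and one vanishing factor kills the product. The rank depends
    on the path only, so thresholds and horizon may vary with it. *)
Lemma survival_eventually0 r u : 0 < u -> r < jump X u w ->
  exists n0, forall (r1 r2 : R) D C n, r1 < r2 -> r2 <= r -> u <= D%:R -> (n0 <= n)%N ->
    survival X (expR (- r1)) (expR (- r2)) C (h_ n) (D * n.+1) w = 0.
Proof.
move=> u0 ju.
have [delta delta0 Hd] := rcll_large_increments Xrcll u0 ju.
have [n0 Hn0] := h_lt delta0.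
exists n0 => r1 r2 D C n r12 r2r uD nn0.
have hn0 : 0 < h_ n by rewrite invr_gt0.
have exk : exists k, u <= k%:R * h_ n.
  by exists (D * n.+1)%N; rewrite natrM mulfK.
have [k uk kmin] := ex_minnP exk.
case: k uk kmin => [|k] uk kmin.
  by move: uk; rewrite mul0r leNgt u0.
have kN : (k < D * n.+1)%N by apply: kmin; rewrite natrM mulfK.
have ku : k%:R * h_ n < u by rewrite ltNge; apply/negP => /kmin; rewrite ltnn.
have /andP[s0 _] := survival01 X (expR (- r1)) (expR (- r2)) C (h_ n) (D * n.+1) w.
apply/le_anti; rewrite s0 andbT.
apply: (le_trans (survival_le _ _ _ _ _ _ kN)) => /=.
rewrite /no_jump_factor cutoff_eq1 ?subrr ?mulr0 ?mul0r//.
  by rewrite ltr_expR ltrN2.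
rewrite /ratio ler_expR lerN2; apply: (le_trans r2r); apply: Hd => //.
  by rewrite -gridS.
by rewrite addrAC subrr add0r Hn0.
Qed.

End survival_paths.

(** * Bounds on the law of the largest jump *)

Lemma measure_bigcup_le {d : measure_display} {T : measurableType d} {R : realType}
    (mu : {measure set T -> \bar R}) (G : (set T)^nat) (c : \bar R) :
  (forall m, measurable (G m)) -> nondecreasing_seq G -> (forall m, (mu (G m) <= c)%E) ->
  (mu (\bigcup_m G m) <= c)%E.
Proof.
move=> mG ndG Gc.
have cG := nondecreasing_cvg_mu (mu := mu) mG (bigcup_measurable (fun m _ => mG m)) ndG.
rewrite -(cvg_lim _ cG)//; apply: lime_le; first by apply/cvg_ex; eexists; exact: cG.
by apply: nearW => m; exact: Gc.
Qed.

Section jump_probability.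
Context {d : measure_display} {T : measurableType d} {R : realType}.
Context (alpha beta : R) (pi : levy_measure R) (triple : branching_triple alpha beta pi).
Context (P : R -> probability T R) (X : R -> T -> R).
Let Phi := branching_mechanism alpha beta pi.
Context (CB : CB_process Phi P X).
Context (r : R) (r0 : 0 < r).
Implicit Types (x l : R) (j m n D : nat).

Let A : set T := [set w | (sup_jump X w <= r%:E)%E].

Let MP : markov_process P X. Proof. exact: cb_markov CB. Qed.

Let mX (t : R) : 0 <= t -> measurable_fun setT (X t).
Proof. exact: mp_measurable MP t. Qed.

Let piI : (\int[pi]_(t in `]0%R, +oo[) (Num.min t (t ^+ 2))%:E < +oo)%E := bt_integrable triple.

(** Thresholds decreasing to [r] but strictly above it, because a jump of size exactly [r] must not
    be detected. With [a_ j] and [b_ j] below, increments up to [rj j.+1] are ignored and those from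
    [rj j] on are fatal. *)
Let rj j : R := r + j.+1%:R^-1.

Let rj_gt j : r < rj j. Proof. by rewrite ltrDl invr_gt0. Qed.

Let rj_gt0 j : 0 < rj j. Proof. exact: lt_trans (rj_gt j). Qed.

Let rjS j : rj j.+1 < rj j.
Proof. by rewrite ltrD2l ltf_pV2 ?posrE// ltr_nat. Qed.

Let a_ j := expR (- rj j.+1).
Let b_ j := expR (- rj j).

Let ba j : b_ j < a_ j. Proof. by rewrite ltr_expR ltrN2. Qed.
Let a_gt0 j : 0 < a_ j. Proof. exact: expR_gt0. Qed.
Let a_lt1 j : a_ j < 1. Proof. by rewrite -expR0 ltr_expR oppr_lt0. Qed.

Let h_ n : R := n.+1%:R^-1.
Let h_ge0 n : 0 <= h_ n. Proof. by rewrite invr_ge0. Qed.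
Let gridh D n : (D * n.+1)%:R * h_ n = D%:R.
Proof. by rewrite natrM mulfK. Qed.

Let S j D n C w := survival X (a_ j) (b_ j) C (h_ n) (D * n.+1) w.

Let bS j D n C : measurable C -> bounded_measurable (S j D n C).
Proof. by move=> mC; exact: survival_bounded_measurable. Qed.

Let h_small (e : R) m : 0 < e -> exists2 n, (m <= n)%N & 0 <= h_ n <= e.
Proof.
move=> e0; exists (maxn m (Num.truncn e^-1)); first exact: leq_maxl.
rewrite h_ge0/= /h_ -[leRHS]invrK lef_pV2 ?posrE ?invr_gt0//.
by apply: (le_trans (ltW (truncnS_gt _))); rewrite ler_nat ltnS leq_maxr.
Qed.

(** The index [m'] serves both as horizon and as threshold index, and the mesh index dominates it.
    The sets increase with [m] and involve countably many grid functionals. *)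
Let G m := [set w | forall m' n, (m <= m')%N -> (m' <= n)%N -> S m' m' n setT w = 0].

Let mG m : measurable (G m).
Proof.
rewrite (_ : G m = \bigcap_(m' in [set k | (m <= k)%N]) \bigcap_(n in [set k | (m' <= k)%N])
  (S m' m' n setT @^-1` [set 0])).
  apply: bigcap_measurable => [|m' _]; first by exists m => /=.
  apply: bigcap_measurable => [|n _]; first by exists m' => /=.
  have [mS _] := bS m' m' n measurableT.
  by have := mS measurableT [set 0] (measurable_set1 0); rewrite setTI.
by apply/seteqP; split => w H m' mm' n; exact: H.
Qed.

(** A jump above [r] is detected once the horizon passes its time, the threshold falls below its
    size and the mesh is fine enough. Without such a jump, the survival functional with fixed
    threshold and horizon is eventually 1, which excludes every [G m]. *)
Let notA_bigcup : ~` A = \bigcup_m G m.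
Proof.
apply/seteqP; split => w; rewrite /A/=.
  move/negP; rewrite -ltNge => /ereal_sup_gt[_ [u /= + <-]].
  rewrite in_itv/= andbT lte_fin => u0 ju.
  pose e := jump X u w - r.
  have e0 : 0 < e by rewrite subr_gt0.
  (* A level strictly between [r] and the jump, leaving room for the thresholds [rj] below it. *)
  pose r' := r + e / 2.
  have r'j : r' < jump X u w by rewrite /r' /e; lra.
  have [n0 H] := survival_eventually0 (cb_rcll CB w) u0 r'j.
  have [j _ /andP[_ je]] := h_small 0 (divr_gt0 e0 (ltr0Sn _ 1)).
  exists (maxn n0 (maxn j (Num.truncn u).+1)) => // m' n; rewrite !geq_max.
  move=> /andP[n0m /andP[jm um]] mn; apply: H => //.
  - rewrite lerD2l; apply: le_trans je.
    by rewrite /h_ lef_pV2 ?posrE// ler_nat ltnS.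
  - by apply: (le_trans (ltW (truncnS_gt _))); rewrite ler_nat.
  - exact: leq_trans mn.
move=> [m _ Gm] /= sr.
have [M [n0 H]] := survival_eventually1 (cb_rcll CB w) m sr (rj_gt m.+1) (rj_gt0 m.+1) (rjS m).
have := H setT (maxn m n0) (leq_maxr _ _) (fun _ _ => Logic.I).
have := Gm m (maxn m n0) (leqnn _) (leq_maxl _ _); rewrite /S => -> /eqP.
by rewrite eq_sym oner_eq0.
Qed.

(** The supremum runs over uncountably many times, so measurability is not immediate; it comes from
    the description of the complement by grids. *)
Lemma measurable_sup_jump_le : measurable [set w | (sup_jump X w <= r%:E)%E].
Proof.
rewrite -/A -[A]setCK notA_bigcup; apply: measurableC.
by apply: bigcup_measurable => m _; exact: mG.
Qed.

Let I l := \int[pi]_(t in `]r, +oo[) expR (- (l * t)).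

Let mI (i : interval R) : @measurable _ (measurableTypeR R) [set` i].
Proof. exact: measurable_itv. Qed.

Let cut_integrable l j : 0 <= l -> pi.-integrable `]0, +oo[
  (EFin \o (fun t : R => expR (- (l * t)) * cutoff (a_ j) (b_ j) (expR (- t)))).
Proof. by move=> l0; exact: (cutoff_integrable triple). Qed.

Let tail_exp_integrable l : 0 <= l -> pi.-integrable `]r, +oo[ (EFin \o (fun t : R => expR (- (l * t)))).
Proof.
move=> l0; apply: (tail_bounded_integrable piI r0); first exact: measurable_fun_expRN_mul.
move=> t rt; rewrite ger0_norm ?expR_ge0// -expR0 ler_expR oppr_le0 mulr_ge0//.
by rewrite ltW// (lt_trans r0).
Qed.

Let cut_tail l j : 0 <= l ->
  \int[pi]_(t in `]0, +oo[) (expR (- (l * t)) * cutoff (a_ j) (b_ j) (expR (- t))) =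
  \int[pi]_(t in `]r, +oo[) (expR (- (l * t)) * cutoff (a_ j) (b_ j) (expR (- t))).
Proof.
move=> l0.
have posE : `]0, +oo[%classic = `]0, r]%classic `|` `]r, +oo[%classic.
  by rewrite (@itv_bndbnd_setU _ _ _ (BRight r))//= ?bnd_simp ltW.
rewrite posE Rintegral_setU//; first last.
- apply/disj_setPS => t [] /=; rewrite !in_itv/= andbT => /andP[_ tr] rt.
  by have := lt_le_trans rt tr; rewrite ltxx.
- by rewrite -posE; exact: cut_integrable.
rewrite [X in X + _](_ : _ = 0) ?add0r//.
transitivity (\int[pi]_(t in `]0, r]) (0 : R)); last by rewrite (Rintegral_cst pi (mI _)) mul0r.
apply: eq_Rintegral => t; rewrite inE/= in_itv/= => /andP[t0 tr].
by rewrite cutoff_eq0 ?mulr0// ler_expR lerN2 (le_trans tr)// ltW.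
Qed.

Let cut_tail_integrable l j : 0 <= l -> pi.-integrable `]r, +oo[
  (EFin \o (fun t : R => expR (- (l * t)) * cutoff (a_ j) (b_ j) (expR (- t)))).
Proof.
move=> l0; apply: integrableS (cut_integrable j l0) => //.
by apply: tail_sub.
Qed.

Let cut_mechanism_le l j : 0 <= l ->
  cut_mechanism alpha beta pi (a_ j) (b_ j) l <=
  fine (pi `]r, +oo[%classic) - truncated_mechanism alpha beta pi r l.
Proof.
move=> l0; rewrite truncated_mechanismE// lerD2r cut_tail//.
apply: le_Rintegral => //; [exact: cut_tail_integrable|exact: tail_exp_integrable|].
by move=> t _; rewrite ler_piMr ?expR_ge0// cutoff_le1.
Qed.

(** On []r, oo[] the cutoff is less than 1 only up to [rj j], and there [expR (- (l * t)) <= 1]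
    bounds the loss by the mass of []r, rj j]]. *)
Let cut_mechanism_ge l j : 0 <= l ->
  fine (pi `]r, +oo[%classic) - truncated_mechanism alpha beta pi r l
    - fine (pi `]r, rj j]%classic) <= cut_mechanism alpha beta pi (a_ j) (b_ j) l.
Proof.
move=> l0; rewrite truncated_mechanismE// addrAC lerD2r cut_tail//.
rewrite lerBlDr -lerBlDl -RintegralB//; [|exact: tail_exp_integrable|exact: cut_tail_integrable].
have -> : fine (pi `]r, rj j]%classic) = \int[pi]_(t in `]r, +oo[) \1_(`]r, rj j]) t.
  rewrite /Rintegral integral_indic//; congr (fine (pi _)).
  apply/seteqP; split => t /=; rewrite !in_itv/= ?andbT; last by case.
  by move=> /[dup] rt /andP[].
have iind : pi.-integrable `]r, +oo[ (EFin \o (\1_(`]r, rj j]) : R -> R)).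
  apply: (tail_bounded_integrable piI r0) => //.
  by move=> t _; rewrite indicE; case: (_ \in _); rewrite ?normr1 ?normr0.
apply: le_Rintegral => //.
  exact: (integrableB (mI _) (tail_exp_integrable l0) (cut_tail_integrable j l0)).
move=> t; rewrite /= in_itv/= andbT => rt.
have /andP[e1 e2] := expRN_unit l0 (ltW (lt_trans r0 rt)).
rewrite indicE; have [tr|tr] := leP t (rj j).
  rewrite mem_set/= ?in_itv/= ?rt//.
  by have := mulr_ge0 e1 (cutoff_ge0 (a_ j) (b_ j) (expR (- t))); lra.
rewrite cutoff_eq1 ?mulr1 ?subrr//.
by rewrite ler_expR lerN2 ltW.
Qed.

(** The intervals exclude [r], hence decrease to the empty set even if [pi] has an atom there; their
    measure is finite because [r > 0]. *)
Let rj_tail_small (e : R) : 0 < e -> exists j, fine (pi `]r, rj j]%classic) <= e.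
Proof.
move=> e0.
pose F j : set (measurableTypeR R) := `]r, rj j]%classic.
have mF j : measurable (F j) by exact: mI.
have Fsub j : F j `<=` `]r, +oo[%classic.
  by move=> t; rewrite /F/= !in_itv/= andbT => /andP[].
have Ffin j : (pi (F j) < +oo)%E.
  apply: le_lt_trans (tail_lty piI r0).
  by apply: le_measure => //; rewrite inE; [exact: mF|exact: mI].
have F0 : \bigcap_j F j = set0.
  suff HF (t : R) : ~ (forall j, F j t).
    by apply/seteqP; split => // t Ft; apply: (HF t) => j; exact: Ft.
  move=> Ft.
  have rt : r < t by have := Ft 0%N; rewrite /F/= in_itv/= => /andP[].
  have tr0 : 0 < (t - r) / 2 by rewrite divr_gt0// subr_gt0.
  have [j _ /andP[_ je]] := h_small 0 tr0.
  have /andP[_ tj] : r < t <= rj j by have := Ft j; rewrite /F/= in_itv/=.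
  have rjE : rj j = r + h_ j by [].
  by move: tj je; rewrite rjE; lra.
have cF : pi \o F @ \oo --> pi (\bigcap_j F j).
  apply: nonincreasing_cvg_mu; [exact: Ffin|exact: mF|by rewrite F0|].
  apply/nonincreasing_seqP => j; apply/subsetPset => t; rewrite /F/= !in_itv/= => /andP[-> tr].
  exact: (le_trans tr (ltW (rjS j))).
rewrite F0 measure0 in cF.
have /fine_cvgP[_ /cvgrPdist_le/(_ e e0)[j _ Hj]] := cF.
exists j; have := Hj j (leqnn j); rewrite /= sub0r normrN.
by apply: le_trans; exact: ler_norm.
Qed.

(** Bounded through the complement: the survival functional vanishes on [G m], so the probability of
    [G m] and the mean survival add up to at most 1. One half of [e] pays for the cap, the other for
    the grid error. *)
Lemma sup_jump_probability_ge x l : 0 <= x -> 0 < l ->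
  fine (pi `]r, +oo[%classic) - truncated_mechanism alpha beta pi r l <= 0 ->
  ((expR (- (l * x)))%:E <= P x [set w | (sup_jump X w <= r%:E)%E])%E.
Proof.
move=> x0 l0 Fl.
have [v cum laplaceX] := cb_laplace CB.
have mA : measurable A by exact: measurable_sup_jump_le.
suff H : (P x (~` A) <= (1 - expR (- (l * x)))%:E)%E.
  have := probability_setC (P x) mA.
  move: H; rewrite -/A => /[swap] ->.
  have -> : P x A = (fine (P x A))%:E by rewrite fineK// fin_num_measure.
  by rewrite -EFinB !lee_fin; lra.
rewrite notA_bigcup; apply: measure_bigcup_le => //.
  apply/nondecreasing_seqP => m; apply/subsetPset => w Gm m' n mm' m'n.
  by apply: Gm => //; exact: ltnW.
move=> m.
rewrite -[leLHS]fineK ?fin_num_measure//.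
rewrite lee_fin; apply/ler_addgt0Pr => e e0.
have [K K0 KE] : exists2 K, 0 <= K & expR (- (l * K)) <= e / 2.
  exists (Num.max 0 (- ln (e / 2) / l)); first by rewrite le_max lexx.
  rewrite -[leRHS]lnK ?posrE ?divr_gt0// ler_expR lerNl.
  by rewrite [leRHS]mulrC -ler_pdivrMr// le_max lexx orbT.
have Fm : cut_mechanism alpha beta pi (a_ m) (b_ m) l <= 0.
  by apply: le_trans Fl; apply: cut_mechanism_le; exact: ltW.
have [h0 h00 H] := survival_lower_bound triple MP cum laplaceX (ba m) (a_gt0 m) (a_lt1 m)
  m K0 (ltW l0) (divr_gt0 e0 (ltr0Sn _ 1)) Fm.
have [n mn hn] := h_small m h00.
have {}H := H x (h_ n) (m * n.+1)%N x0 hn (gridh m n).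
have : fine (P x (G m)) + \int[P x]_w S m m n setT w <= 1.
  rewrite -expectation_indic// -expectationD; last 2 first.
  - exact: bounded_measurable_indic.
  - exact: bS.
  rewrite -[leRHS](expectation_cst (P x)); apply: expectation_le.
  - by apply: bounded_measurableD; [exact: bounded_measurable_indic|exact: bS].
  - exact: bounded_measurable_cst.
  move=> w; have /andP[s1 s2] := survival01 X (a_ m) (b_ m) setT (h_ n) (m * n.+1) w.
  rewrite indicE; case: (boolP (w \in G m)) => [|_]; last by rewrite add0r.
  by rewrite inE => Gw; rewrite Gw// addr0.
by move: H; rewrite -/(S m m n setT); lra.
Qed.

(** The event is the increasing union of the sets [H m], on which the capped survival functional is
    1 for all caps and mesh indices from [m] on. The mean bound then applies at a fixed horizon [D],
    and its extra term [l / (f0 * D)] vanishes as [D] grows. *)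
Lemma sup_jump_probability_le x l : 0 <= x -> 0 < l -> 0 < fine (pi `]r, +oo[%classic) ->
  0 < fine (pi `]r, +oo[%classic) - truncated_mechanism alpha beta pi r l ->
  (P x [set w | (sup_jump X w <= r%:E)%E] <= (expR (- (l * x)))%:E)%E.
Proof.
move=> x0 l0 F0 Fl.
have [v cum laplaceX] := cb_laplace CB.
have mA : measurable A by exact: measurable_sup_jump_le.
have [j jP] : exists j, 0 < cut_mechanism alpha beta pi (a_ j) (b_ j) 0 /\
    0 <= cut_mechanism alpha beta pi (a_ j) (b_ j) l.
  (* A loss of at most [e] leaves the cut functional positive at 0, where half of the tail mass
     remains, and nonnegative at [l]. *)
  pose e := Num.min (fine (pi `]r, +oo[%classic) / 2)
    (fine (pi `]r, +oo[%classic) - truncated_mechanism alpha beta pi r l).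
  have e0 : 0 < e by rewrite lt_min divr_gt0.
  have [j je] := rj_tail_small e0; exists j.
  have e1 : e <= fine (pi `]r, +oo[%classic) / 2 by rewrite ge_min lexx.
  have e2 : e <= fine (pi `]r, +oo[%classic) - truncated_mechanism alpha beta pi r l.
    by rewrite ge_min lexx orbT.
  have := cut_mechanism_ge j (lexx 0); rewrite truncated_mechanism0.
  have := cut_mechanism_ge j (ltW l0).
  by split; lra.
have [c0 cl] := jP.
set f0 := cut_mechanism _ _ _ _ _ 0 in c0.
suff H D : (0 < D)%N -> (P x A <= (expR (- (l * x)) + l / (f0 * D%:R))%:E)%E.
  have PE : P x A = (fine (P x A))%:E by rewrite fineK// fin_num_measure.
  rewrite -/A PE lee_fin; apply/ler_addgt0Pr => e e0.
  pose D := (Num.truncn (l / (f0 * e))).+1.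
  have := H D isT; rewrite PE lee_fin => /le_trans; apply; rewrite lerD2l.
  have D0 : 0 < D%:R :> R by rewrite ltr0n.
  rewrite ler_pdivrMr ?mulr_gt0//.
  have : l / (f0 * e) < D%:R by exact: truncnS_gt.
  rewrite ltr_pdivrMr ?mulr_gt0// => /ltW lD.
  by apply: (le_trans lD); rewrite (_ : D%:R * (f0 * e) = e * (f0 * D%:R))//; ring.
move=> D0.
pose H m := A `&` [set w | forall m' n, (m <= m')%N -> (m <= n)%N -> S j D n `]-oo, m'%:R] w = 1].
have mH m : measurable (H m).
  apply: measurableI => //.
  rewrite (_ : [set w | _] = \bigcap_(m' in [set k | (m <= k)%N]) \bigcap_(n in [set k | (m <= k)%N])
    (S j D n `]-oo, m'%:R] @^-1` [set 1])).
    apply: bigcap_measurable => [|m' _]; first by exists m => /=.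
    apply: bigcap_measurable => [|n _]; first by exists m => /=.
    have mC : measurable (`]-oo, m'%:R]%classic : set R) by exact: measurable_itv.
    have [mS _] := bS j D n mC.
    by have := mS measurableT [set 1] (measurable_set1 1); rewrite setTI.
  by apply/seteqP; split => w Hw m' mm' n; exact: Hw.
have AE : A = \bigcup_m H m.
  apply/seteqP; split => w; last by move=> [m _ []].
  move=> Aw.
  have [M [n0 Hw]] := survival_eventually1 (cb_rcll CB w) D Aw (rj_gt j.+1) (rj_gt0 j.+1) (rjS j).
  exists (maxn n0 (Num.truncn M).+1) => //; split => // m' n; rewrite !geq_max.
  move=> /andP[_ Mm] /andP[n0n _]; apply: Hw => // y yM /=; rewrite in_itv/=.
  apply: (le_trans yM); apply: (le_trans (ltW (truncnS_gt _))).
  by rewrite ler_nat.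
rewrite AE; apply: measure_bigcup_le => //.
  apply/nondecreasing_seqP => m; apply/subsetPset => w [Aw Hw]; split => // m' n mm' mn.
  by apply: Hw; exact: ltnW.
move=> m.
rewrite -[leLHS]fineK ?fin_num_measure//.
rewrite lee_fin; apply/ler_addgt0Pr => e e0.
have [h0 h00 HS] := survival_upper_bound triple MP cum laplaceX (ba j) (a_gt0 j) (a_lt1 j)
  (ler0n R m) l0 D0 e0 c0 cl.
have [n mn hn] := h_small m h00.
apply: le_trans (HS x (h_ n) (D * n.+1)%N x0 hn (gridh D n)).
rewrite -expectation_indic//; apply: expectation_le.
- exact: bounded_measurable_indic.
- exact: (bS j D n (measurable_itv _)).
move=> w; have /andP[s1 s2] := survival01 X (a_ j) (b_ j) `]-oo, m%:R] (h_ n) (D * n.+1) w.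
rewrite indicE; case: (boolP (w \in H m)) => [|_]; last exact: s1.
by rewrite inE => -[_ Hw]; have := Hw m n (leqnn _) mn; rewrite /S => ->.
Qed.

End jump_probability.

(** * Branching mechanisms and their inverses *)

Section inverse.
Context {R : realType}.
Implicit Types (Psi : R -> R) (c l M L : R).

(* [Psi] need not be injective on [[largest_zero Psi, +oo[]: any preimage there
   makes the pseudo-inverse a genuine right inverse at [c]. *)
Lemma branching_inverse_mem Psi c l : largest_zero Psi <= l -> Psi l = c ->
  largest_zero Psi <= branching_inverse Psi c /\ Psi (branching_inverse Psi c) = c.
Proof.
move=> ql Pl.
have surj : set_surj (`[largest_zero Psi, +oo[ : set R) [set c] Psi.
  by move=> _ ->; exists l => //; rewrite /= in_itv/= ql.
split; last by apply: (surjpK (fun=> 0) surj); rewrite inE.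
have : (`[largest_zero Psi, +oo[ : set R) (branching_inverse Psi c).
  by apply: (surjpinv_image_sub surj); exists c.
by rewrite /= in_itv/= andbT.
Qed.

(** A zero [z] beyond [l] would force [Psi l <= (l / z) * Psi z = 0 < c]. *)
Lemma largest_zero_bounds Psi c l : Psi 0 = 0 -> 0 < c -> 0 <= l -> Psi l = c ->
  (forall m t, 0 <= m -> 0 <= t <= 1 -> Psi (t * m) <= t * Psi m) ->
  0 <= largest_zero Psi <= l.
Proof.
move=> P0 c0 l0 Pl star.
have ub : ubound [set m | 0 <= m /\ Psi m = 0] l.
  move=> z [z0 Pz]; rewrite leNgt; apply/negP => lz.
  have z_gt0 : 0 < z by exact: le_lt_trans lz.
  have lz1 : 0 <= l / z <= 1 by rewrite divr_ge0//= ler_pdivrMr// mul1r ltW.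
  by have := star z (l / z) z0 lz1; rewrite divfK ?lt0r_neq0// Pz mulr0 Pl leNgt c0.
apply/andP; split.
  by apply: ub_le_sup => //; exists l.
by apply: ge_sup => //; exists 0.
Qed.

(** Regularity is known on [[0, M]] only; composing with the projection onto that interval gives a
    function continuous on the whole line, to which the intermediate value theorem applies. *)
Lemma lipschitz_IVT Psi c M L : 0 <= M -> 0 < L -> Psi 0 <= c <= Psi M ->
  (forall l m, 0 <= l <= M -> 0 <= m <= M -> `|Psi l - Psi m| <= L * `|l - m|) ->
  exists2 l, 0 <= l & Psi l = c.
Proof.
move=> M0 L0 /andP[c0 cM] lip.
pose clamp (x : R) := Num.max 0 (Num.min x M).
have clampI x : 0 <= clamp x <= M.
  by rewrite le_max lexx/= ge_max M0 ge_min lexx orbT.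
have clampE x : 0 <= x <= M -> clamp x = x.
  by move=> /andP[x0 xM]; rewrite /clamp (min_idPl xM) (max_idPr x0).
have clamp_lip x y : `|clamp x - clamp y| <= `|x - y|.
  rewrite /clamp /Num.max /Num.min ler_norml.
  case: (ltP x M) => ?; case: (ltP y M) => ?; case: ltP => ?; case: ltP => ?;
  have := ler_norm (x - y); have := ler_norm (y - x); rewrite (distrC y); lra.
have cont : continuous (Psi \o clamp).
  move=> x; apply/cvgrPdist_le => e e0.
  apply/nbhs_ballP; exists (e / L) => /=; first by rewrite divr_gt0.
  move=> y; rewrite /ball/= => xy.
  apply: (le_trans (lip _ _ (clampI x) (clampI y))).
  rewrite mulrC -ler_pdivlMr//; apply: le_trans (clamp_lip _ _) (ltW xy).
have P0 : (Psi \o clamp) 0 = Psi 0 by rewrite /= clampE// lexx.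
have PM : (Psi \o clamp) M = Psi M by rewrite /= clampE// M0 lexx.
have [|l] := @IVT R (Psi \o clamp) 0 M c M0 (continuous_subspaceT cont).
  by rewrite P0 PM ge_min le_max c0 cM orbT.
rewrite in_itv/= => lM; rewrite clampE// => <-; exists l => //.
by case/andP: lM.
Qed.

End inverse.

Section branching_limits.
Context {R : realType} (alpha beta : R) (pi : levy_measure R).
Context (triple : branching_triple alpha beta pi).
Let Phi := branching_mechanism alpha beta pi.
Implicit Types (l r c : R) (n : nat).

Let piI : (\int[pi]_(t in `]0%R, +oo[) (Num.min t (t ^+ 2))%:E < +oo)%E := bt_integrable triple.

Let mI (i : interval R) : @measurable _ (measurableTypeR R) [set` i].
Proof. exact: measurable_itv. Qed.

Let F n : set (measurableTypeR R) := `]n.+1%:R^-1, +oo[%classic.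

Let bigcupF : \bigcup_n F n = `]0, +oo[%classic.
Proof.
suff H (t : R) : (exists n, n.+1%:R^-1 < t) <-> 0 < t.
  apply/seteqP; split => t; rewrite /= in_itv/= andbT.
    by move=> [n _]; rewrite /F/= in_itv/= andbT => tn; apply/H; exists n.
  by move=> /H[n tn]; exists n => //; rewrite /F/= in_itv/= andbT.
split=> [[n]|t0]; first by apply: lt_trans; rewrite invr_gt0.
exists (Num.truncn t^-1).
by rewrite -[ltRHS]invrK ltf_pV2 ?posrE ?invr_gt0// truncnS_gt.
Qed.

Let ndF : nondecreasing_seq F.
Proof.
apply/nondecreasing_seqP => n; apply/subsetPset => t; rewrite /F/= !in_itv/= !andbT.
by apply: lt_trans; rewrite ltf_pV2 ?posrE// ltr_nat.
Qed.

Let invS_gt0 n : 0 < n.+1%:R^-1 :> R. Proof. by rewrite invr_gt0. Qed.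

(** Monotone convergence along []1 / (n + 1), oo[]. The mean over []0, oo[] may be infinite, whereas
    each tail mean is finite. *)
Lemma tail_mean_limit : ((- alpha)%:E < \int[pi]_(t in `]0%R, +oo[) t%:E)%E ->
  exists2 r, 0 < r & 0 < alpha + \int[pi]_(t in `]r, +oo[) t.
Proof.
move=> H.
have cF : (\int[pi]_(t in F n) t%:E)%E @[n --> \oo] --> (\int[pi]_(t in \bigcup_n F n) t%:E)%E.
  apply: ge0_nondecreasing_set_cvg_integral => //.
  - by move=> n; exact: mI.
  - by move=> n t; rewrite /F/= in_itv/= andbT lee_fin => /(lt_trans (invS_gt0 n))/ltW.
rewrite bigcupF in cF.
apply: contrapT => nH.
have : (\int[pi]_(t in `]0%R, +oo[) t%:E <= (- alpha)%:E)%E.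
  rewrite -(cvg_lim _ cF)//; apply: lime_le; first by apply/cvg_ex; eexists; exact: cF.
  apply: nearW => n.
  rewrite leNgt; apply/negP => Hn; apply: nH; exists n.+1%:R^-1 => //.
  have iid := tail_id_integrable piI (invS_gt0 n).
  have := integrable_fin_num (mI _) iid.
  move=> fin; rewrite -ltrBlDl sub0r -lte_fin /Rintegral fineK//.
by rewrite leNgt H.
Qed.

Lemma levy_integral_ge0 l : 0 <= l ->
  0 <= \int[pi]_(t in `]0, +oo[) (expR (- (l * t)) - 1 + l * t).
Proof.
move=> l0; apply: Rintegral_ge0 => t; rewrite /= in_itv/= andbT => t0.
by have /andP[] := expRN_sub1_le_min (mulr_ge0 l0 (ltW t0)).
Qed.

Lemma levy_integral_tail_le e l : 0 < e -> 0 <= l ->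
  \int[pi]_(t in `]e, +oo[) (expR (- (l * t)) - 1 + l * t) <=
  \int[pi]_(t in `]0, +oo[) (expR (- (l * t)) - 1 + l * t).
Proof.
move=> e0 l0.
have ik := levy_kernel_integrable piI (mI _) (@subset_refl _ (`]0%R, +oo[%classic : set (measurableTypeR R))) l0.
have ike := levy_kernel_integrable piI (mI _) (tail_sub e0) l0.
rewrite /Rintegral fine_le//.
- exact: (integrable_fin_num (mI _) ike).
- exact: (integrable_fin_num (mI _) ik).
apply: ge0_subset_integral => //.
- by case/integrableP : ik.
- move=> t; rewrite /= in_itv/= andbT lee_fin => t0.
  by have /andP[] := expRN_sub1_le_min (mulr_ge0 l0 (ltW t0)).
- exact: tail_sub.
Qed.

(** If [beta > 0], the quadratic term wins: [l >= 1] and [l * beta >= |alpha| + c] suffice.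
    Otherwise some truncated slope [s = alpha + \int_(]e, oo[) t] is positive, and bounding the
    kernel below by [l t - 1] on []e, oo[] gives [Phi l >= s l - q]. *)
Lemma branching_mechanism_unbounded c :
  (0 < beta \/ ((- alpha)%:E < \int[pi]_(t in `]0%R, +oo[) t%:E)%E) -> 0 <= c ->
  exists2 l, 0 <= l & c <= Phi l.
Proof.
move=> H c0.
case: H => [beta0|/tail_mean_limit[e e0 sl]].
  pose l := Num.max 1 ((`|alpha| + c) / beta).
  have l1 : 1 <= l by rewrite le_max lexx.
  have lb : `|alpha| + c <= l * beta by rewrite -ler_pdivrMr// le_max lexx orbT.
  have l0 : 0 <= l by exact: le_trans l1.
  exists l => //; rewrite /Phi /branching_mechanism.
  have := levy_integral_ge0 l0; have := ler_norm (- alpha); rewrite normrN.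
  set J := \int[pi]_(t in _) _; nra.
pose s := alpha + \int[pi]_(t in `]e, +oo[) t.
pose q := fine (pi `]e, +oo[%classic).
have q0 : 0 <= q by exact: fine_ge0.
pose l := (c + q) / s.
have l0 : 0 <= l by apply: divr_ge0; [exact: addr_ge0|exact: ltW].
have ls : l * s = c + q by rewrite /l divfK// lt0r_neq0.
exists l => //; rewrite /Phi /branching_mechanism.
have iid := tail_id_integrable piI e0.
have i1 : pi.-integrable `]e, +oo[ (EFin \o (fun t : R => - 1)).
  by apply: (tail_bounded_integrable piI) => // t _; rewrite normrN1.
have ilid := integrableZl (mI _) l iid.
have : l * \int[pi]_(t in `]e, +oo[) t - q <=
    \int[pi]_(t in `]0, +oo[) (expR (- (l * t)) - 1 + l * t).
  have -> : l * \int[pi]_(t in `]e, +oo[) t - q = \int[pi]_(t in `]e, +oo[) (l * t + - 1).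
    by rewrite RintegralD// RintegralZl// (Rintegral_cst pi (mI _) (-1)) mulN1r.
  have ike := levy_kernel_integrable piI (mI _) (tail_sub e0) l0.
  apply: le_trans (levy_integral_tail_le e0 l0).
  apply: le_Rintegral => //; first exact: (integrableD (mI _) ilid i1).
  by move=> t _; have := expR_ge0 (- (l * t)); lra.
have : 0 <= beta * l ^+ 2 by rewrite mulr_ge0 ?sqr_ge0// (bt_beta_ge0 triple).
move: ls; rewrite /s; lra.
Qed.

Lemma tail_exp_le r l : 0 < r -> 0 <= l ->
  0 <= \int[pi]_(t in `]r, +oo[) expR (- (l * t)) <= fine (pi `]r, +oo[%classic).
Proof.
move=> r0 l0; apply/andP; split; first by apply: Rintegral_ge0 => t _; exact: expR_ge0.
have -> : fine (pi `]r, +oo[%classic) = \int[pi]_(t in `]r, +oo[) (1 : R).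
  by rewrite (Rintegral_cst pi (mI _) 1) mul1r.
have e1 t : r < t -> expR (- (l * t)) <= 1 :> R.
  by move=> rt; rewrite -expR0 ler_expR oppr_le0 mulr_ge0// ltW// (lt_trans r0).
apply: le_Rintegral => //.
- apply: (tail_bounded_integrable piI r0); first exact: measurable_fun_expRN_mul.
  by move=> t rt; rewrite ger0_norm ?expR_ge0// e1.
- by apply: (tail_bounded_integrable piI r0) => // t _; rewrite normr1.
by move=> t; rewrite /= in_itv/= andbT => rt; exact: e1.
Qed.

(** The difference is the integral of [1 - expR (- (l * t))] over []r, oo[]. Thus the growth of Phi
    passes to Phi^r. *)
Lemma branching_le_truncated r l : 0 < r -> 0 <= l ->
  Phi l <= truncated_mechanism alpha beta pi r l.
Proof.
move=> r0 l0; have := truncated_mechanismE piI alpha beta r0 l0.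
by have /andP[] := tail_exp_le r0 l0; rewrite -/Phi; lra.
Qed.

(** The kernel is at most [l t], so Phi^r(l) is at most [l] times [alpha] plus the mean of [pi],
    which the hypothesis makes finite. *)
Lemma truncated_mechanism_le0 r l : 0 < r -> 0 <= l -> beta = 0 ->
  (\int[pi]_(t in `]0%R, +oo[) t%:E <= (- alpha)%:E)%E ->
  truncated_mechanism alpha beta pi r l <= 0.
Proof.
move=> r0 l0 b0 H.
have posE : `]0, +oo[%classic = `]0, r]%classic `|` `]r, +oo[%classic.
  by rewrite (@itv_bndbnd_setU _ _ _ (BRight r))//= ?bnd_simp ltW.
have rsub : `]0, r]%classic `<=` `]0, +oo[%classic by rewrite posE; exact: subsetUl.
have iid : pi.-integrable `]0, +oo[ (EFin \o (fun t : R => t)).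
  apply/integrableP; split; first exact/measurable_EFinP.
  apply: le_lt_trans (ltry (- alpha)); apply: le_trans H.
  rewrite le_eqVlt; apply/orP; left; apply/eqP; apply: eq_integral => t.
  by rewrite inE/= in_itv/= andbT => t0; rewrite gtr0_norm.
have iidr : pi.-integrable `]0, r] (EFin \o (fun t : R => t)).
  by apply: integrableS iid => //; exact: mI.
have Hr : alpha + (\int[pi]_(t in `]r, +oo[) t + \int[pi]_(t in `]0, r]) t) <= 0.
  have : \int[pi]_(t in `]0, +oo[) t <= - alpha.
    by rewrite -lee_fin /Rintegral fineK//; exact: (integrable_fin_num (mI _) iid).
  rewrite posE Rintegral_setU//; first by lra.
  - by rewrite -posE.
  - apply/disj_setPS => t [] /=; rewrite !in_itv/= andbT => /andP[_ tr] rt.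
    by have := lt_le_trans rt tr; rewrite ltxx.
have ilid := integrableZl (mI _) l iidr.
have : \int[pi]_(t in `]0, r]) (expR (- (l * t)) - 1 + l * t) <= l * \int[pi]_(t in `]0, r]) t.
  rewrite -RintegralZl//; apply: le_Rintegral => //.
    exact: (levy_kernel_integrable piI (mI _) rsub l0).
  move=> t; rewrite /= in_itv/= => /andP[t0 _].
  have : expR (- (l * t)) <= 1 by rewrite -expR0 ler_expR oppr_le0 mulr_ge0// ltW.
  lra.
rewrite /truncated_mechanism b0 mul0r addr0.
set J := \int[pi]_(t in `]0, r]) _; set U := \int[pi]_(t in `]r, +oo[) _ in Hr *.
set V := \int[pi]_(t in `]0, r]) _ in Hr *.
move=> JV; have : l * (alpha + (U + V)) <= 0 by rewrite mulr_ge0_le0.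
lra.
Qed.

(** If [Phi l <= 0], then the Levy integral is 0 since all terms are nonnegative; but on each []1 /
    (n + 1), oo[] the kernel is bounded below by a positive constant, so [pi] would vanish there,
    hence on []0, oo[]. *)
Lemma branching_mechanism_gt0 l : pi `]0, +oo[%classic != 0%E -> 0 <= alpha -> 0 < l -> 0 < Phi l.
Proof.
move=> pi0 a0 l0; rewrite ltNge; apply/negP => Pl.
have J0 := levy_integral_ge0 (ltW l0).
have J1 : \int[pi]_(t in `]0, +oo[) (expR (- (l * t)) - 1 + l * t) <= 0.
  move: Pl; rewrite /Phi /branching_mechanism.
  have : 0 <= beta * l ^+ 2 by rewrite mulr_ge0 ?sqr_ge0// (bt_beta_ge0 triple).
  have : 0 <= alpha * l by rewrite mulr_ge0// ltW.
  lra.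
suff : (pi (\bigcup_n F n) <= 0)%E.
  by rewrite bigcupF measure_le0; exact/negP.
apply: measure_bigcup_le => // n; first exact: mI.
pose e : R := n.+1%:R^-1.
have e0 : 0 < e by exact: invS_gt0.
pose k := expR (- (l * e)) - 1 + l * e.
have k0 : 0 < k.
  have : 1 + - (l * e) < expR (- (l * e)) by apply: expR_gt1Dx; rewrite oppr_eq0 lt0r_neq0// mulr_gt0.
  by rewrite /k; lra.
have ike := levy_kernel_integrable piI (mI _) (tail_sub e0) (ltW l0).
have ic : pi.-integrable `]e, +oo[ (EFin \o (fun t : R => k)).
  have i1 : pi.-integrable `]e, +oo[ (EFin \o (fun t : R => 1)).
    by apply: (tail_bounded_integrable piI) => // t _; rewrite normr1.
  have := integrableZl (mI _) k i1.
  by congr (_.-integrable _ _); apply/funext => t /=; rewrite mule1.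
have : k * fine (pi (F n)) <= 0.
  rewrite -(Rintegral_cst pi (mI _) k); apply: le_trans J1.
  apply: le_trans (levy_integral_tail_le e0 (ltW l0)).
  apply: le_Rintegral => // t; rewrite /= in_itv/= andbT => et.
  (* Monotonicity of the kernel in [t], obtained by exchanging the roles of exponent and
     variable. *)
  have /andP[+ _] := expRN_sub1_lip (ltW l0) (ltW e0) (ltW et).
  by rewrite /k (mulrC e) (mulrC t); lra.
rewrite pmulr_rle0// => Fn0.
by rewrite -[leLHS]fineK ?lee_fin//; exact: (tail_fin_num piI).
Qed.

End branching_limits.

(** In (i) the two one-sided bounds meet at the inverse. In (ii) F is positive everywhere, so the
    upper bound holds for arbitrarily large exponents. In (iii) only a null tail is new: then F is
    negative on []0, oo[], and the lower bound holds for arbitrarily small exponents. *)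
Theorem theorem3p5 (R : realType) (d : measure_display) (Omega : measurableType d)
    (alpha beta : R) (pi : levy_measure R)
    (P : R -> probability Omega R) (X : R -> Omega -> R) (x : R)
    (triple : branching_triple alpha beta pi)
    (pi_neq0 : pi `]0, +oo[ != 0%E)
    (CB : CB_process (branching_mechanism alpha beta pi) P X)
    (x_gt0 : 0 < x) :
  [/\ (0 < beta \/
       ((- alpha)%:E < \int[pi]_(theta in `]0%R, +oo[) theta%:E)%E) ->
      forall r : R, 0 < r -> (0 < pi `]r, +oo[%classic)%E ->
      P x [set w | (sup_jump X w <= r%:E)%E] =
      (expR (- (x * branching_inverse (truncated_mechanism alpha beta pi r)
                      (fine (pi `]r, +oo[%classic)))))%:E,
      (beta = 0 /\
       (\int[pi]_(theta in `]0%R, +oo[) theta%:E <= (- alpha)%:E)%E) ->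
      forall r : R, 0 < r -> (0 < pi `]r, +oo[%classic)%E ->
      P x [set w | (sup_jump X w <= r%:E)%E] = 0%E
    & 0 <= alpha ->
      forall r : R, 0 < r ->
      P x [set w | (sup_jump X w <= r%:E)%E] =
      (expR (- (x * branching_inverse (truncated_mechanism alpha beta pi r)
                      (fine (pi `]r, +oo[%classic)))))%:E].
Proof.
have piI := bt_integrable triple.
have x0 := ltW x_gt0.
have tail_gt0 r : 0 < r -> (0 < pi `]r, +oo[%classic)%E -> 0 < fine (pi `]r, +oo[%classic).
  by move=> r0; rewrite -lte_fin fineK//; exact: (tail_fin_num piI).
have mA r : 0 < r -> measurable [set w | (sup_jump X w <= r%:E)%E].
  by move=> r0; exact: (measurable_sup_jump_le CB r0).
have PE r : 0 < r -> P x [set w | (sup_jump X w <= r%:E)%E] =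
    (fine (P x [set w | (sup_jump X w <= r%:E)%E]))%:E.
  by move=> r0; rewrite fineK// fin_num_measure//; exact: mA.
have part1 : (0 < beta \/
       ((- alpha)%:E < \int[pi]_(theta in `]0%R, +oo[) theta%:E)%E) ->
      forall r : R, 0 < r -> (0 < pi `]r, +oo[%classic)%E ->
      P x [set w | (sup_jump X w <= r%:E)%E] =
      (expR (- (x * branching_inverse (truncated_mechanism alpha beta pi r)
                      (fine (pi `]r, +oo[%classic)))))%:E.
  move=> H r r0 pir.
  set c := fine _; set Psi := truncated_mechanism alpha beta pi r.
  have c0 : 0 < c by exact: tail_gt0.
  have Psi0 : Psi 0 = 0 by exact: truncated_mechanism0.
  have star m t : 0 <= m -> 0 <= t <= 1 -> Psi (t * m) <= t * Psi m.
    by move=> m0 t01; apply: truncated_mechanism_star => //; exact: (bt_beta_ge0 triple).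
  have [M M0 cM] := branching_mechanism_unbounded triple H (ltW c0).
  have [L L0 lip] := truncated_mechanism_lip piI alpha r (bt_beta_ge0 triple) M0.
  (* [c] lies between [Psi 0 = 0] and [Psi M >= Phi M >= c]. *)
  have [l l0 Pl] : exists2 l, 0 <= l & Psi l = c.
    apply: (lipschitz_IVT M0 L0 _ lip).
    rewrite -/Psi Psi0 (ltW c0)/= (le_trans cM)//.
    exact: branching_le_truncated.
  have /andP[q0 ql] := largest_zero_bounds Psi0 c0 l0 Pl star.
  have [] := branching_inverse_mem ql Pl; set b := branching_inverse _ _ => qb Pb.
  have b_gt0 : 0 < b.
    rewrite lt_neqAle (le_trans q0 qb) andbT; apply/eqP => b0.
    by move: Pb; rewrite -b0 Psi0 => c00; move: c0; rewrite -c00 ltxx.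
  apply/le_anti/andP; split; last first.
    rewrite (mulrC x); apply: (sup_jump_probability_ge triple CB r0 x0 b_gt0).
    by rewrite -/Psi -/c Pb subrr.
  rewrite PE// lee_fin; apply/ler_addgt0Pr => e e0.
  (* Chosen so that [1 - t = t * e / (b * x)]: replacing [b] by [t * b] costs at most [e], while
     [Psi (t * b) <= t * c < c] gives the strict inequality that the upper bound requires. *)
  pose t := (1 + e / (b * x))^-1.
  have bx0 : 0 < b * x by rewrite mulr_gt0.
  have u0 : 0 < e / (b * x) by rewrite divr_gt0.
  have t0 : 0 < t by rewrite invr_gt0 addr_gt0.
  have t1 : t < 1 by rewrite invf_lt1 ?ltrDl// addr_gt0.
  have tE : t * (1 + e / (b * x)) = 1 by rewrite mulVf// lt0r_neq0// addr_gt0.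
  have : (P x [set w | (sup_jump X w <= r%:E)%E] <= (expR (- ((t * b) * x)))%:E)%E.
    apply: (sup_jump_probability_le triple CB r0 x0) => //; first exact: mulr_gt0.
    rewrite subr_gt0 -/Psi -/c; apply: (le_lt_trans (star _ _ (ltW b_gt0) _)).
      by rewrite (ltW t0) (ltW t1).
    by rewrite Pb gtr_pMl.
  rewrite PE// lee_fin => /le_trans; apply.
  have := @normr_expRN_sub_le R (t * b * x) (x * b).
  rewrite !mulr_ge0 ?(ltW t0) ?(ltW b_gt0)// => /(_ isT isT).
  rewrite (_ : t * b * x - x * b = - ((1 - t) * (b * x))); last by ring.
  rewrite normrN (ger0_norm (_ : 0 <= (1 - t) * (b * x))); last first.
    by apply: mulr_ge0; [rewrite subr_ge0 ltW|exact: ltW].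
  have : (1 - t) * (b * x) <= e.
    have -> : 1 - t = t * (e / (b * x)) by rewrite -{1}tE; ring.
    by rewrite -mulrA divfK ?lt0r_neq0// ler_piMl ?(ltW e0) ?(ltW t1).
  by rewrite ler_norml; lra.
split => //.
- move=> [b0 H] r r0 pir.
  apply/le_anti/andP; split => //.
  rewrite PE// lee_fin; apply/ler_addgt0Pr => e e0; rewrite add0r.
  (* Then [l * x = 1 / e] and [expR (- (1 / e)) <= 1 / (1 + 1 / e) <= e]. *)
  pose l := (e * x)^-1.
  have l0 : 0 < l by rewrite invr_gt0 mulr_gt0.
  have := sup_jump_probability_le triple CB r0 x0 l0 (tail_gt0 _ r0 pir).
  rewrite PE// lee_fin => /(_ _)/le_trans; apply.
    have := truncated_mechanism_le0 triple r0 (ltW l0) b0 H.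
    by have := tail_gt0 _ r0 pir; lra.
  have lx : l * x = e^-1 by rewrite /l invfM -mulrA mulVf ?mulr1// lt0r_neq0.
  have := expRN_le_inv (mulr_ge0 (ltW l0) x0); move/le_trans; apply.
  by rewrite lx -[leRHS]invrK lef_pV2 ?posrE ?addr_gt0 ?invr_gt0// lerDr.
move=> a0 r r0.
have [pir|] := ltP 0%E (pi `]r, +oo[%classic).
  (* As in Markov's inequality, the mean of [pi] is at least [r] times the mass of []r, oo[], hence
     positive, while [- alpha <= 0]. *)
  apply: part1 => //; right.
  apply: (@le_lt_trans _ _ 0%E); first by rewrite lee_fin oppr_le0.
  apply: (@lt_le_trans _ _ (\int[pi]_(t in `]r, +oo[) r%:E)%E).
    by rewrite integral_cst// mule_gt0.
  apply: (@le_trans _ _ (\int[pi]_(t in `]r, +oo[) t%:E)%E).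
    apply: ge0_le_integral => //.
    - by move=> t _; rewrite lee_fin ltW.
    - by move=> t; rewrite /= in_itv/= andbT lee_fin => /ltW.
  apply: ge0_subset_integral => //.
  - by move=> t; rewrite /= in_itv/= andbT lee_fin => /ltW.
  - exact: tail_sub.
(* With a null tail, Phi^r and Phi agree on [[0, oo[] and are positive on []0, oo[]; the largest
   zero and the inverse at 0 are then both 0, and the event must have probability 1. *)
rewrite measure_le0 => /eqP pir; rewrite pir/=.
set Psi := truncated_mechanism alpha beta pi r.
have PsiE l : 0 <= l -> Psi l = branching_mechanism alpha beta pi l.
  move=> l0; have := truncated_mechanismE piI alpha beta r0 l0.
  have := tail_exp_le triple r0 l0; rewrite pir/= => /le_anti <-.
  by rewrite -/Psi; lra.
have Psi_gt0 l : 0 < l -> 0 < Psi l.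
  by move=> l0; rewrite PsiE ?(ltW l0)//; exact: branching_mechanism_gt0.
have Psi0 : Psi 0 = 0 by exact: truncated_mechanism0.
have zero_set : [set l | 0 <= l /\ Psi l = 0] = [set 0].
  apply/seteqP; split=> [l [l0 Pl]|_ ->] //=.
  apply/eqP; rewrite eq_le l0 andbT leNgt; apply/negP => /Psi_gt0.
  by rewrite Pl ltxx.
have lz0 : largest_zero Psi = 0 by rewrite /largest_zero zero_set sup1.
have [] := @branching_inverse_mem _ Psi 0 0 _ Psi0; first by rewrite lz0.
rewrite lz0 => b0 Pb.
have -> : branching_inverse Psi 0 = 0.
  by have : [set l | 0 <= l /\ Psi l = 0] (branching_inverse Psi 0) by []; rewrite zero_set.
rewrite mulr0 oppr0 expR0; apply/le_anti/andP; split.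
  by apply: probability_le1; exact: mA.
rewrite PE// lee_fin; apply/ler_addgt0Pr => e e0.
pose l := e / x.
have l0 : 0 < l by rewrite divr_gt0.
have := sup_jump_probability_ge triple CB r0 x0 l0.
rewrite pir/= -/Psi sub0r oppr_le0 => /(_ (ltW (Psi_gt0 _ l0))).
rewrite PE// lee_fin.
have := expR_ge1Dx (- (l * x)); rewrite /l divfK ?lt0r_neq0//; lra.
Qed.
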